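(* Let $D$ be any closed graph-like qutrit ZX-diagram (no input or output wires). Then $D$ is equivalent, in the qutrit ZX-calculus and up to a nonzero scalar, to a closed graph-like qutrit ZX-diagram $D'$ that contains no $\mathcal N$-spider, no $\mathcal P$-spider, and no pair of $\mathcal M$-spiders connected by an $H$-edge or $H^\dagger$-edge; moreover $D'$ is obtained from $D$ by a finite sequence of rewrite steps, each of which strictly decreases the number of spiders.
   Context: Qutrit ZX-diagrams are built by $\otimes$ and $\circ$ from green $Z$-spiders and red $X$-spiders (each with two phases $\alpha,\beta$), the qutrit Hadamard $H$, swaps, identities and adjoints. With $\omega=e^{2\pi i/3}$, a $Z$-spider with $n$ inputs and $m$ outputs is interpreted as $|0\rangle^{\otimes m}\langle0|^{\otimes n}+e^{i\alpha}|1\rangle^{\otimes m}\langle1|^{\otimes n}+e^{i\beta}|2\rangle^{\otimes m}\langle2|^{\otimes n}$, an $X$-spider analogously in the basis $|+\rangle,|\omega\rangle,|\bar\omega\rangle$ (the Fourier basis), and $H$ as $\tfrac1{\sqrt3}\sum_{i,j}\omega^{ij}|i\rangle\langle j|$. The qutrit ZX-calculus is the standard sound set of rewrite rules for these diagrams (Wang's qutrit ZX-calculus); equivalence is derivable equality up to nonzero scalars. An $H$-edge ($H^\dagger$-edge) is a wire between two spiders through an $H$ ($H^\dagger$) box. A diagram is graph-like if every spider is a green $Z$-spider, spiders are connected only by $H$- or $H^\dagger$-edges, each pair of spiders is connected by at most one such edge, every input/output wire is connected to a spider, and every spider is connected to at most one input or output. Writing an integer phase $k$ for $\tfrac{2\pi}{3}k$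 (mod 3) and denoting a $Z$-spider's phase pair by $(\alpha,\beta)$, the spider families are: $\mathcal M=\{(0,0),(1,2),(2,1)\}$, $\mathcal N=\{(0,1),(1,0),(0,2),(2,0)\}$, $\mathcal P=\{(1,1),(2,2)\}$; an $\mathcal M$-spider (resp. $\mathcal N$-, $\mathcal P$-spider) is a $Z$-spider whose phase pair lies in that set. *)

(* Defs.v *)
From HB Require Import structures.
From mathcomp Require Import all_boot all_order all_algebra.
From mathcomp Require Import reals trigo.
From Stdlib Require Export Relation_Operators.

Set Implicit Arguments.
Unset Strict Implicit.
Unset Printing Implicit Defensive.

Import Order.TTheory GRing.Theory Num.Theory.

Local Open Scope ring_scope.

(* Diagrams are string diagrams presented as networks: generators are listed
   with the names of the wires on their legs, and two legs (or a leg and a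
   boundary point) carrying the same name are joined.  Sequential composition
   is the sharing of names, parallel composition is juxtaposition, identities
   and swaps are left implicit in the naming, so diagrams that differ by a
   deformation only differ by [zx_perm] and [zx_rename] below.  A wire may join
   any two legs; joining two outputs (two inputs) is composing with the cup
   \sum_k |kk> (the cap \sum_k <kk|).

   Interpretation, with w = exp(2 i pi / 3), m outputs and n inputs:
     Zspider : |0..0><0..0| + e^(i a) |1..1><1..1| + e^(i b) |2..2><2..2|;
     Xspider : the same in the basis H|0>, H|1>, H|2>;
     Hbox false : H = 1/sqrt 3 \sum_(j, k) w^(j k) |j><k|;
     Hbox true : the adjoint of H.
   The adjoint of a spider is the spider with inputs and outputs exchanged and
   opposite phases. *)
Inductive node (R : realType) : Type :=
| Zspider of seq nat & seq nat & R & R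
| Xspider of seq nat & seq nat & R & R
| Hbox of bool & nat & nat.

Arguments Zspider {R} ins outs a b.
Arguments Xspider {R} ins outs a b.
Arguments Hbox {R} dag i o.

Section NodeEq.
Variable R : realType.

Definition node_code (v : node R) :
    bool * (seq nat * seq nat) * (R * R) + bool * (nat * nat) :=
  match v with
  | Zspider xs ys a b => inl (false, (xs, ys), (a, b))
  | Xspider xs ys a b => inl (true, (xs, ys), (a, b))
  | Hbox d x y => inr (d, (x, y))
  end.

Definition node_decode
    (c : bool * (seq nat * seq nat) * (R * R) + bool * (nat * nat)) : node R :=
  match c with
  | inl (false, (xs, ys), (a, b)) => Zspider xs ys a b
  | inl (true, (xs, ys), (a, b)) => Xspider xs ys a b
  | inr (d, (x, y)) => Hbox d x y
  end.

Lemma node_codeK : cancel node_code node_decode.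
Proof. by case. Qed.

HB.instance Definition _ := Equality.copy (node R) (can_type node_codeK).

End NodeEq.

Record diagram (R : realType) := Diagram {
  dins : seq nat;
  douts : seq nat;
  dnodes : seq (node R)
}.

Section Diagrams.
Variable R : realType.
Implicit Types (D E : diagram R) (p q h : node R) (C L : seq (node R)).
Implicit Types (a b c d : R) (w x y : nat) (xs ys zs : seq nat).

Definition legs p : seq nat :=
  match p with
  | Zspider xs ys _ _ | Xspider xs ys _ _ => xs ++ ys
  | Hbox _ x y => [:: x; y]
  end.

Definition wires D : seq nat :=
  dins D ++ douts D ++ flatten [seq legs p | p <- dnodes D].

(* Every wire has exactly two ends. *)
Definition wf D : bool := all (fun w => count_mem w (wires D) == 2%N) (wires D).

Definition map_node (f : nat -> nat) p : node R :=
  match p with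
  | Zspider xs ys a b => Zspider (map f xs) (map f ys) a b
  | Xspider xs ys a b => Xspider (map f xs) (map f ys) a b
  | Hbox dag x y => Hbox dag (f x) (f y)
  end.

Definition map_diagram (f : nat -> nat) D : diagram R :=
  Diagram (map f (dins D)) (map f (douts D)) (map (map_node f) (dnodes D)).

Definition is_spider p : bool := if p is Hbox _ _ _ then false else true.
Definition is_green p : bool := if p is Zspider _ _ _ _ then true else false.

Definition n_spiders D : nat := count is_spider (dnodes D).

(* The box [h] has one end on [p] and the other one on [q]. *)
Definition joins h p q : bool :=
  if h is Hbox _ x y then
    (x \in legs p) && (y \in legs q) || (x \in legs q) && (y \in legs p)
  else false.

Definition closed_diagram D : Prop := dins D = [::] /\ douts D = [::].

(* The patterns [perm_eq (dnodes D) [:: p, q & C]] select distinct occurrences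
   of nodes: legless spiders with the same phases are equal as nodes. *)
Record graph_like D : Prop := GraphLike {
  gl_wf : wf D;
  gl_green : all (fun p => is_spider p ==> is_green p) (dnodes D);
  (* no plain wire between two spiders, or from a spider to itself *)
  gl_no_plain : forall p q C, perm_eq (dnodes D) [:: p, q & C] ->
    is_spider p -> is_spider q -> ~~ has (mem (legs p)) (legs q);
  gl_no_loop : forall p, p \in dnodes D -> is_spider p -> uniq (legs p);
  (* every H- or H^dagger-box lies between two distinct spiders *)
  gl_edge : forall h, h \in dnodes D -> ~~ is_spider h ->
    exists p q C, [/\ perm_eq (dnodes D) [:: h, p, q & C],
                      is_spider p, is_spider q & joins h p q];
  gl_simple : forall p q h k C, perm_eq (dnodes D) [:: p, q, h, k & C] ->
    is_spider p -> is_spider q -> ~~ (joins h p q && joins k p q);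
  gl_boundary : forall w, w \in dins D ++ douts D ->
    exists2 p, p \in dnodes D & is_spider p /\ w \in legs p;
  gl_boundary1 : forall p, p \in dnodes D -> is_spider p ->
    (count (mem (legs p)) (dins D ++ douts D) <= 1)%N
}.

Definition eq_mod2pi a b : Prop := exists k : int, a = b + k%:~R * (2 * pi).

(* The integer phase k. *)
Definition third (k : nat) : R := k%:R * (2 * pi / 3).

Definition in_family (F : seq (nat * nat)) p : Prop :=
  if p is Zspider _ _ a b then
    exists2 kl, kl \in F & eq_mod2pi a (third kl.1) /\ eq_mod2pi b (third kl.2)
  else False.

Definition M_spider := in_family [:: (0, 0); (1, 2); (2, 1)]%N.
Definition N_spider := in_family [:: (0, 1); (1, 0); (0, 2); (2, 0)]%N.
Definition P_spider := in_family [:: (1, 1); (2, 2)]%N.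

Definition adjacent_M_pair D : Prop :=
  exists p q h C, [/\ perm_eq (dnodes D) [:: p, q, h & C],
                      M_spider p, M_spider q & joins h p q].

Definition boxes (dag : bool) xs ys : seq (node R) :=
  [seq Hbox dag e.1 e.2 | e <- zip xs ys].

(* Local rules, each of them sound up to a nonzero scalar.  The scalars are
   absorbed in the rules rather than being quotiented out semantically: if
   every closed diagram of nonzero value could be erased, all such diagrams
   would be equivalent. *)
Inductive zx_rule : seq (node R) -> seq (node R) -> Prop :=
| rule_phase xs ys a b c d : eq_mod2pi a c -> eq_mod2pi b d ->
    zx_rule [:: Zspider xs ys a b] [:: Zspider xs ys c d]
  (* legs of a Z-spider commute and bend *)
| rule_legs xs ys xs' ys' a b : perm_eq (xs ++ ys) (xs' ++ ys') ->
    zx_rule [:: Zspider xs ys a b] [:: Zspider xs' ys' a b]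
| rule_fusion xs ys zs xs' ys' a b c d : zs != [::] ->
    zx_rule [:: Zspider xs (zs ++ ys) a b; Zspider (zs ++ xs') ys' c d]
            [:: Zspider (xs ++ xs') (ys ++ ys') (a + c) (b + d)]
  (* H H^dagger = H^dagger H = 1, the identity being the 1-1 spider, which
     [zx_wire] turns into a plain wire *)
| rule_H_unitary dag x y z :
    zx_rule [:: Hbox dag x y; Hbox (~~ dag) y z] [:: Zspider [:: x] [:: z] 0 0]
  (* H is a symmetric matrix *)
| rule_H_transpose dag x y : zx_rule [:: Hbox dag x y] [:: Hbox dag y x]
  (* H H = H^dagger H^dagger, the dualiser |j> -> |-j> *)
| rule_dualiser x y z y' :
    zx_rule [:: Hbox false x y; Hbox false y z]
            [:: Hbox true x y'; Hbox true y' z]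
  (* conjugating a Z-spider by dualisers exchanges its phases *)
| rule_dualiser_Z xs ys zs a b : size ys = size xs -> size zs = size xs ->
    zx_rule [:: Zspider [::] xs a b]
            (Zspider [::] zs b a :: boxes false zs ys ++ boxes false ys xs)
  (* colour change *)
| rule_colour xs ys xs' ys' a b : size xs' = size xs -> size ys' = size ys ->
    zx_rule [:: Xspider xs ys a b]
            (Zspider xs' ys' a b :: boxes true xs xs' ++ boxes false ys' ys)
  (* Euler decomposition of H *)
| rule_Euler x y z t :
    zx_rule [:: Hbox false x t]
            [:: Zspider [:: x] [:: y] (third 2) (third 2);
                Xspider [:: y] [:: z] (third 2) (third 2);
                Zspider [:: z] [:: t] (third 2) (third 2)]
| rule_copy x ys a b :
    zx_rule [:: Xspider [::] [:: x] 0 0; Zspider [:: x] ys a b]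
            [seq Xspider [::] [:: y] 0 0 | y <- ys]
| rule_bialgebra x y z t x1 x2 y1 y2 w :
    zx_rule [:: Zspider [:: x] [:: x1; x2] 0 0; Zspider [:: y] [:: y1; y2] 0 0;
                Xspider [:: x1; y1] [:: z] 0 0; Xspider [:: x2; y2] [:: t] 0 0]
            [:: Xspider [:: x; y] [:: w] 0 0; Zspider [:: w] [:: z; t] 0 0]
  (* X-Paulis are copied by Z-spiders, and permute their phases *)
| rule_Pauli_copy x y ys zs : size zs = size ys ->
    zx_rule [:: Xspider [:: x] [:: y] (third 1) (third 2); Zspider [:: y] ys 0 0]
            (Zspider [:: x] zs 0 0 ::
             [seq Xspider [:: e.1] [:: e.2] (third 1) (third 2) | e <- zip zs ys])
| rule_Pauli_phase x y y' z a b :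
    zx_rule [:: Zspider [:: x] [:: y] a b;
                Xspider [:: y] [:: z] (third 1) (third 2)]
            [:: Xspider [:: x] [:: y'] (third 1) (third 2);
                Zspider [:: y'] [:: z] (b - a) (- a)]
  (* a legless spider is the scalar 1 + e^(i a) + e^(i b) *)
| rule_scalar a b : ~ (1 + cos a + cos b = 0 /\ sin a + sin b = 0) ->
    zx_rule [:: Zspider [::] [::] a b] [::].

(* In [zx_local] no freshness condition is needed: as both diagrams are
   well-formed, a wire that is internal to [L] or [L'] does not occur
   elsewhere. *)
Inductive zx_equiv : diagram R -> diagram R -> Prop :=
| zx_refl D : zx_equiv D D
| zx_sym D E : zx_equiv D E -> zx_equiv E D
| zx_trans D E F : zx_equiv D E -> zx_equiv E F -> zx_equiv D F
| zx_perm xs ys C C' : perm_eq C C' ->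
    zx_equiv (Diagram xs ys C) (Diagram xs ys C')
| zx_rename f D : {in wires D &, injective f} -> zx_equiv D (map_diagram f D)
| zx_local xs ys L L' C : zx_rule L L' ->
    wf (Diagram xs ys (L ++ C)) -> wf (Diagram xs ys (L' ++ C)) ->
    zx_equiv (Diagram xs ys (L ++ C)) (Diagram xs ys (L' ++ C))
| zx_wire xs ys x y C : x != y ->
    wf (Diagram xs ys (Zspider [:: x] [:: y] 0 0 :: C)) ->
    zx_equiv (Diagram xs ys (Zspider [:: x] [:: y] 0 0 :: C))
             (map_diagram (fun w => if w == y then x else w)
                          (Diagram xs ys C)).

(* A step eliminates one N- or P-spider, or two adjacent M-spiders. *)
Definition rewrite_step D E : Prop :=
  [/\ zx_equiv D E, graph_like E, closed_diagram E &
      ((exists2 p, p \in dnodes D & N_spider p \/ P_spider p) /\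
         n_spiders D = (n_spiders E).+1)
      \/ (adjacent_M_pair D /\ n_spiders D = (n_spiders E).+2)].

End Diagrams.

(* Main.v *)
(* A closed diagram is written as a list of factors whose legs are variables, each
   variable standing for the phase-free green spider that joins its occurrences.
   Graph-like diagrams become graphs with edges H (weight 1) and H^dagger (weight 2
   modulo 3) and phases on the vertices, and since the occurrences of a variable
   are unlimited, the rules can be applied with coinciding external legs.

   The bialgebra rule then eliminates two adjacent phase-free vertices with two
   further neighbours each, and splitting spiders extends this to arbitrary
   neighbourhoods: this is the pivot.  M-phases are linear functions of the
   variable, hence can be traded for an edge to a basis state, which is copied
   away when its vertex is eliminated; so the pivot removes two adjacent
   M-spiders.  N- and P-phases are a quadratic function plus a linear one.  The
   quadratic part is an H-loop, which opens into a triangle on which two pivots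
   eliminate the vertex: this is local complementation.  The parallel edges and
   loops that these eliminations create reduce to single edges and phases.  Every
   step removes one or two spiders, so the procedure terminates. *)
Require Import Defs.
From mathcomp Require Import all_boot all_order all_algebra.
From mathcomp Require Import boolp reals trigo.
From mathcomp Require Import zify ring lra.

Set Implicit Arguments.
Unset Strict Implicit.
Unset Printing Implicit Defensive.

Import Order.TTheory GRing.Theory Num.Theory.

(** Let each variable take values [j] in Z/3. A closed diagram is a sum over all values, an H-edge
    between [j] and [k] is w^(jk) and an H^dagger-edge is w^(-jk). The phase pair (c, 2c) is w^(cj),
    and (c, c) is w^(c j^2) because 4 = 1 modulo 3. So the M-family consists of the linear
    functions, and N and P of those with a nonzero quadratic coefficient, P being the case without
    linear part. Each elimination is a Fourier inversion or a Gauss sum over one or two variables,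
    but it must be derived from the rules instead of being computed. The obstacle is bookkeeping: a
    wire name has two ends, so legs meeting at one vertex carry different names, and spiders would
    have to be unfused before each rule and fused again after it. Variables do this once and for
    all. The price is that a factor list has several drawings: a variable with two occurrences is a
    two-legged spider or a bare wire, and rules need bare wires inside. Everything rests on these
    drawings being equivalent, which is [net_zxe]. *)

Local Notation Ph u a b := (Zspider [::] [:: u] a b).
Local Notation Ed := Hbox.

(** * Factor lists and the diagrams they represent *)

Section Nets.
Variable R : realType.
Implicit Types (p : node R) (C L F : seq (node R)) (bd vs : seq nat).
Implicit Types (g f s : nat -> nat).

Definition allegs L : seq nat := flatten [seq legs p | p <- L].
Definition closedD L : diagram R := Diagram [::] [::] L.
Definition zxe L L' : Prop := zx_equiv (closedD L) (closedD L').
Definition wfl L : bool := wf (closedD L).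
Definition subst (x y : nat) : nat -> nat := fun w => if w == x then y else w.

Lemma allegs_cat L L' : allegs (L ++ L') = allegs L ++ allegs L'.
Proof. by rewrite /allegs map_cat flatten_cat. Qed.

Lemma allegs_cons p L : allegs (p :: L) = legs p ++ allegs L.
Proof. by []. Qed.

Lemma legs_map f p : legs (map_node f p) = map f (legs p).
Proof. by case: p => [xs ys a b|xs ys a b|d x y] //=; rewrite map_cat. Qed.

Lemma allegs_map f L : allegs (map (map_node f) L) = map f (allegs L).
Proof. by elim: L => //= p L IH; rewrite !allegs_cons map_cat IH legs_map. Qed.

Lemma wflP L : reflect (forall w, count_mem w (allegs L) = 0 \/ count_mem w (allegs L) = 2)
  (wfl L).
Proof.
apply: (iffP allP) => [H w|H w]; rewrite /wires /=.
  have [w_in|/count_memPn ->] := boolP (w \in allegs L); last by left.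
  by right; apply/eqP/H.
by rewrite -/(allegs L); case: (H w) => [/eqP|-> //]; rewrite -leqn0 leqNgt -has_count has_pred1 => /negbTE ->.
Qed.

Lemma perm_allegs L L' : perm_eq L L' -> perm_eq (allegs L) (allegs L').
Proof. by move=> e; apply/perm_flatten/perm_map. Qed.

Lemma wfl_perm L L' : perm_eq (allegs L) (allegs L') -> wfl L -> wfl L'.
Proof.
by move=> e /wflP H; apply/wflP => w; rewrite -(permP e).
Qed.

Lemma zxe_refl L : zxe L L. Proof. exact: zx_refl. Qed.
Lemma zxe_sym L L' : zxe L L' -> zxe L' L. Proof. exact: zx_sym. Qed.
Lemma zxe_trans L2 L1 L3 : zxe L1 L2 -> zxe L2 L3 -> zxe L1 L3.
Proof. exact: zx_trans. Qed.
Lemma zxe_perm L L' : perm_eq L L' -> zxe L L'. Proof. exact: zx_perm. Qed.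
Lemma zxe_local L L' C : zx_rule L L' -> wfl (L ++ C) -> wfl (L' ++ C) ->
  zxe (L ++ C) (L' ++ C).
Proof. exact: zx_local. Qed.

Lemma eq_map_node f f' p : {in legs p, f =1 f'} -> map_node f p = map_node f' p.
Proof.
case: p => [xs ys a b|xs ys a b|d x y] /= e.
- by congr Zspider; apply/eq_in_map => w w_in; apply: e; rewrite mem_cat w_in ?orbT.
- by congr Xspider; apply/eq_in_map => w w_in; apply: e; rewrite mem_cat w_in ?orbT.
by rewrite !e ?inE ?eqxx ?orbT.
Qed.

Lemma eq_map_nodes f f' L : {in allegs L, f =1 f'} ->
  map (map_node f) L = map (map_node f') L.
Proof.
elim: L => //= p L IH e; congr cons.
  by apply: eq_map_node => w w_in; apply: e; rewrite mem_cat w_in.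
by apply: IH => w w_in; apply: e; rewrite mem_cat w_in orbT.
Qed.

Lemma map_node_id p : map_node id p = p.
Proof. by case: p => * /=; rewrite ?map_id. Qed.

Lemma map_node_comp f g p : map_node f (map_node g p) = map_node (f \o g) p.
Proof. by case: p => * /=; rewrite -?map_comp. Qed.

Lemma map_nodes_id L : map (map_node id) L = L.
Proof. by rewrite (eq_map map_node_id) map_id. Qed.

Lemma map_nodes_comp f g L :
  map (map_node f) (map (map_node g) L) = map (map_node (f \o g)) L.
Proof. by rewrite -map_comp; apply: eq_map => p; exact: map_node_comp. Qed.

Lemma map_nodes_fix f L : {in allegs L, f =1 id} -> map (map_node f) L = L.
Proof. by move/eq_map_nodes ->; exact: map_nodes_id. Qed.

Lemma zxe_rename f L : {in allegs L &, injective f} -> zxe L (map (map_node f) L).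
Proof. exact: (@zx_rename R f (closedD L)). Qed.

Lemma zxe_wire x y C : x != y -> wfl (Zspider [:: x] [:: y] 0%R 0%R :: C) ->
  zxe (Zspider [:: x] [:: y] 0%R 0%R :: C) (map (map_node (subst y x)) C).
Proof. exact: zx_wire. Qed.

Lemma relabel_node p f ws : map f ws = legs p ->
  exists2 q, legs q = ws & map_node f q = p.
Proof.
have take_drop xs ys : map f ws = xs ++ ys ->
    map f (take (size xs) ws) = xs /\ map f (drop (size xs) ws) = ys.
  by move=> e; rewrite map_take map_drop e take_size_cat // drop_size_cat.
case: p => [xs ys a b|xs ys a b|d x y] /=.
- case/take_drop => e1 e2.
  exists (Zspider (take (size xs) ws) (drop (size xs) ws) a b) => /=.
    exact: cat_take_drop.
  by rewrite e1 e2.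
- case/take_drop => e1 e2.
  exists (Xspider (take (size xs) ws) (drop (size xs) ws) a b) => /=.
    exact: cat_take_drop.
  by rewrite e1 e2.
by case: ws {take_drop} => [|x' [|y' []]] //= [<- <-]; exists (Hbox d x' y').
Qed.

(** Wires can be chosen freely above a given naming, all at once, instead of being named node by
    node. *)
Lemma relabel L f ws : map f ws = allegs L ->
  exists2 C, allegs C = ws & map (map_node f) C = L.
Proof.
elim: L ws => [|p L IH] ws /=; first by case: ws => // _; exists [::].
rewrite allegs_cons => e.
have e1 : map f (take (size (legs p)) ws) = legs p by rewrite map_take e take_size_cat.
have e2 : map f (drop (size (legs p)) ws) = allegs L by rewrite map_drop e drop_size_cat.
have [q q_ws <-] := relabel_node e1; have [C C_ws <-] := IH _ e2.
by exists (q :: C) => //=; rewrite allegs_cons q_ws C_ws cat_take_drop.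
Qed.

Lemma uniq_map_inj f (s : seq nat) : uniq (map f s) -> {in s &, injective f}.
Proof.
elim: s => //= x s IH /andP[nx u] y z; rewrite !inE.
move=> /predU1P[->|ys] /predU1P[->|zs] // e; last exact: IH.
- by rewrite e map_f in nx.
by rewrite -e map_f in nx.
Qed.

(** Both lists have the same shape. As no wire repeats in [C], the matching of positions is a
    function of the wire names. *)
Lemma relabel_unique C C' g g' : map (map_node g) C = map (map_node g') C' ->
  uniq (allegs C) ->
  exists2 f, C' = map (map_node f) C & map f (allegs C) = allegs C'.
Proof.
move=> e uC; have [f fE] : exists f, map f (allegs C) = allegs C'.
  exists (fun w => nth 0 (allegs C') (index w (allegs C))).
  have sz : size (allegs C) = size (allegs C').
    by rewrite -(size_map g) -allegs_map e allegs_map size_map.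
  apply: (@eq_from_nth _ 0); rewrite size_map // => i lt_i.
  by rewrite (nth_map 0) // index_uniq.
exists f => //; elim: C C' e fE {uC} => [|p C IH] [|p' C'] //= [ep eC].
rewrite !allegs_cons map_cat => /eqP.
have sz : size (legs p) = size (legs p').
  by rewrite -(size_map g) -legs_map ep legs_map size_map.
rewrite eqseq_cat ?size_map // => /andP[/eqP e1 /eqP e2].
congr cons; last exact: IH e2.
move: ep e1 {sz e2}; case: p => [xs ys a b|xs ys a b|d x y];
  case: p' => [xs' ys' a' b'|xs' ys' a' b'|d' x' y'] //=.
- case=> ex ey -> -> /eqP; rewrite map_cat eqseq_cat.
    by case/andP=> /eqP -> /eqP ->.
  by rewrite -[RHS](size_map g') -ex !size_map.
- case=> ex ey -> -> /eqP; rewrite map_cat eqseq_cat.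
    by case/andP=> /eqP -> /eqP ->.
  by rewrite -[RHS](size_map g') -ex !size_map.
by case=> -> _ _ [-> ->].
Qed.

Definition fiber g bd v : node R := Zspider [::] [seq w <- bd | g w == v] 0%R 0%R.
Definition verts g bd vs : seq (node R) := [seq fiber g bd v | v <- vs].

Lemma allegs_verts g bd vs w : uniq vs -> {subset map g bd <= vs} ->
  count_mem w (allegs (verts g bd vs)) = count_mem w bd.
Proof.
move=> uvs sub.
have -> : count_mem w (allegs (verts g bd vs)) = count_mem (g w) vs * count_mem w bd.
  elim: vs {uvs sub} => [|v vs IH] //=; rewrite allegs_cons count_cat IH mulnDl.
  congr addn; rewrite /= count_filter; case: eqVneq => [->|neq].
    by rewrite mul1n; apply: eq_count => x /=; case: eqVneq => [->|//]; rewrite eqxx.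
  rewrite mul0n; apply/eqP; rewrite -leqn0 leqNgt -has_count -all_predC.
  by apply/allP => x _ /=; case: eqVneq => //= ->; rewrite eq_sym.
have [w_in|/count_memPn ->] := boolP (w \in bd); last by rewrite muln0.
by rewrite count_uniq_mem // sub ?mul1n // map_f.
Qed.

Lemma verts_sub g bd vs : {subset allegs (verts g bd vs) <= bd}.
Proof.
move=> w /flattenP[l /mapP[q /mapP[v _ ->] ->]].
by rewrite mem_filter => /andP[].
Qed.

(* A factor list [F] has variables as legs, each variable standing for a
   phase-free green spider to which all its occurrences are attached; the phases
   of a vertex are thus carried by a one-legged green spider.  In a
   representation, [C] is [F] with wires in place of variables ([g] maps a wire
   to its variable); a wire occurring twice in [C] represents a variable with
   exactly two occurrences whose green spider has been replaced by a plain
   wire. *)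
Record net F C g bd vs : Prop := Net {
  net_map : map (map_node g) C = F;
  net_le2 : forall w, count_mem w (allegs C) <= 2;
  net_bd : forall w, count_mem w bd = (count_mem w (allegs C) == 1);
  net_uniq : uniq vs;
  net_vs : vs =i map g bd;
  net_inner : forall w w', count_mem w (allegs C) = 2 -> w' \in allegs C ->
    g w' = g w -> w' = w }.

Definition draw C g bd vs := C ++ verts g bd vs.

Lemma net_wf F C g bd vs : net F C g bd vs -> wfl (draw C g bd vs).
Proof.
case=> _ le2 bdE u vsE _; apply/wflP => w; rewrite allegs_cat count_cat.
rewrite allegs_verts //; last by move=> v; rewrite vsE.
by rewrite bdE; case: (count_mem w _) (le2 w) => [|[|[|]]] //; auto.
Qed.

Lemma zxe_bd C g bd bd' vs : perm_eq bd bd' -> wfl (C ++ verts g bd vs) ->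
  zxe (C ++ verts g bd vs) (C ++ verts g bd' vs).
Proof.
move=> e; elim: vs C => [|v vs IH] C /= wfC; first exact: zxe_refl.
have e1 : perm_eq (C ++ fiber g bd v :: verts g bd vs)
    ([:: fiber g bd v] ++ (C ++ verts g bd vs)) by rewrite -(cat1s _ (verts _ _ _)) perm_catCA.
have el : perm_eq [seq w <- bd | g w == v] [seq w <- bd' | g w == v].
  exact: perm_filter.
have wf1 := wfl_perm (perm_allegs e1) wfC.
have wf2 : wfl ([:: fiber g bd' v] ++ (C ++ verts g bd vs)).
  by move: wf1; apply: wfl_perm; rewrite /allegs /= perm_cat2r.
apply: zxe_trans (zxe_perm e1) _.
apply: (@zxe_trans ([:: fiber g bd' v] ++ (C ++ verts g bd vs))).
  by apply: zxe_local => //; apply: rule_legs; rewrite /= el.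
have e2 : perm_eq ([:: fiber g bd' v] ++ (C ++ verts g bd vs))
    (rcons C (fiber g bd' v) ++ verts g bd vs).
  by rewrite -cats1 catA perm_cat2r perm_catC.
apply: zxe_trans (zxe_perm e2) _; rewrite -(cat_rcons (fiber g bd' v)).
by apply: IH; apply: wfl_perm wf2; apply: perm_allegs.
Qed.

Lemma zxe_draw F C C' g bd bd' vs vs' : net F C g bd vs ->
  perm_eq C C' -> perm_eq bd bd' -> perm_eq vs vs' ->
  zxe (draw C g bd vs) (draw C' g bd' vs').
Proof.
move=> n eC ebd evs; apply: zxe_trans (zxe_bd ebd (net_wf n)) _.
by apply: zxe_perm; apply: perm_cat => //; apply: perm_map.
Qed.

(** Without bare wires the only freedom left is the choice of names and the order of legs and
    spiders. *)
Lemma net_draw_unique F C C' g g' bd bd' vs vs' :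
  net F C g bd vs -> net F C' g' bd' vs' -> uniq (allegs C) -> uniq (allegs C') ->
  zxe (draw C g bd vs) (draw C' g' bd' vs').
Proof.
move=> n n' uC uC'.
have [|f eC' fE] := @relabel_unique C C' g g' _ uC.
  by rewrite (net_map n) (net_map n').
have gf : {in allegs C, g' \o f =1 g}.
  apply/eq_in_map; rewrite map_comp fE -!allegs_map.
  by rewrite (net_map n) (net_map n').
have bdC : perm_eq bd (allegs C).
  apply/allP => w _; apply/eqP; rewrite (net_bd n).
  by rewrite count_uniq_mem //; case: (w \in _).
have bdC' : perm_eq bd' (allegs C').
  apply/allP => w _; apply/eqP; rewrite (net_bd n').
  by rewrite count_uniq_mem //; case: (w \in _).
have evs : perm_eq vs vs'.
  apply: uniq_perm (net_uniq n) (net_uniq n') _ => v.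
  rewrite (net_vs n) (net_vs n') (perm_mem (perm_map g bdC)).
  rewrite (perm_mem (perm_map g' bdC')) -fE -map_comp.
  by have /eq_in_map -> := gf.
apply: zxe_trans (zxe_draw n (perm_refl _) bdC evs) _.
apply: zxe_sym; apply: zxe_trans (zxe_draw n' (perm_refl _) bdC' (perm_refl _)) _.
apply: zxe_sym.
have finj : {in allegs C &, injective f}.
  by apply: uniq_map_inj; rewrite fE.
have -> : draw C' g' (allegs C') vs' = map (map_node f) (draw C g (allegs C) vs').
  rewrite /draw map_cat -eC'; congr cat; rewrite /verts -map_comp.
  apply: eq_map => v; rewrite /fiber /= -fE filter_map; congr Zspider; congr map.
  by apply: eq_in_filter => w w_in /=; rewrite -gf.
by apply: zxe_rename; apply: sub_in2 finj => w; rewrite allegs_cat mem_cat => /orP[//|]; exact: verts_sub.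
Qed.

(* Insert the green spider of a variable that was drawn as a plain wire. *)
Lemma net_subdivide F C g bd vs w : net F C g bd vs ->
  count_mem w (allegs C) = 2 ->
  exists C' g' bd' vs', [/\ net F C' g' bd' vs', size bd < size bd'
    & zxe (draw C g bd vs) (draw C' g' bd' vs')].
Proof.
move=> n w2; pose w' := (\max_(v <- allegs C) v).+1.
have fresh v : v \in allegs C -> v != w'.
  by move=> v_in; rewrite neq_ltn ltnS (@leq_bigmax_seq _ _ predT id).
have w_in : w \in allegs C by rewrite -has_pred1 has_count w2.
have [l1 [l2 [l3 eC]]] : exists l1 l2 l3, allegs C = l1 ++ w :: l2 ++ w :: l3.
  move: w2; case/splitPr: w_in => l1 l2 w2.
  have: w \in l1 ++ l2.
    by rewrite -has_pred1 has_count; move: w2; rewrite !count_cat /= eqxx; lia.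
  rewrite mem_cat => /orP[] /splitPr[] l l'.
    by exists l, l', l2; rewrite -catA.
  by exists l1, l, l'.
have nw' : w' \notin allegs C by apply/negP => /fresh; rewrite eqxx.
have sw' : w' != w by rewrite eq_sym fresh.
have s_fix : {in allegs C, subst w' w =1 id}.
  by move=> v /fresh; rewrite /subst => /negbTE ->.
(* Only the second end of [w] is renamed to the fresh [w']; the two ends are then joined by a
   two-legged spider, which [zxe_wire] removes. *)
have [|C' C'E eC'] := @relabel C (subst w' w) (l1 ++ w :: l2 ++ w' :: l3).
  rewrite eC !map_cat /= map_cat /= /subst eqxx -/(subst w' w).
  rewrite (eq_sym w) (negbTE sw').
  by congr (_ ++ _ :: _ ++ _ :: _); rewrite map_id_in // => v v_in; apply: s_fix;
    rewrite eC !(mem_cat, inE) v_in ?orbT.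
pose g' := g \o subst w' w.
have gw' : g' w' = g w by rewrite /g' /subst /= eqxx.
have gE v : v != w' -> g' v = g v by rewrite /g' /subst /= => /negbTE ->.
have cnt v : count_mem v (allegs C') + (v == w) = count_mem v (allegs C) + (v == w').
  by rewrite C'E eC !count_cat /= !count_cat /= ![_ == v]eq_sym; lia.
have cw : count_mem w (allegs C') = 1.
  by move: (cnt w); rewrite eqxx w2 (eq_sym w) (negbTE sw'); lia.
have cw' : count_mem w' (allegs C') = 1.
  by move: (cnt w'); rewrite eqxx (negbTE sw') (count_memPn nw'); lia.
have ceq v : v != w -> v != w' -> count_mem v (allegs C') = count_mem v (allegs C).
  by move=> /negbTE e1 /negbTE e2; move: (cnt v); rewrite e1 e2; lia.
have mem_C' v : v \in allegs C' -> v = w' \/ v \in allegs C.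
  rewrite C'E eC !(mem_cat, inE); have [->|_] := eqVneq v w'; first by left.
  by move=> h; right; move: h; case: (v \in l1); case: (v == w); case: (v \in l2).
have nbd : w \notin bd by apply/count_memPn; rewrite (net_bd n) w2.
have nbd' : w' \notin bd by apply/count_memPn; rewrite (net_bd n) (count_memPn nw').
have bdC v : v \in bd -> v \in allegs C.
  by rewrite -!has_pred1 !has_count (net_bd n); case: (count_mem v _).
have gbd v : v \in bd -> g v != g w.
  move=> v_in; apply: contraNneq nbd => e.
  by rewrite -(net_inner n w2 _ e) // bdC.
have gw_vs : g w \notin vs.
  rewrite (net_vs n); apply/mapP => -[v /gbd + e]; by rewrite e eqxx.
have n' : net F C' g' (w :: w' :: bd) (g w :: vs).
  split.
  - by rewrite -(net_map n) -eC' map_nodes_comp.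
  - move=> v; have := net_le2 n v.
    have [->|e1] := eqVneq v w; first by rewrite cw.
    have [->|e2] := eqVneq v w'; first by rewrite cw'.
    by rewrite ceq.
  - move=> v /=; rewrite (net_bd n) (eq_sym w) (eq_sym w').
    have [->|e1] := eqVneq v w; first by rewrite cw w2 eq_sym (negbTE sw').
    have [->|e2] := eqVneq v w'; first by rewrite cw' (count_memPn nw').
    by rewrite ceq.
  - by rewrite /= gw_vs (net_uniq n).
  - move=> v; rewrite /= !inE gw' gE 1?eq_sym // (net_vs n) orbA orbb; congr orb.
    congr (_ \in _); apply/eq_in_map => u u_in.
    by rewrite gE // fresh // bdC.
  move=> v u v2 u_in e.
  have vw : v != w by apply: contra_eqN v2 => /eqP ->; rewrite cw.
  have vw' : v != w' by apply: contra_eqN v2 => /eqP ->; rewrite cw'.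
  move: v2; rewrite ceq // => v2.
  have [eu|u_C] := mem_C' _ u_in.
    move: e; rewrite eu gw' gE // => /(net_inner n v2 w_in) e.
    by rewrite e eqxx in vw.
  by apply: (net_inner n v2 u_C); move: e; rewrite !gE // fresh.
exists C', g', (w :: w' :: bd), (g w :: vs); split=> //; apply: zxe_sym.
have fw : fiber g' (w :: w' :: bd) (g w) = Zspider [::] [:: w; w'] 0%R 0%R.
  rewrite /fiber /= gw' gE 1?eq_sym // eqxx; congr (Zspider _ [:: _, _ & _]).
  apply/eqP; rewrite -[_ == _]negbK -has_filter; apply/hasPn => v v_in /=.
  by rewrite gE ?gbd // fresh // bdC.
have ev : verts g' (w :: w' :: bd) vs = verts g bd vs.
  apply/eq_in_map => v v_in; rewrite /fiber /= gw' gE 1?eq_sym //.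
  rewrite eq_sym; have /negbTE -> : g w != v by apply: contraNneq gw_vs => ->.
  congr Zspider; apply: eq_in_filter => u u_in; by rewrite gE // fresh // bdC.
have wf' := net_wf n'; move: (wf'); rewrite /draw /= fw ev => wfD.
have e1 : perm_eq (C' ++ Zspider [::] [:: w; w'] 0%R 0%R :: verts g bd vs)
    ([:: Zspider [::] [:: w; w'] 0%R 0%R] ++ (C' ++ verts g bd vs)).
  by rewrite -(cat1s _ (verts _ _ _)) perm_catCA.
apply: zxe_trans (zxe_perm e1) _.
have wf1 := wfl_perm (perm_allegs e1) wfD.
have wf2 : wfl ([:: Zspider [:: w] [:: w'] 0%R 0%R] ++ (C' ++ verts g bd vs)) by [].
apply: (@zxe_trans ([:: Zspider [:: w] [:: w'] 0%R 0%R] ++ (C' ++ verts g bd vs))).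
  by apply: zxe_local => //; apply: rule_legs.
have -> : C ++ verts g bd vs = map (map_node (subst w' w)) (C' ++ verts g bd vs).
  rewrite map_cat eC' map_nodes_fix // => v v_in; apply: s_fix.
  by apply: bdC; apply: verts_sub v_in.
by apply: zxe_wire => //; rewrite eq_sym.
Qed.

Lemma net_uniq_draw F C g bd vs : net F C g bd vs ->
  exists C' g' bd' vs', [/\ net F C' g' bd' vs', uniq (allegs C')
    & zxe (draw C g bd vs) (draw C' g' bd' vs')].
Proof.
(* Each subdivision enlarges [bd], whose size never exceeds the number of legs in [F]. *)
have [k] := ubnP (size (allegs F) - size bd).
elim: k C g bd vs => // k IH C g bd vs lt_k n.
have [uC|] := boolP (uniq (allegs C)).
  by exists C, g, bd, vs; split=> //; apply: zxe_refl.
move=> nu; have [w w2] : exists w, count_mem w (allegs C) = 2.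
  have : has (fun w => count_mem w (allegs C) == 2) (allegs C).
    rewrite -[has _ _]negbK -all_predC; apply: contra nu => /allP nw.
    apply/count_mem_uniq => w; have := net_le2 n w; have [w_in|/count_memPn -> //] := boolP (w \in allegs C).
    have := nw _ w_in; move: w_in; rewrite -has_pred1 has_count /=.
    by case: (count_mem w _) => [|[|[|]]].
  by case/hasP => w _ /eqP; exists w.
have [C1 [g1 [bd1 [vs1 [n1 lt1 e1]]]]] := net_subdivide n w2.
have sz F0 C0 g0 bd0 vs0 : net F0 C0 g0 bd0 vs0 -> size bd0 <= size (allegs F0).
  move=> n0; rewrite -(net_map n0) allegs_map size_map.
  apply: uniq_leq_size => [|v].
    apply/count_mem_uniq => v; rewrite -has_pred1 has_count (net_bd n0).
    by case: (_ == 1).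
  by rewrite -!has_pred1 !has_count (net_bd n0); case: (count_mem v _).
have [|C2 [g2 [bd2 [vs2 [n2 u2 e2]]]]] := IH _ _ _ _ _ n1.
  by have := sz _ _ _ _ _ n1; lia.
by exists C2, g2, bd2, vs2; split=> //; apply: zxe_trans e1 e2.
Qed.

(** Independence of the drawing: both drawings are subdivided until no bare wire is left, where
    uniqueness applies. *)
Lemma net_zxe F C C' g g' bd bd' vs vs' :
  net F C g bd vs -> net F C' g' bd' vs' ->
  zxe (draw C g bd vs) (draw C' g' bd' vs').
Proof.
move=> /net_uniq_draw[C1 [g1 [bd1 [vs1 [n1 u1 e1]]]]].
move=> /net_uniq_draw[C2 [g2 [bd2 [vs2 [n2 u2 e2]]]]].
apply: zxe_trans e1 _; apply: zxe_trans (zxe_sym e2).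
exact: net_draw_unique n1 n2 u1 u2.
Qed.

Lemma net_uniq_intro C g : uniq (allegs C) ->
  net (map (map_node g) C) C g (allegs C) (undup (map g (allegs C))).
Proof.
move=> u; have c w : count_mem w (allegs C) = (w \in allegs C) by rewrite count_uniq_mem.
split=> // [w|w||v|w w']; rewrite ?c ?undup_uniq ?mem_undup //; by case: (w \in _).
Qed.

Lemma net_exists F k : exists C g, [/\ map (map_node g) C = F,
  uniq (allegs C) & {in allegs C, forall w, k <= w}].
Proof.
pose ws := iota k (size (allegs F)).
have [|C CE eC] := @relabel F (fun w => nth 0 (allegs F) (w - k)) ws.
  apply: (@eq_from_nth _ 0); rewrite size_map size_iota // => i lt_i.
  by rewrite (nth_map 0) ?size_iota // nth_iota // addKn.
exists C, (fun w => nth 0 (allegs F) (w - k)); split; rewrite ?CE ?iota_uniq //.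
by move=> w; rewrite mem_iota => /andP[].
Qed.

(** Quantifying over all drawings makes the relation convenient to use; by [feq_intro] it suffices
    to prove it for one pair of drawings. *)
Variant feq F F' : Prop := Feq of
  forall C C' g g' bd bd' vs vs', net F C g bd vs -> net F' C' g' bd' vs' ->
    zxe (draw C g bd vs) (draw C' g' bd' vs').

Lemma feq_intro F F' C C' g g' bd bd' vs vs' :
  net F C g bd vs -> net F' C' g' bd' vs' ->
  zxe (draw C g bd vs) (draw C' g' bd' vs') -> feq F F'.
Proof.
move=> n n' e; split=> C1 C1' g1 g1' bd1 bd1' vs1 vs1' n1 n1'.
apply: zxe_trans (net_zxe n1 n) _; apply: zxe_trans e _; exact: net_zxe n' n1'.
Qed.

Lemma feq_refl F : feq F F.
Proof. by split=> C C' g g' bd bd' vs vs' n n'; exact: net_zxe n n'. Qed.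

Lemma feq_sym F F' : feq F F' -> feq F' F.
Proof.
by case=> e; split=> C C' g g' bd bd' vs vs' n n'; apply: zxe_sym; apply: e n' n.
Qed.

Lemma feq_trans F2 F1 F3 : feq F1 F2 -> feq F2 F3 -> feq F1 F3.
Proof.
case=> e [e']; split=> C C' g g' bd bd' vs vs' n n'.
have [C2 [g2 [eF u2 _]]] := net_exists F2 0.
have n2 := net_uniq_intro g2 u2; rewrite eF in n2.
exact: zxe_trans (e _ _ _ _ _ _ _ _ n n2) (e' _ _ _ _ _ _ _ _ n2 n').
Qed.

Lemma feq_perm F F' : perm_eq F F' -> feq F F'.
Proof.
move=> e; have [C [g [eF uC _]]] := net_exists F 0.
have : perm_eq F' F by rewrite perm_sym.
case/(perm_iotaP (Hbox false 0 0)) => Is; rewrite -eF size_map => Isz eF'.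
pose C' := [seq nth (Hbox false 0 0) C i | i <- Is].
have eC : perm_eq C C'.
  by rewrite perm_sym; apply/(perm_iotaP (Hbox false 0 0)); exists Is.
have eFC : map (map_node g) C' = F'.
  rewrite eF' -map_comp; apply/eq_in_map => i; rewrite (perm_mem Isz) mem_iota => lt_i /=.
  by rewrite (nth_map (Hbox false 0 0)).
have uC' : uniq (allegs C') by rewrite -(perm_uniq (perm_allegs eC)).
have n := net_uniq_intro g uC; have n' := net_uniq_intro g uC'.
rewrite eFC in n'; apply: (feq_intro n n').
apply: (zxe_draw n eC (perm_allegs eC)).
exact: perm_undup (perm_mem (perm_map g (perm_allegs eC))).
Qed.

End Nets.

#[global] Arguments allegs {R} L : simpl never.

(** * Rules instantiated by variables, and green spiders as equalities between variables *)

Section NetRules.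
Variable R : realType.
Implicit Types (p : node R) (C L F : seq (node R)) (bd vs : seq nat).
Implicit Types (g f s : nat -> nat) (a b c d : R).

Definition le2 L : bool := all (fun w => count_mem w (allegs L) <= 2) (allegs L).

Definition same_ends L L' : bool :=
  all (fun w => (count_mem w (allegs L) == 1) == (count_mem w (allegs L') == 1))
    (allegs L ++ allegs L').

Definition inner L : seq nat :=
  [seq w <- allegs L | count_mem w (allegs L) == 2].

(** An inner wire of a rule must stay a bare wire: its variable may have no occurrence besides the
    two ends of that wire. *)
Definition inner_fresh s L F : bool :=
  all (fun w => (s w \notin allegs F) &&
    all (fun w' => (s w' == s w) ==> (w' == w)) (allegs L)) (inner L).

(** A drawing that contains [L] verbatim, so that the rule applies to it literally. Names below [k]
    belong to the rule and are read through [s], the others belong to the context and are read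
    through [g]. *)
Lemma net_rule_side k s L F C g bd :
  {in allegs L, forall w, w < k} -> {in allegs C, forall w, k <= w} ->
  map (map_node g) C = F -> uniq (allegs C) -> le2 L -> inner_fresh s L F ->
  (forall w, count_mem w bd = (count_mem w (allegs (L ++ C)) == 1)) ->
  let h w := if w < k then s w else g w in
  net (map (map_node s) L ++ F) (L ++ C) h bd (undup (map h bd)).
Proof.
move=> Lk Ck eF uC l2 inn bdE h.
have hs : {in allegs L, h =1 s} by move=> w /Lk; rewrite /h => ->.
have hg : {in allegs C, h =1 g} by move=> w /Ck; rewrite /h leqNgt => /negbTE ->.
have cL w : w \in allegs C -> count_mem w (allegs L) = 0.
  by move=> /Ck w_ge; apply/count_memPn/negP => /Lk; rewrite ltnNge w_ge.
have cC w : count_mem w (allegs C) = (w \in allegs C) by rewrite count_uniq_mem.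
split=> //.
- by rewrite map_cat -eF (eq_map_nodes hs) (eq_map_nodes hg).
- move=> w; rewrite allegs_cat count_cat cC.
  have [w_in|_] := boolP (w \in allegs C); first by rewrite cL.
  have [w_in|/count_memPn -> //] := boolP (w \in allegs L).
  by rewrite addn0 (allP l2).
- exact: undup_uniq.
- by move=> v; rewrite mem_undup.
move=> w w'; rewrite allegs_cat count_cat cC mem_cat.
have [w_in|nw] := boolP (w \in allegs C); first by rewrite cL.
rewrite addn0 => w2; have wL : w \in allegs L by rewrite -has_pred1 has_count w2.
have /(allP inn) /andP[w_fresh /allP w_inj] : w \in inner L by rewrite mem_filter /= w2.
case/orP => w'_in.
  by rewrite (hs w wL) (hs w' w'_in) => /eqP /(implyP (w_inj _ w'_in)) /eqP.
rewrite (hs w wL) (hg w' w'_in) => e; case/negP: w_fresh.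
by rewrite -e -eF allegs_map map_f.
Qed.

(* A rule of the calculus applies to factor lists, its external wires being
   instantiated by arbitrary, possibly equal, variables. *)
Lemma feq_rule s L L' F : zx_rule L L' -> le2 L -> le2 L' -> same_ends L L' ->
  inner_fresh s L F -> inner_fresh s L' F ->
  feq (map (map_node s) L ++ F) (map (map_node s) L' ++ F).
Proof.
move=> r l2 l2' ends inn inn'.
pose k := (\max_(w <- allegs L ++ allegs L') w).+1.
have lt_k w : w \in allegs L ++ allegs L' -> w < k.
  by move=> w_in; rewrite ltnS (@leq_bigmax_seq _ _ predT id).
have Lk : {in allegs L, forall w, w < k}.
  by move=> w w_in; apply: lt_k; rewrite mem_cat w_in.
have Lk' : {in allegs L', forall w, w < k}.
  by move=> w w_in; apply: lt_k; rewrite mem_cat w_in orbT.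
have [C [g [eF uC Ck]]] := net_exists F k.
pose bd := [seq w <- undup (allegs (L ++ C)) | count_mem w (allegs (L ++ C)) == 1].
have bdE w : count_mem w bd = (count_mem w (allegs (L ++ C)) == 1).
  rewrite count_uniq_mem ?filter_uniq ?undup_uniq // mem_filter mem_undup.
  by rewrite -has_pred1 has_count; case: (count_mem w _) => [|[|]].
have ends' w : (count_mem w (allegs L) == 1) = (count_mem w (allegs L') == 1).
  have [w_in|] := boolP (w \in allegs L ++ allegs L'); first by have /eqP := allP ends w w_in.
  by rewrite mem_cat negb_or => /andP[/count_memPn -> /count_memPn ->].
have bdE' w : count_mem w bd = (count_mem w (allegs (L' ++ C)) == 1).
  rewrite bdE !allegs_cat !count_cat; have := ends' w.
  have [wC|/count_memPn ->] := boolP (w \in allegs C); last by rewrite !addn0 => ->.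
  have nL : w \notin allegs L by apply/negP => /Lk; rewrite ltnNge Ck.
  have nL' : w \notin allegs L' by apply/negP => /Lk'; rewrite ltnNge Ck.
  by rewrite (count_memPn nL) (count_memPn nL').
have n := net_rule_side Lk Ck eF uC l2 inn bdE.
have n' := net_rule_side Lk' Ck eF uC l2' inn' bdE'.
(* Both sides share [bd], hence their variable spiders, so the two drawings differ only in [L] and
   [L']. *)
apply: (feq_intro n n'); have := net_wf n; have := net_wf n'.
rewrite /draw -!catA => w w'; exact: zxe_local r w' w.
Qed.

Lemma wfl_remove us L L' C : wfl (L ++ C) ->
  perm_eq (allegs L) (us ++ us ++ allegs L') -> wfl (L' ++ C).
Proof.
move=> /wflP H /permP e; apply/wflP => w; have := H w.
by rewrite !allegs_cat !count_cat e !count_cat; lia.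
Qed.

Lemma zxe_legs us vs a b C : perm_eq us vs ->
  wfl (Zspider [::] us a b :: C) ->
  wfl (Zspider [::] vs a b :: C) /\
  zxe (Zspider [::] us a b :: C) (Zspider [::] vs a b :: C).
Proof.
move=> e w; have w' : wfl ([:: Zspider [::] vs a b] ++ C).
  by apply: wfl_perm w; rewrite /= !allegs_cons /= perm_cat2r.
by split=> //; apply: (@zxe_local _ [:: _] [:: _]) => //; apply: rule_legs.
Qed.

Lemma zxe_fuse zs us vs a b c d C : zs != [::] ->
  wfl ([:: Zspider [::] (zs ++ us) a b, Zspider [::] (zs ++ vs) c d & C]) ->
  wfl (Zspider [::] (us ++ vs) (a + c)%R (b + d)%R :: C) /\
  zxe [:: Zspider [::] (zs ++ us) a b, Zspider [::] (zs ++ vs) c d & C]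
      (Zspider [::] (us ++ vs) (a + c)%R (b + d)%R :: C).
Proof.
move=> nz w; have w1 : wfl ([:: Zspider [::] (us ++ vs) (a + c)%R (b + d)%R] ++ C).
  apply: (@wfl_remove zs) (w : wfl ([:: _; _] ++ C)) _.
  rewrite /allegs /= !cats0; apply/permP => P; rewrite !count_cat; lia.
split=> //.
have w2 : wfl ([:: Zspider [::] (zs ++ us) a b; Zspider (zs ++ vs) [::] c d] ++ C).
  by apply: wfl_perm w; rewrite /allegs /= !cats0.
have w3 : wfl ([:: Zspider vs us (a + c)%R (b + d)%R] ++ C).
  apply: wfl_perm w1; rewrite /allegs /= -!catA perm_catCA; exact: perm_refl.
have e1 : zxe [:: Zspider [::] (zs ++ us) a b, Zspider [::] (zs ++ vs) c d & C]
    [:: Zspider [::] (zs ++ us) a b, Zspider (zs ++ vs) [::] c d & C].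
  have pe x y : perm_eq [:: x, y & C] ([:: y; x] ++ C).
    by apply/permP => P /=; lia.
  apply: zxe_trans (zxe_perm (pe _ _)) _; apply: zxe_sym.
  apply: zxe_trans (zxe_perm (pe _ _)) _; apply: zxe_sym.
  apply: (@zxe_local _ [:: _] [:: _]).
  - by apply: rule_legs; rewrite cats0.
  - by apply: wfl_perm w; exact/perm_allegs/pe.
  by apply: wfl_perm w2; exact/perm_allegs/pe.
apply: zxe_trans e1 _.
apply: (@zxe_trans _ (Zspider vs us (a + c)%R (b + d)%R :: C)); last first.
  apply: (@zxe_local _ [:: _] [:: _]) => //.
  by apply: rule_legs; rewrite /= perm_catC.
have := @rule_fusion R [::] us zs vs [::] a b c d nz; rewrite cats0 => r.
exact: (@zxe_local _ [:: _; _] [:: _]).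
Qed.

Lemma net_head F p : exists C q g,
  [/\ map (map_node g) C = F, map_node g q = p & uniq (legs q ++ allegs C)].
Proof.
have [[|q C] [g [//= [e1 e2] u _]]] := net_exists (p :: F) 0.
by exists C, q, g.
Qed.

(** A green spider with legs [x] and [y] forces both variables to be equal: it fuses with the spider
    of [x] and with that of [y], leaving a single variable spider. *)
Lemma feq_merge x y zs a b F : x != y ->
  feq (Zspider [::] (x :: y :: zs) a b :: F)
      (map (map_node (subst x y)) (Zspider [::] (y :: zs) a b :: F)).
Proof.
move=> neq; have [C [q [g []]]] := net_head F (Zspider [::] (x :: y :: zs) a b).
case: q => // -[|//] [|e1 [|e2 es]] // a' b' eF [ex ey ez -> ->].
set B := es ++ allegs C => uB.
pose q := Zspider [::] (e1 :: e2 :: es) a b.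
pose q' := Zspider [::] (e2 :: es) a b.
have sy : subst x y y = y by rewrite /subst eq_sym (negbTE neq).
pose vs := [seq v <- undup (map g B) | (v != x) && (v != y)].
have n : net (Zspider [::] (x :: y :: zs) a b :: F) (q :: C) g (e1 :: e2 :: B) (x :: y :: vs).
  have := @net_uniq_intro _ (q :: C) g uB.
  rewrite [map _ _]/= ex ey ez eF => -[? ? ? u vsE ?]; split=> //.
    by rewrite /= !inE negb_or neq !mem_filter !eqxx andbF /= filter_uniq ?undup_uniq.
  move=> v; rewrite /= ex ey !inE mem_filter mem_undup.
  by case: (v == x); case: (v == y).
have n' : net (map (map_node (subst x y)) (Zspider [::] (y :: zs) a b :: F))
    (q' :: C) (subst x y \o g) (e2 :: B) (y :: vs).
  have uB' : uniq (allegs (q' :: C)) by have /andP[] := uB.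
  have := @net_uniq_intro _ (q' :: C) (subst x y \o g) uB'.
  rewrite -map_nodes_comp [map _ (q' :: C)]/= ey ez eF => -[? ? ? u vsE ?]; split=> //.
    by rewrite /= mem_filter eqxx !andbF /= filter_uniq ?undup_uniq.
  move=> v; rewrite /= ey sy !inE mem_filter mem_undup map_comp.
  have [//|nvy /=] := eqVneq v y; have [->|nvx] := eqVneq v x.
    apply/esym/negbTE/mapP => -[u' _]; rewrite /subst.
    by case: eqVneq => [_ e|/[swap] <-]; rewrite ?e eqxx // in neq *.
  apply/idP/mapP => [v_in|[u' u'_in]]; first by exists v; rewrite // /subst (negbTE nvx).
  by rewrite /subst; case: eqVneq => _ e; rewrite e ?eqxx // in nvy *.
apply: (feq_intro n n').
pose X := [seq w <- B | g w == x]; pose Y := [seq w <- B | g w == y].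
have fx : fiber R g (e1 :: e2 :: B) x = Zspider [::] (e1 :: X) 0%R 0%R.
  by rewrite /fiber /= ex ey eqxx eq_sym (negbTE neq).
have fy : fiber R g (e1 :: e2 :: B) y = Zspider [::] (e2 :: Y) 0%R 0%R.
  by rewrite /fiber /= ex ey eqxx (negbTE neq).
pose Y' := [seq w <- B | subst x y (g w) == y].
have fy' : fiber R (subst x y \o g) (e2 :: B) y = Zspider [::] (e2 :: Y') 0%R 0%R.
  by rewrite /fiber /= ey sy eqxx.
have eXY : perm_eq (X ++ Y) Y'.
  apply/permP => P; rewrite count_cat !count_filter -count_predUI.
  rewrite [X in _ + X](_ : _ = 0) ?addn0.
    apply: eq_count => w /=; rewrite /subst; case: (eqVneq (g w) x) => [->|].
      by rewrite eqxx (negbTE neq) andbT andbF orbF.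
    by rewrite andbF.
  apply/eqP; rewrite -leqn0 leqNgt -has_count; apply/hasPn => w _ /=.
  by case: eqVneq => [->|]; rewrite ?andbF // (negbTE neq) !andbF.
have fv : verts R (subst x y \o g) (e2 :: B) vs = verts R g (e1 :: e2 :: B) vs.
  apply/eq_in_map => v; rewrite mem_filter => /andP[/andP[nvx nvy] _].
  rewrite /fiber /= ex ey sy ![_ == v]eq_sym.
  rewrite (negbTE nvx) (negbTE nvy); congr Zspider; apply: eq_filter => w /=.
  rewrite /subst; case: (eqVneq (g w) x) => [->|//].
  by rewrite ![_ == v]eq_sym (negbTE nvx) (negbTE nvy).
pose D := C ++ verts R g (e1 :: e2 :: B) vs.
have pe : perm_eq (draw (q :: C) g (e1 :: e2 :: B) (x :: y :: vs))
    [:: Zspider [::] (e1 :: e2 :: es) a b, Zspider [::] (e1 :: X) 0%R 0%R,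
        Zspider [::] (e2 :: Y) 0%R 0%R & D].
  rewrite /draw /= fx fy /D perm_cons; apply/permP => P.
  by rewrite /= !count_cat /=; lia.
have pe' : perm_eq (draw (q' :: C) (subst x y \o g) (e2 :: B) (y :: vs))
    [:: Zspider [::] (e2 :: es) a b, Zspider [::] (e2 :: Y') 0%R 0%R & D].
  rewrite /draw /= fy' fv /D perm_cons; apply/permP => P.
  by rewrite /= !count_cat /=; lia.
apply: zxe_trans (zxe_perm pe) _; apply: zxe_sym.
apply: zxe_trans (zxe_perm pe') _; apply: zxe_sym.
have w1 := wfl_perm (perm_allegs pe) (net_wf n).
have w2 := wfl_perm (perm_allegs pe') (net_wf n').
have [w3 e3] := @zxe_fuse [:: e1] (e2 :: es) X a b 0%R 0%R _ isT w1.
apply: zxe_trans e3 _.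
have [w4 e4] := @zxe_fuse [:: e2] (es ++ X) Y _ _ 0%R 0%R _ isT w3.
apply: zxe_trans e4 _.
have [w5 e5] := @zxe_fuse [:: e2] es Y' _ _ 0%R 0%R _ isT w2.
apply: zxe_sym; apply: zxe_trans e5 _; apply: zxe_sym.
rewrite !addr0 in w4 *.
by case: (@zxe_legs ((es ++ X) ++ Y) (es ++ Y') a b D _ w4); rewrite -?catA ?perm_cat2l.
Qed.

(** The one-legged spider fuses into the spider of [y], which survives because [y] occurs in [F].
    Read backwards, this marks a vertex so that it is not lost when its last edge disappears. *)
Lemma feq_unit y F : y \in allegs F ->
  feq (Zspider [::] [:: y] 0%R 0%R :: F) F.
Proof.
have [C [q [g []]]] := net_head F (Zspider [::] [:: y] 0%R 0%R).
case: q => // -[|//] [|e []] // a b eF [ey -> ->] uB.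
pose q : node R := Zspider [::] [:: e] 0%R 0%R; pose B := allegs C.
rewrite -eF allegs_map => y_in.
pose vs := [seq v <- undup (map g B) | v != y].
have vsE : y :: vs =i map g B.
  by move=> v; rewrite inE mem_filter mem_undup; case: eqVneq => // ->.
have uvs : uniq (y :: vs) by rewrite /= mem_filter eqxx filter_uniq ?undup_uniq.
have n : net (map (map_node g) (q :: C)) (q :: C) g (e :: B) (y :: vs).
  have [? ? ? _ _ ?] := @net_uniq_intro _ (q :: C) g uB; split=> // v.
  by rewrite vsE /= ey inE; case: eqVneq => // ->.
have n' : net (map (map_node g) C) C g B (y :: vs).
  by case/andP: uB => _ /(@net_uniq_intro _ _ g) [? ? ? _ _ ?]; split.
move: n; rewrite [map _ _]/= ey => n; apply: (feq_intro n n').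
pose Y := [seq w <- B | g w == y].
have fy : fiber R g (e :: B) y = Zspider [::] (e :: Y) 0%R 0%R.
  by rewrite /fiber /= ey eqxx.
have fv : verts R g (e :: B) vs = verts R g B vs.
  apply/eq_in_map => v; rewrite mem_filter => /andP[nvy _].
  by rewrite /fiber /= ey eq_sym (negbTE nvy).
pose D := C ++ verts R g B vs.
have pe : perm_eq (draw (q :: C) g (e :: B) (y :: vs))
    [:: Zspider [::] [:: e] 0%R 0%R, Zspider [::] (e :: Y) 0%R 0%R & D].
  rewrite /draw /= fy fv /D perm_cons; apply/permP => P.
  by rewrite /= !count_cat /=; lia.
have pe' : perm_eq (draw C g B (y :: vs)) (Zspider [::] Y 0%R 0%R :: D).
  rewrite /draw /D /= -[fiber R g B y]/(Zspider [::] Y 0%R 0%R); apply/permP => P.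
  by rewrite /= !count_cat /=; lia.
apply: zxe_trans (zxe_perm pe) _; apply: zxe_sym.
apply: zxe_trans (zxe_perm pe') _; apply: zxe_sym.
have w1 := wfl_perm (perm_allegs pe) (net_wf n).
have [_] := @zxe_fuse [:: e] [::] Y 0%R 0%R 0%R 0%R _ isT w1.
by rewrite !addr0.
Qed.

End NetRules.

Definition below k (l : seq nat) : bool := all (fun w => w < k) l.

Lemma below_cat k l l' : below k (l ++ l') = below k l && below k l'.
Proof. exact: all_cat. Qed.

Lemma belowP k l : reflect {in l, forall w, w < k} (below k l).
Proof. exact: allP. Qed.

Lemma notin_below k x l : below k l -> k <= x -> x \notin l.
Proof. by move=> /belowP b le_kx; apply/negP => /b; rewrite ltnNge le_kx. Qed.

Lemma bound_ex l : exists k, below k l.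
Proof.
exists (\max_(w <- l) w).+1; apply/allP => w w_in.
by rewrite ltnS (@leq_bigmax_seq _ _ predT id).
Qed.

Lemma substE x y : subst x y x = y. Proof. by rewrite /subst eqxx. Qed.
Lemma substF x y w : w != x -> subst x y w = w.
Proof. by rewrite /subst => /negbTE ->. Qed.

(* A star: [(d, v)] stands for a [d]-edge to the vertex [v]. *)
Fixpoint ends (N : seq (bool * nat)) : seq nat :=
  if N is e :: N' then e.2 :: ends N' else [::].
Fixpoint neg (N : seq (bool * nat)) : seq (bool * nat) :=
  if N is e :: N' then (~~ e.1, e.2) :: neg N' else [::].

Lemma ends_neg N : ends (neg N) = ends N.
Proof. by elim: N => //= e N ->. Qed.

Lemma size_neg N : size (neg N) = size N.
Proof. by elim: N => //= e N ->. Qed.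

(** Labels are signs: [false] (H) is 1 and [true] (H^dagger) is -1. This multiplies all weights of
    [B] by minus the sign of [c], the minus being that of the pivot formula. *)
Definition sgn (c : bool) (B : seq (bool * nat)) : seq (bool * nat) :=
  if c then B else neg B.

Lemma negK B : neg (neg B) = B.
Proof. by elim: B => //= -[l y] B ->; rewrite negbK. Qed.

Lemma sgn_cons c f B : sgn c (f :: B) = (~~ (c (+) f.1), f.2) :: sgn c B.
Proof. by case: c f => -[[] y]. Qed.

Lemma sgn_neg c B : sgn (~~ c) B = neg (sgn c B).
Proof. by case: c; rewrite /= ?negK. Qed.

Lemma sgn_sgn c e B : sgn (~~ c) (sgn e B) = sgn (c (+) e) B.
Proof. by case: c; case: e; rewrite /= ?negK. Qed.

Lemma ends_sgn c B : ends (sgn c B) = ends B.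
Proof. by case: c; rewrite //= ends_neg. Qed.

Lemma size_sgn c B : size (sgn c B) = size B.
Proof. by case: c; rewrite //= size_neg. Qed.

Lemma ends_cat A B : ends (A ++ B) = ends A ++ ends B.
Proof. by elim: A => //= e A ->. Qed.

(** * Lists of edges at a vertex, and the freshness of names in them *)

Section Stars.
Variable R : realType.
Implicit Types (N A B : seq (bool * nat)) (c d : bool) (v x : nat).

Local Notation t1 := (third R 1).
Local Notation t2 := (third R 2).

Fixpoint star v N : seq (node R) :=
  if N is e :: N' then Hbox e.1 v e.2 :: star v N' else [::].
Fixpoint zip_star (xs : seq nat) N : seq (node R) :=
  match xs, N with
  | x :: xs', e :: N' => Hbox e.1 x e.2 :: zip_star xs' N'
  | _, _ => [::]
  end.
Fixpoint units N : seq (node R) := if N is e :: N' then Ph e.2 0%R 0%R :: units N' else [::].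
Fixpoint box_row d (xs ys : seq nat) : seq (node R) :=
  match xs, ys with
  | x :: xs', y :: ys' => Hbox d x y :: box_row d xs' ys'
  | _, _ => [::]
  end.

(* The phases that an X-Pauli leaf puts on the neighbours of its spider. *)
Definition pauli d : R * R := if d then (t1, t2) else (t2, t1).

Fixpoint paulis d N : seq (node R) :=
  if N is e :: N' then Ph e.2 (pauli (d (+) e.1)).1 (pauli (d (+) e.1)).2 :: paulis d N'
  else [::].

Lemma paulis_neg d N : paulis d (neg N) = paulis (~~ d) N.
Proof. by elim: N => //= e N ->; rewrite addbN addNb. Qed.

Fixpoint x_paulis (zs xs : seq nat) : seq (node R) :=
  match zs, xs with
  | z :: zs', x :: xs' => Xspider [:: z] [:: x] t1 t2 :: x_paulis zs' xs'
  | _, _ => [::]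
  end.

Lemma x_paulisE zs xs : [seq Xspider [:: e.1] [:: e.2] t1 t2 | e <- zip zs xs] = x_paulis zs xs.
Proof. by elim: zs xs => [|z zs IH] [|x xs] //=; rewrite IH. Qed.

Lemma perm_x_paulis zs xs : size zs = size xs -> perm_eq (allegs (x_paulis zs xs)) (zs ++ xs).
Proof.
elim: zs xs => [|z zs IH] [|x xs] // sz; have /permP e := IH xs (succn_inj sz).
apply/permP => P; rewrite [x_paulis _ _]/= allegs_cons count_cat e /= !count_cat /=; lia.
Qed.

Lemma notin_x_paulis x zs xs : x \notin zs -> x \notin xs -> x \notin allegs (x_paulis zs xs).
Proof.
elim: zs xs => [|z zs IH] [|y xs] // hx hy.
have [h1 h2] : x != z /\ x \notin zs by apply/andP; rewrite -negb_or -in_cons.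
have [h3 h4] : x != y /\ x \notin xs by apply/andP; rewrite -negb_or -in_cons.
rewrite /= allegs_cons mem_cat negb_or; apply/andP; split; last exact: IH.
by rewrite !inE negb_or h1.
Qed.

Lemma notin_paulis x d N : x \notin ends N -> x \notin allegs (paulis d N).
Proof.
elim: N => // e N IH hx.
have [h1 h2] : x != e.2 /\ x \notin ends N by apply/andP; rewrite -negb_or -in_cons.
rewrite /= allegs_cons mem_cat negb_or; apply/andP; split; last exact: IH.
by rewrite inE.
Qed.

Lemma boxes_rowE d xs ys : boxes R d xs ys = box_row d xs ys.
Proof. by elim: xs ys => [|x xs IH] [|y ys] //=; rewrite -IH. Qed.

Lemma units_sgn c B : units (sgn c B) = units B :> seq (node R).
Proof. by case: c => //=; elim: B => //= e B ->. Qed.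

Lemma star_cat v A B : star v (A ++ B) = star v A ++ star v B :> seq (node R).
Proof. by elim: A => //= e A ->. Qed.

Lemma notin_star x v N : x != v -> x \notin ends N -> x \notin allegs (star v N).
Proof.
move=> xv; elim: N => [|e N IH] //=; rewrite inE negb_or => /andP[xe xN].
by rewrite allegs_cons /= !inE !negb_or xv xe IH.
Qed.

Lemma notin_box_row x d xs ys : x \notin xs -> x \notin ys ->
  x \notin allegs (box_row d xs ys).
Proof.
elim: xs ys => [|x0 xs IH] [|y0 ys] // hx hy.
have [h1 h2] : x != x0 /\ x \notin xs by apply/andP; rewrite -negb_or -in_cons.
have [h3 h4] : x != y0 /\ x \notin ys by apply/andP; rewrite -negb_or -in_cons.
rewrite /= allegs_cons mem_cat negb_or; apply/andP; split; last exact: IH.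
by rewrite !inE negb_or h1.
Qed.

Lemma perm_box_row d xs ys : size xs = size ys ->
  perm_eq (allegs (box_row d xs ys)) (xs ++ ys).
Proof.
elim: xs ys => [|x0 xs IH] [|y0 ys] // sz; have /permP e := IH ys (succn_inj sz).
apply/permP => P; rewrite [box_row d _ _]/=.
by rewrite allegs_cons count_cat e /= !count_cat /=; lia.
Qed.

Lemma notin_zip_star x xs N : x \notin xs -> x \notin ends N -> x \notin allegs (zip_star xs N).
Proof.
elim: xs N => [|x0 xs IH] [|e N] // hx hy.
have [h1 h2] : x != x0 /\ x \notin xs by apply/andP; rewrite -negb_or -in_cons.
have [h3 h4] : x != e.2 /\ x \notin ends N by apply/andP; rewrite -negb_or -in_cons.
rewrite /= allegs_cons mem_cat negb_or; apply/andP; split; last exact: IH.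
by rewrite !inE negb_or h1.
Qed.

Lemma notin_units x N : x \notin ends N -> x \notin allegs (units N).
Proof.
elim: N => // e N IH hx.
have [h1 h2] : x != e.2 /\ x \notin ends N by apply/andP; rewrite -negb_or -in_cons.
rewrite /= allegs_cons mem_cat negb_or; apply/andP; split; last exact: IH.
by rewrite inE.
Qed.

Lemma sub_ends_star v N : {subset ends N <= allegs (star v N)}.
Proof.
elim: N => //= e N IH x; rewrite in_cons allegs_cons mem_cat => /predU1P[->|/IH ->].
  by rewrite /= !in_cons eqxx orbT.
exact: orbT.
Qed.

End Stars.

#[global] Arguments star {R} v N.
#[global] Arguments zip_star {R} xs N.
#[global] Arguments units {R} N.
#[global] Arguments box_row {R} d xs ys.

(* Three disjoint supplies of fresh names, for [o] in {0, 1, 2}. *)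
Fixpoint spread o k n : seq nat :=
  if n is n'.+1 then k + o :: spread o (k + 3) n' else [::].

Lemma size_spread o k n : size (spread o k n) = n.
Proof. by elim: n k => //= n IH k; rewrite IH. Qed.

Lemma spread_ge o k n : {in spread o k n, forall x, k <= x}.
Proof.
elim: n k => //= n IH k x; rewrite inE => /predU1P[->|/IH]; first exact: leq_addr.
by lia.
Qed.

Lemma notin_spread o k n x : x < k -> x \notin spread o k n.
Proof. by move=> lt_k; apply/negP => /spread_ge; rewrite leqNgt lt_k. Qed.

Lemma all_notin_spread o k n l : below k l -> all (fun x => x \notin l) (spread o k n).
Proof. by move=> bk; apply/allP => x /spread_ge; exact: notin_below. Qed.

Lemma perm_spread k n :
  perm_eq (spread 0 k n ++ spread 1 k n ++ spread 2 k n) (iota k (n * 3)).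
Proof.
elim: n k => [//|n IH] k; have {IH} /permP e := IH (k + 3).
rewrite mulSn iotaD.
by apply/permP => P; have := e P; rewrite /= !count_cat /= !count_cat /= addn0 addn1 addn2; lia.
Qed.

Lemma uniq_spread3 k n : uniq (spread 0 k n ++ spread 1 k n ++ spread 2 k n).
Proof. by rewrite (perm_uniq (perm_spread k n)) iota_uniq. Qed.

(** * Factor lists up to order and edge orientation *)

Section Factors.
Variable R : realType.
Implicit Types (p : node R) (C L F G : seq (node R)) (N A B : seq (bool * nat)).
Implicit Types (a b c : R) (d l : bool) (k s u v w x y : nat).

Lemma subst_fresh x y F : x \notin allegs F -> map (map_node (subst x y)) F = F.
Proof.
by move=> nx; apply: map_nodes_fix => w w_in; rewrite substF //; apply: contraNneq nx => <-.
Qed.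

Definition sym_pred (P : pred (node R)) : Prop :=
  forall d u v, P (Hbox d u v) = P (Hbox d v u).

(* Equality of factor lists up to reordering and reorientation of the edges. *)
Definition seqv F F' : Prop := forall P, sym_pred P -> count P F = count P F'.

(** For rules with arbitrarily many legs the side conditions of [feq_rule] cannot be checked by
    computation. Here they follow from listing the outer wires [es] and the inner wires [I] and
    [I']. *)
Lemma feq_rule_perm L L' (es I I' : seq nat) F : zx_rule L L' ->
  perm_eq (allegs L) (es ++ I ++ I) -> perm_eq (allegs L') (es ++ I' ++ I') ->
  uniq (es ++ I) -> uniq (es ++ I') ->
  all (fun w => w \notin allegs F) (I ++ I') -> feq (L ++ F) (L' ++ F).
Proof.
move=> r e e' u u' /allP fr.
have cnt J (M : seq (node R)) w : perm_eq (allegs M) (es ++ J ++ J) -> uniq (es ++ J) ->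
    count_mem w (allegs M) = (w \in es) + (w \in J) + (w \in J) /\ ~~ ((w \in es) && (w \in J)).
  move=> eM; rewrite cat_uniq => /and3P[ues /hasPn dis uJ].
  rewrite (permP eM) !count_cat !count_uniq_mem // addnA; split=> //.
  by apply/negP => /andP[? /dis]; apply/negP; rewrite negbK.
have inn J (M : seq (node R)) : perm_eq (allegs M) (es ++ J ++ J) -> uniq (es ++ J) ->
    {subset J <= I ++ I'} -> inner_fresh id M F.
  move=> eM uM sub; apply/allP => w; rewrite mem_filter.
  have [-> dis] := cnt J M w eM uM => /andP[c2 _]; rewrite fr; last first.
    by apply: sub; move: c2 dis; case: (w \in es); case: (w \in J).
  by apply/allP => w' _; apply/implyP.
rewrite -[L]map_nodes_id -[L']map_nodes_id; apply: feq_rule => //.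
- apply/allP => w _; have [-> ] := cnt I L w e u.
  by case: (w \in es); case: (w \in I).
- apply/allP => w _; have [-> ] := cnt I' L' w e' u'.
  by case: (w \in es); case: (w \in I').
- apply/allP => w _; have [-> ] := cnt I L w e u; have [-> ] := cnt I' L' w e' u'.
  by case: (w \in es); case: (w \in I); case: (w \in I').
- by apply: (inn I) => // w; rewrite mem_cat => ->.
by apply: (inn I') => // w; rewrite mem_cat orbC => ->.
Qed.

Lemma feq_orient1 d u v F : feq (Ed d u v :: F) (Ed d v u :: F).
Proof.
exact: (@feq_rule R (nth 0 [:: u; v]) _ _ F (rule_H_transpose R d 0 1)).
Qed.

Definition orient p : node R :=
  if p is Hbox d u v then if u <= v then Hbox d u v else Hbox d v u else p.

Lemma feq_orient F : feq F (map orient F).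
Proof.
rewrite -[F in feq F]cats0 -[map _ _]cats0.
elim: F [::] => [|p F IH] F0; first exact: feq_refl.
apply: (@feq_trans _ (orient p :: F ++ F0)).
  case: p => //= [xs ys a b|xs ys a b|d u v]; try exact: feq_refl.
  by case: ifP => _; [exact: feq_refl | exact: feq_orient1].
apply: (@feq_trans _ (F ++ orient p :: F0)).
  by apply: feq_perm; rewrite -cat1s -[_ :: F0]cat1s perm_catCA.
apply: feq_trans (IH _) _; apply: feq_perm.
by rewrite -[_ :: F0]cat1s perm_catCA.
Qed.

(** Orienting every edge from its smaller to its larger end is a canonical form, after which both
    lists are permutations of each other. *)
Lemma feq_seqv F F' : seqv F F' -> feq F F'.
Proof.
move=> e; apply: feq_trans (feq_orient F) _.
apply: feq_trans (feq_sym (feq_orient F')); apply: feq_perm; apply/permP => P.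
rewrite !count_map; apply: e => d u v /=.
by case: (ltngtP u v) => [||->].
Qed.

Lemma feq_via L L' F F' : feq L L' -> seqv F L -> seqv L' F' -> feq F F'.
Proof.
by move=> e s1 s2; apply: feq_trans (feq_seqv s1) (feq_trans e (feq_seqv s2)).
Qed.

Lemma feq_vias L L' F F' : feq L L' -> seqv F L' -> seqv L F' -> feq F F'.
Proof. by move/feq_sym; apply: feq_via. Qed.

End Factors.

Ltac seqv_orient P hP :=
  repeat match goal with
  | |- context [P (Hbox ?d ?u ?v)] =>
    match goal with
    | |- context [P (Hbox d v u)] =>
      first [constr_eq u v; fail 1 | rewrite (hP d u v)]
    end
  end.

Ltac gen_counts P :=
  repeat match goal with
  | |- context [nat_of_bool (P ?x)] => generalize (nat_of_bool (P x))
  | |- context [count P ?l] => generalize (count P l)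
  end.

(** Stating [seqv] by counts turns a rearrangement of factors into linear arithmetic over opaque
    counts. *)
Ltac seqv_tac :=
  let P := fresh "P" in let hP := fresh "hP" in
  move=> P hP; rewrite /= ?(map_cat, count_cat, cat_cons) /=;
  rewrite ?count_cat /= ?count_cat /=;
  seqv_orient P hP; gen_counts P; clear; intros; lia.

Ltac mem_tac :=
  rewrite ?(allegs_cons, allegs_cat) ?mem_cat /= ?in_cons ?eqxx ?orbT //.

(* Irrelevant boolean hypotheses make [lia] exponential. *)
Ltac nat_lia :=
  repeat match goal with
  | H : is_true (negb _) |- _ => clear H
  | H : is_true (below _ _) |- _ => clear H
  | H : is_true (all _ _) |- _ => clear H
  | H : is_true (uniq _) |- _ => clear H
  | H : is_true (_ \in _) |- _ => clear H
  | H : _ -> _ |- _ => clear H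
  end; lia.

Ltac hyp_tac := match goal with H : ?G |- ?G => exact H end.

Ltac neq_tac :=
  first [ hyp_tac
        | match goal with H : is_true (?x != ?y) |- is_true (?y != ?x) =>
            rewrite eq_sym; exact H end
        | nat_lia ].

Ltac notin_leaf_tac :=
  first [ hyp_tac | match goal with
  | H : is_true (below ?k ?l) |- is_true (_ \notin ?l) => apply: (notin_below H); nat_lia
  end ].

Ltac notin_list_tac :=
  lazymatch goal with
  | |- is_true (_ \notin allegs (star _ _)) => apply: notin_star
  | |- is_true (_ \notin allegs (zip_star _ _)) => apply: notin_zip_star
  | |- is_true (_ \notin allegs (units _)) => apply: notin_units
  | |- is_true (_ \notin allegs (box_row _ _ _)) => apply: notin_box_row
  | |- is_true (_ \notin allegs (x_paulis _ _ _)) => apply: notin_x_paulis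
  | |- is_true (_ \notin allegs (paulis _ _ _)) => apply: notin_paulis
  | |- is_true (_ \notin ends (neg _)) => rewrite ends_neg
  | |- is_true (_ \notin ends (sgn _ _)) => rewrite ends_sgn
  | |- is_true (_ \notin spread _ _ _) => apply: notin_spread; nat_lia
  end.

Ltac fresh_tac :=
  lazymatch goal with
  | |- is_true (_ && _) => apply/andP; split; fresh_tac
  | |- is_true (_ \in _) => mem_tac
  | |- sub_mem _ _ => apply/allP; rewrite /= ?andbT; fresh_tac
  | |- is_true (_ != _) => neq_tac
  | |- is_true (_ \notin allegs (_ :: _)) =>
      rewrite allegs_cons mem_cat negb_or; fresh_tac
  | |- is_true (_ \notin allegs (_ ++ _)) =>
      rewrite allegs_cat mem_cat negb_or; fresh_tac
  | |- is_true (_ \notin allegs [::]) => done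
  | |- is_true (_ \notin legs _) => simpl; fresh_tac
  | |- is_true (_ \notin _ :: _) => rewrite in_cons negb_or; fresh_tac
  | |- is_true (_ \notin _ ++ _) => rewrite mem_cat negb_or; fresh_tac
  | |- is_true (_ \notin [::]) => done
  | |- is_true (_ \notin _) =>
      first [ notin_leaf_tac | notin_list_tac; fresh_tac | progress simpl; fresh_tac ]
  | |- is_true (all _ _) => first [ hyp_tac | done | progress simpl; fresh_tac ]
  | |- is_true (uniq _) => first [ hyp_tac | done | progress simpl; fresh_tac ]
  | |- _ => first [ hyp_tac | done | nat_lia ]
  end.

(* Replace the left-hand side by [F_], using the equivalence [rl] ([step]) or its
   converse ([steps]). *)
Ltac step F_ rl := apply: (@feq_trans _ F_);
  [apply: feq_via; [apply: rl; fresh_tac | seqv_tac | seqv_tac] | ].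
Ltac steps F_ rl := apply: (@feq_trans _ F_);
  [apply: feq_vias; [apply: rl; fresh_tac | seqv_tac | seqv_tac] | ].
Ltac last_step rl := apply: feq_via; [apply: rl; fresh_tac | seqv_tac | seqv_tac].
Ltac last_steps rl := apply: feq_vias; [apply: rl; fresh_tac | seqv_tac | seqv_tac].

(** * Laws of spiders and edges *)

Section Basic.
Variable R : realType.
Implicit Types (C L F G : seq (node R)) (N A B : seq (bool * nat)).
Implicit Types (a b c : R) (d l : bool) (k m p q r s t u v w x y z : nat).

(** The variables on the legs may coincide, so the permutation is applied to the positions, which
    serve as pairwise distinct wires of the rule. *)
Lemma feq_legs xs ys xs' ys' a b F : perm_eq (xs ++ ys) (xs' ++ ys') ->
  feq (Zspider xs ys a b :: F) (Zspider xs' ys' a b :: F).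
Proof.
rewrite perm_sym => /(perm_iotaP 0)[Is Isz eI]; set s := nth 0 (xs ++ ys).
pose m := size xs; pose m' := size xs'.
have ex : map s (iota 0 m) = xs /\ map s (iota m (size ys)) = ys.
  have : map s (iota 0 m ++ iota m (size ys)) = xs ++ ys.
    by rewrite -iotaD -size_cat -[RHS](mkseq_nth 0).
  rewrite map_cat => /eqP; rewrite eqseq_cat ?size_map ?size_iota //.
  by case/andP=> /eqP -> /eqP ->.
have ex' : map s (take m' Is) = xs' /\ map s (drop m' Is) = ys'.
  have : map s (take m' Is ++ drop m' Is) = xs' ++ ys' by rewrite cat_take_drop eI.
  rewrite map_cat => /eqP; rewrite eqseq_cat; first by case/andP=> /eqP -> /eqP ->.
  rewrite size_map size_takel // -(size_map (nth 0 (xs ++ ys))) -eI size_cat.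
  exact: leq_addr.
pose L := [:: Zspider (iota 0 m) (iota m (size ys)) a b].
pose L' := [:: Zspider (take m' Is) (drop m' Is) a b].
have -> : Zspider xs ys a b :: F = map (map_node s) L ++ F.
  by rewrite /= (proj1 ex) (proj2 ex).
have -> : Zspider xs' ys' a b :: F = map (map_node s) L' ++ F.
  by rewrite /= (proj1 ex') (proj2 ex').
have aL : allegs L = iota 0 (size (xs ++ ys)).
  by rewrite /allegs /= cats0 -iotaD size_cat.
have aL' : allegs L' = Is by rewrite /allegs /= cats0 cat_take_drop.
have e : perm_eq (allegs L') (allegs L) by rewrite aL aL'.
have uL : uniq (allegs L) by rewrite aL iota_uniq.
have in0 M : uniq (allegs M) -> inner M = [::] :> seq nat.
  move=> uM; apply/eqP; rewrite -[_ == _]negbK -has_filter; apply/hasPn => w _.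
  by rewrite count_uniq_mem //; case: (w \in _).
apply: feq_rule.
- by apply: rule_legs; rewrite cat_take_drop -iotaD -size_cat perm_sym.
- by apply/allP => w _; rewrite count_uniq_mem //; case: (w \in _).
- by apply/allP => w _; rewrite (permP e) count_uniq_mem //; case: (w \in _).
- by apply/allP => w _; rewrite (permP e).
- by rewrite /inner_fresh in0.
by rewrite /inner_fresh in0 // (perm_uniq e).
Qed.

Lemma feq_phase u a b c (d : R) F : eq_mod2pi a c -> eq_mod2pi b d ->
  feq (Ph u a b :: F) (Ph u c d :: F).
Proof.
move=> ac bd; have r := @rule_phase R [::] [:: 0] _ _ _ _ ac bd.
exact: (@feq_rule R (nth 0 [:: u]) _ _ F r).
Qed.

Lemma feq_phase_add u a b c (d : R) F :
  feq (Ph u a b :: Ph u c d :: F) (Ph u (a + c)%R (b + d)%R :: F).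
Proof.
have [e /=] := bound_ex (u :: allegs F); move/andP=> [ue be].
have nF : e \notin allegs F by fresh_tac.
have r := @rule_fusion R [::] [::] [:: 0] [::] [:: 1] a b c d isT.
(* A spider between a fresh [e] and [u] is read in two ways: it fuses with the phases at [e], or it
   identifies [e] with [u]. *)
have e1 : feq (Ph e a b :: Zspider [:: e] [:: u] c d :: F) (Ph u (a + c)%R (b + d)%R :: F).
  apply: (@feq_rule R (nth 0 [:: e; u]) _ _ F r) => //.
  by rewrite /inner_fresh /= nF eqxx (_ : (u == e) = false) //; lia.
have e2 : feq (Ph e a b :: Zspider [:: e] [:: u] c d :: F) (Zspider [::] [:: e; u] c d :: Ph e a b :: F).
  apply: (@feq_trans _ (Zspider [:: e] [:: u] c d :: Ph e a b :: F)).
    by apply: feq_seqv; seqv_tac.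
  exact: feq_legs.
apply: feq_trans (e1); apply: feq_sym; apply: feq_trans e2 _.
have neu : e != u by lia.
apply: feq_trans (feq_merge _ _ _ _ neu) _.
rewrite /= substE (substF _ (_ : u != e)); last by rewrite eq_sym.
by rewrite subst_fresh //; apply: feq_seqv; seqv_tac.
Qed.

Lemma feq_scalar v a b F : v \notin allegs F ->
  ~ (1 + cos a + cos b = 0 /\ sin a + sin b = 0)%R -> feq (Ph v a b :: F) F.
Proof.
move=> nv nz.
apply: (@feq_trans _ (Ph v 0%R 0%R :: Ph v a b :: F)).
  by apply: feq_sym; apply: feq_unit; rewrite inE eqxx.
apply: (@feq_trans _ (Ph v 0%R 0%R :: Zspider [:: v] [::] a b :: F)).
  apply: (@feq_trans _ (Ph v a b :: Ph v 0%R 0%R :: F)).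
    by apply: feq_seqv; seqv_tac.
  apply: (@feq_trans _ (Zspider [:: v] [::] a b :: Ph v 0%R 0%R :: F)).
    exact: feq_legs.
  by apply: feq_seqv; seqv_tac.
have r := @rule_fusion R [::] [::] [:: 0] [::] [::] 0%R 0%R a b isT.
rewrite !add0r in r.
apply: (@feq_trans _ (Zspider [::] [::] a b :: F)).
  apply: (@feq_rule R (nth 0 [:: v]) _ _ F r) => //.
  by rewrite /inner_fresh /= nv eqxx.
exact: (@feq_rule R id _ _ F (rule_scalar nz)).
Qed.

(** The scalar 1 + 2 e^(i a) never vanishes, since e^(i a) has modulus 1 and not 1/2. *)
Lemma feq_scalar_diag v a F : v \notin allegs F -> feq (Ph v a a :: F) F.
Proof.
move=> nv; apply: feq_scalar => // -[c0 s0].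
have {}s0 : (sin a = 0)%R by lra.
have {}c0 : (cos a = - (1 / 2))%R by lra.
have := cos2Dsin2 a; rewrite s0 c0; lra.
Qed.

Lemma feq_cancelH d s u v F : s \notin allegs F -> s != u -> s != v ->
  feq (Ed d s u :: Ed (~~ d) s v :: F) (Zspider [::] [:: u; v] 0%R 0%R :: F).
Proof.
move=> ns su sv.
apply: (@feq_trans _ (Ed d u s :: Ed (~~ d) s v :: F)).
  by apply: feq_seqv; seqv_tac.
apply: (@feq_trans _ (Zspider [:: u] [:: v] 0%R 0%R :: F)); last exact: feq_legs.
apply: (@feq_rule R (nth 0 [:: u; s; v]) _ _ F (rule_H_unitary R d 0 1 2)) => //.
by rewrite /inner_fresh /= ns; lia.
Qed.

(** The two opposite edges at [s] compose to the identity, so [u] becomes [v]. The context is split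
    as [G ++ F] so that the substitution only has to be computed on the part containing [u]. *)
Lemma feq_contract d s u v G F : s \notin allegs (G ++ F) -> u \notin allegs F ->
  s != u -> s != v -> u != v ->
  feq (Ed d s u :: Ed (~~ d) s v :: G ++ F)
      (Ph v 0%R 0%R :: map (map_node (subst u v)) G ++ F).
Proof.
move=> ns nu su sv uv; apply: feq_trans (feq_cancelH d ns su sv) _.
apply: feq_trans (feq_merge _ _ _ _ uv) _.
rewrite /= map_cat (subst_fresh _ nu) substF; last by rewrite eq_sym.
exact: feq_refl.
Qed.

Lemma subst_star u v N : u \notin ends N ->
  map (map_node (subst u v)) (@star R u N) = star v N.
Proof.
elim: N => //= e N IH; rewrite inE negb_or => /andP[ue /IH ->].
by rewrite substE substF // eq_sym.
Qed.

Lemma feq_contract_star d s u v a b N F :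
  s \notin allegs F -> u \notin allegs F -> s \notin ends N -> u \notin ends N ->
  s != u -> s != v -> u != v ->
  feq (Ed d s u :: Ed (~~ d) s v :: Ph u a b :: star u N ++ F)
      (Ph v a b :: star v N ++ F).
Proof.
move=> sF uF sN uN su sv uv.
have sE : s \notin allegs (@star R u N) by apply: notin_star.
apply: feq_trans (_ : feq (Ph v 0%R 0%R :: (Ph v a b :: star v N) ++ F) _); last first.
  by apply: feq_unit; rewrite inE eqxx.
apply: feq_trans (@feq_contract d s u v (Ph u a b :: star u N) F _ uF su sv uv) _.
  by rewrite /= allegs_cons /= inE negb_or su allegs_cat mem_cat negb_or sE.
rewrite /= substE subst_star //; exact: feq_refl.
Qed.

Lemma feq_path d1 d u p q v F : p \notin allegs F -> q \notin allegs F ->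
  p != u -> p != v -> q != u -> q != v -> p != q ->
  feq (Ed d1 u p :: Ed d p q :: Ed (~~ d) q v :: F) (Ed d1 u v :: F).
Proof.
move=> pF qF pu pv qu qv pq.
apply: (@feq_trans _ (Ed d q p :: Ed (~~ d) q v :: [:: Ed d1 u p] ++ F)).
  by apply: feq_seqv; seqv_tac.
apply: feq_trans (@feq_contract d q p v _ F _ pF _ qv pv) _.
- by rewrite /= allegs_cons /= !inE !negb_or qu eq_sym pq.
- by rewrite eq_sym.
rewrite /= substE substF; last by rewrite eq_sym.
by apply: feq_unit; rewrite /= !inE eqxx orbT.
Qed.

Lemma feq_dual d u p v F : p \notin allegs F -> p != u -> p != v ->
  feq (Ed d u p :: Ed d p v :: F) (Ed (~~ d) u p :: Ed (~~ d) p v :: F).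
Proof.
move=> pF pu pv; wlog -> : d / d = false.
  move=> H; case: d; last exact: H.
  by apply: feq_sym; apply: H.
apply: (@feq_rule R (nth 0 [:: u; p; v; p]) _ _ F (rule_dualiser R 0 1 2 3)) => //;
by rewrite /inner_fresh /= pF; lia.
Qed.

(** H has order four, so its cube is H^dagger, and conversely. This is how an edge is replaced by
    edges of the other type. *)
Lemma feq_path3 d u p q v F : p \notin allegs F -> q \notin allegs F ->
  p != u -> p != v -> q != u -> q != v -> p != q ->
  feq (Ed d u p :: Ed d p q :: Ed d q v :: F) (Ed (~~ d) u v :: F).
Proof.
move=> pF qF pu pv qu qv pq.
step (Ed (~~ d) u p :: Ed (~~ d) p q :: Ed d q v :: F) (@feq_dual d u p q (Ed d q v :: F)).
have := @feq_path (~~ d) (~~ d) u p q v F; rewrite negbK; exact.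
Qed.

End Basic.

(** * Changing the sign of a variable *)

Section Dualisers.
Variable R : realType.
Implicit Types (C L F G : seq (node R)) (N A B : seq (bool * nat)).
Implicit Types (a b c : R) (d l : bool) (k m n p q r s t u v w x y z : nat).

(** Turns a spider with many legs, the form used by the rules, into edges at the single vertex [v]:
    the auxiliary variables [xs] all merge into [v]. *)
Lemma feq_star v xs N a b F : size xs = size N -> uniq xs ->
  v \notin xs -> all (fun x => x \notin ends N) xs ->
  all (fun x => x \notin allegs F) xs ->
  feq (Zspider [::] (v :: xs) a b :: zip_star xs N ++ F) (Ph v a b :: star v N ++ F).
Proof.
elim: xs N F => [|x xs IH] [|[l y] N] F //=; first by move=> *; apply: feq_refl.
case=> sz /andP[x_xs u]; rewrite inE negb_or => /andP[vx v_xs].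
rewrite inE negb_or => /andP[/andP[xy xN] /allP frN] /andP[xF /allP frF].
apply: (@feq_trans _ (Zspider [::] [:: x, v & xs] a b :: zip_star xs N ++ Ed l x y :: F)).
  apply: feq_trans (feq_legs _ _ _ (_ : perm_eq _ ([::] ++ [:: x, v & xs]))) _.
    by apply/permP => P /=; lia.
  by apply: feq_seqv; seqv_tac.
have xv : x != v by rewrite eq_sym.
apply: feq_trans (feq_merge _ _ _ _ xv) _.
have nEz : x \notin allegs (@zip_star R xs N) by fresh_tac.
rewrite /= map_cat /= (subst_fresh _ xF) (subst_fresh _ nEz) substE.
rewrite (substF _ (_ : v != x)) // (substF _ (_ : y != x)); last by rewrite eq_sym.
have -> : map (subst x v) xs = xs.
  by rewrite map_id_in // => z z_xs; rewrite substF //; apply: contraNneq x_xs => <-.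
apply: feq_trans (IH N (Ed l v y :: F) sz u v_xs _ _) _.
- by apply/allP => z z_xs; have := frN z z_xs; rewrite inE negb_or => /andP[].
- apply/allP => z z_xs; rewrite allegs_cons /= !inE !negb_or frF // andbT.
  have := frN z z_xs; rewrite inE negb_or => /andP[-> _]; rewrite andbT.
  by apply: contraNneq v_xs => <-.
by apply: feq_seqv; seqv_tac.
Qed.

Lemma feq_drop_leg v xs a b F : uniq (v :: xs) -> v \notin allegs F ->
  feq (Zspider [::] (v :: xs) a b :: F) (Zspider [::] xs a b :: F).
Proof.
move=> u nv.
apply: (@feq_trans _ (Ph v 0%R 0%R :: Zspider [::] (v :: xs) a b :: F)).
  by apply: feq_sym; apply: feq_unit; rewrite inE eqxx.
apply: (@feq_trans _ ([:: Ph v 0%R 0%R; Zspider [:: v] xs a b] ++ F)).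
  apply: (@feq_trans _ (Zspider [::] (v :: xs) a b :: Ph v 0%R 0%R :: F)).
    by apply: feq_seqv; seqv_tac.
  apply: feq_trans (feq_legs _ _ _ (_ : perm_eq _ ([:: v] ++ xs))) _ => //.
  by apply: feq_seqv; seqv_tac.
have r := @rule_fusion R [::] [::] [:: v] [::] xs 0%R 0%R a b isT.
rewrite !add0r in r; apply: (@feq_rule_perm _ _ _ xs [:: v] [::] _ r) => //.
- by rewrite /allegs /= cats0; apply/permP => P; rewrite /= !count_cat /=; lia.
- by rewrite cats1 rcons_uniq.
- by rewrite cats0; case/andP: u.
by rewrite /= nv.
Qed.

Lemma feq_star_free v xs N a b F : size xs = size N -> uniq xs ->
  v \notin xs -> v \notin ends N -> v \notin allegs F ->
  all (fun x => x \notin ends N) xs -> all (fun x => x \notin allegs F) xs ->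
  feq (Zspider [::] xs a b :: zip_star xs N ++ F) (Ph v a b :: star v N ++ F).
Proof.
move=> sz u v_xs vN vF h1 h2; apply: feq_trans (feq_star _ _ sz u v_xs h1 h2).
by apply/feq_sym/feq_drop_leg; [rewrite /= v_xs | fresh_tac].
Qed.

(** On each branch two H-boxes precede the edge: the last two boxes cancel if it is an
    H^dagger-edge, and the three form H^dagger if it is an H-edge. The type flips in both cases. *)
Lemma feq_undual N k F : below k (ends N) ->
  let n := size N in
  all (fun x => x \notin allegs F) (spread 0 k n) ->
  all (fun x => x \notin allegs F) (spread 1 k n) ->
  feq (box_row false (spread 2 k n) (spread 1 k n) ++
       box_row false (spread 1 k n) (spread 0 k n) ++ zip_star (spread 0 k n) N ++ F)
      (zip_star (spread 2 k n) (neg N) ++ F).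
Proof.
elim: N k F => [|[l y] N IH] k F /=; first by move=> *; apply: feq_refl.
move=> /andP[yk bN] /andP[k0 h0] /andP[k1 h1]; set n := size N.
have {}bN : below k (ends N) := bN.
have bN3 : below (k + 3) (ends N) by apply: sub_all bN => ?; lia.
have h o : all (fun x => x \notin allegs F) (spread o (k + 3) n) ->
    all (fun x => x \notin allegs (Ed (~~ l) (k + 2) y :: F)) (spread o (k + 3) n).
  move=> /allP ho; apply/allP => x x_in; rewrite allegs_cons mem_cat negb_or ho //.
  by have := spread_ge x_in; rewrite /= !inE; lia.
set G := box_row false (spread 2 (k + 3) n) (spread 1 (k + 3) n) ++
  box_row false (spread 1 (k + 3) n) (spread 0 (k + 3) n) ++ zip_star (spread 0 (k + 3) n) N ++ F.
apply: (@feq_trans _ (Ed (~~ l) (k + 2) y :: G)); last first.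
  apply: (@feq_trans _ (zip_star (spread 2 (k + 3) n) (neg N) ++ Ed (~~ l) (k + 2) y :: F)).
    apply: feq_trans (IH (k + 3) _ bN3 (h 0 h0) (h 1 h1)).
    by apply: feq_seqv; rewrite /G /n; seqv_tac.
  by apply: feq_seqv; seqv_tac.
have e : feq (Ed false (k + 2) (k + 1) :: Ed false (k + 1) (k + 0) :: Ed l (k + 0) y :: G)
    (Ed (~~ l) (k + 2) y :: G).
  by case: (l); [apply: (@feq_path _ false false) | apply: (@feq_path3 _ false)];
    rewrite ?/G; fresh_tac.
by apply: feq_trans e; apply: feq_seqv; rewrite /G; seqv_tac.
Qed.

(** This is the substitution of -j for j in the sum over [v]: the values 1 and 2 are exchanged and
    every edge weight at [v] changes sign. It comes from [rule_dualiser_Z], the dualisers being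
    absorbed by the edges. *)
Lemma feq_flip v a b N F : v \notin ends N -> v \notin allegs F ->
  feq (Ph v a b :: star v N ++ F) (Ph v b a :: star v (neg N) ++ F).
Proof.
move=> vN vF; have [k] := bound_ex (v :: ends N ++ allegs F).
rewrite /= below_cat => /and3P[vk bN bF]; set n := size N.
have u3 := uniq_spread3 k n.
have := u3; rewrite !cat_uniq => /and3P[u0 _ /and3P[u1 _ u2]].
set xs := spread 0 k n in u3 u0 *; set ys := spread 1 k n in u3 u1 *.
set zs := spread 2 k n in u3 u2 *.
have [sx sy sz] : [/\ size xs = n, size ys = n & size zs = n] by rewrite !size_spread.
apply: (@feq_trans _ (Zspider [::] xs a b :: zip_star xs N ++ F)).
  by apply/feq_sym/feq_star_free => //; (exact: notin_spread || exact: all_notin_spread).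
apply: (@feq_trans _ (Zspider [::] zs b a :: zip_star zs (neg N) ++ F)); last first.
  apply: feq_star_free; rewrite ?ends_neg ?size_neg //;
    by (exact: notin_spread || exact: all_notin_spread).
apply: (@feq_trans _ ((Zspider [::] zs b a :: box_row false zs ys ++ box_row false ys xs) ++
    (zip_star xs N ++ F))).
  have := @rule_dualiser_Z R xs ys zs a b (etrans sy (esym sx)) (etrans sz (esym sx)).
  rewrite !boxes_rowE => r.
  apply: (@feq_rule_perm _ _ _ xs [::] (ys ++ zs) _ r).
  - by rewrite /allegs /= !cats0.
  - rewrite allegs_cons allegs_cat; apply/permP => P; rewrite !count_cat /=.
    rewrite (permP (perm_box_row R false (etrans sz (esym sy)))).
    rewrite (permP (perm_box_row R false (etrans sy (esym sx)))) !count_cat.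
    by move: (count P xs) (count P ys) (count P zs) => *; lia.
  - by rewrite cats0.
  - by [].
  apply/allP => w w_in; rewrite allegs_cat mem_cat negb_or.
  have wk : k <= w by move: w_in; rewrite /= mem_cat => /orP[] /spread_ge.
  rewrite (notin_below bF wk) andbT; apply: notin_zip_star; last exact: notin_below bN wk.
  by move: u3; rewrite cat_uniq => /and3P[_ /hasPn h _]; exact: h.
have: uniq ((xs ++ ys) ++ zs) by rewrite -catA.
rewrite cat_uniq => /and3P[_ /hasPn h _].
have dis o : {subset spread o k n <= xs ++ ys} ->
    all (fun x => x \notin allegs (Zspider [::] zs b a :: F)) (spread o k n).
  move=> sub; apply/allP => x x_in; rewrite allegs_cons mem_cat negb_or.
  rewrite (notin_below bF (spread_ge x_in)) andbT /=.
  by apply/negP => /h; rewrite /= sub.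
have s0 : {subset spread 0 k n <= xs ++ ys} by move=> x; rewrite mem_cat => ->.
have s1 : {subset spread 1 k n <= xs ++ ys} by move=> x; rewrite mem_cat orbC => ->.
have := feq_undual bN (dis 0 s0) (dis 1 s1); rewrite -/n -/xs -/ys -/zs => e.
apply: feq_via e _ _.
  by seqv_tac.
by seqv_tac.
Qed.

End Dualisers.

(** * X-spiders as edges, and elimination of a vertex with a phase-free leaf *)

Section Copying.
Variable R : realType.
Implicit Types (C L F G : seq (node R)) (N A B : seq (bool * nat)).
Implicit Types (a b c : R) (d l : bool) (k m n p q r s t u v w x y z : nat).

Local Notation t1 := (third R 1).
Local Notation t2 := (third R 2).

Lemma feq_merge_legs x y xs ys zs a b F : x != y -> x \notin allegs F -> x \notin zs ->
  perm_eq (xs ++ ys) [:: x, y & zs] -> forall G,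
  feq (Zspider xs ys a b :: G ++ F)
      (Zspider [::] (y :: zs) a b :: map (map_node (subst x y)) G ++ F).
Proof.
move=> xy xF xz e G; apply: feq_trans (feq_legs _ _ _ (e : perm_eq _ ([::] ++ _))) _.
apply: feq_trans (feq_merge _ _ _ _ xy) _.
rewrite /= map_cat (subst_fresh _ xF) substF; last by rewrite eq_sym.
rewrite map_id_in; first exact: feq_refl.
by move=> w w_in; rewrite substF //; apply: contraNneq xz => <-.
Qed.

Lemma feq_X11 n u v a b F : n \notin allegs F -> n != u -> n != v ->
  feq (Xspider [:: u] [:: v] a b :: F)
      (Ed true u n :: Ph n a b :: Ed false n v :: F).
Proof.
move=> nF nu nv; have [m /=] := bound_ex (n :: u :: v :: allegs F).
move=> /and4P[mn mu mv mF].
have mF' : m \notin allegs F by fresh_tac.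
apply: (@feq_trans _ (Zspider [:: n] [:: m] a b :: [:: Ed true u n; Ed false m v] ++ F)).
  have := @rule_colour R [:: 0] [:: 1] [:: 2] [:: 3] a b erefl erefl.
  rewrite !boxes_rowE /= => r.
  apply: (@feq_rule R (nth 0 [:: u; v; n; m]) _ _ F r) => //.
  by rewrite /inner_fresh /= nF mF'; lia.
apply: feq_trans (@feq_merge_legs m n [:: n] [:: m] [::] a b F _ _ _ _ _) _ => //.
- by lia.
- by apply/permP => P /=; lia.
rewrite /= substE !substF; [|lia|lia|lia].
by apply: feq_seqv; seqv_tac.
Qed.

Lemma feq_X01 n v a b F : n \notin allegs F -> n != v ->
  feq (Xspider [::] [:: v] a b :: F) (Ph n a b :: Ed false n v :: F).
Proof.
move=> nF nv; have := @rule_colour R [::] [:: 0] [::] [:: 1] a b erefl erefl.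
rewrite !boxes_rowE /= => r; apply: (@feq_rule R (nth 0 [:: v; n]) _ _ F r) => //.
by rewrite /inner_fresh /= nF; lia.
Qed.

Lemma feq_X21 n u v x a b F : n \notin allegs F -> n != u -> n != v -> n != x ->
  feq (Xspider [:: u; v] [:: x] a b :: F)
      (Ed true u n :: Ed true v n :: Ph n a b :: Ed false n x :: F).
Proof.
move=> nF nu nv nx; have [m /=] := bound_ex (n :: u :: v :: x :: allegs F).
move=> /and5P[mn mu mv mx mF].
have mF' : m \notin allegs F by fresh_tac.
have mF1 : m.+1 \notin allegs F by fresh_tac.
apply: (@feq_trans _ (Zspider [:: m; m.+1] [:: n] a b ::
    [:: Ed true u m; Ed true v m.+1; Ed false n x] ++ F)).
  have := @rule_colour R [:: 0; 1] [:: 2] [:: 3; 4] [:: 5] a b erefl erefl.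
  rewrite !boxes_rowE /= => r.
  apply: (@feq_rule R (nth 0 [:: u; v; x; m; m.+1; n]) _ _ F r) => //.
  by rewrite /inner_fresh /= nF mF' mF1; lia.
apply: feq_trans (@feq_merge_legs m n [:: m; m.+1] [:: n] [:: m.+1] a b F _ _ _ _ _) _ => //.
- by lia.
- by rewrite inE; lia.
- by apply/permP => P /=; lia.
rewrite /= substE !substF; try lia.
apply: (@feq_trans _ (Zspider [::] [:: n; m.+1] a b ::
    [:: Ed true u n; Ed true v m.+1; Ed false n x] ++ F)).
  by apply: feq_seqv; seqv_tac.
apply: feq_trans (@feq_merge_legs m.+1 n [::] [:: n; m.+1] [::] a b F _ _ _ _ _) _ => //.
- by lia.
- by apply/permP => P /=; lia.
rewrite /= substE !substF; try lia.
by apply: feq_seqv; seqv_tac.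
Qed.

Lemma feq_Euler u v r F : r \notin allegs F -> r != u -> r != v ->
  feq (Ed false u v :: F) (Ph u t2 t2 :: Ph v t2 t2 :: Ph r t2 t2 ::
    Ed true u r :: Ed false r v :: F).
Proof.
move=> rF ru rv; have [k /=] := bound_ex (r :: u :: v :: allegs F).
move=> /and4P[kr ku kv kF].
have nk : k \notin allegs F by fresh_tac.
have nk1 : k.+1 \notin allegs F by fresh_tac.
apply: (@feq_trans _ ([:: Zspider [:: u] [:: k] t2 t2; Xspider [:: k] [:: k.+1] t2 t2;
    Zspider [:: k.+1] [:: v] t2 t2] ++ F)).
  apply: (@feq_rule R (nth 0 [:: u; k; k.+1; v]) _ _ F (rule_Euler R 0 1 2 3)) => //.
  by rewrite /inner_fresh /= nk nk1; lia.
apply: (@feq_trans _ (Zspider [:: u] [:: k] t2 t2 ::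
    [:: Ed true k r; Ph r t2 t2; Ed false r k.+1; Zspider [:: k.+1] [:: v] t2 t2] ++ F)).
  step (Ed true k r :: Ph r t2 t2 :: Ed false r k.+1 ::
    Zspider [:: u] [:: k] t2 t2 :: Zspider [:: k.+1] [:: v] t2 t2 :: F)
    (@feq_X11 r k k.+1 t2 t2 (Zspider [:: u] [:: k] t2 t2 :: Zspider [:: k.+1] [:: v] t2 t2 :: F)).
  by apply: feq_seqv; seqv_tac.
apply: feq_trans (@feq_merge_legs k u [:: u] [:: k] [::] t2 t2 F _ _ _ _ _) _ => //.
- by lia.
- by apply/permP => P /=; lia.
rewrite /= substE !substF; try lia.
apply: (@feq_trans _ (Zspider [:: k.+1] [:: v] t2 t2 ::
    [:: Ph u t2 t2; Ed true u r; Ph r t2 t2; Ed false r k.+1] ++ F)).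
  by apply: feq_seqv; seqv_tac.
apply: feq_trans (@feq_merge_legs k.+1 v [:: k.+1] [:: v] [::] t2 t2 F _ _ _ _ _) _ => //.
- by lia.
rewrite /= substE !substF; try lia.
by apply: feq_seqv; seqv_tac.
Qed.

Lemma feq_units N F : {subset ends N <= allegs F} -> feq (units N ++ F) F.
Proof.
elim: N => [|e N IH] sub /=; first exact: feq_refl.
have sub' : {subset ends N <= allegs F} by move=> x x_in; apply: sub; rewrite inE x_in orbT.
apply: feq_trans (IH sub'); apply: feq_unit.
by rewrite allegs_cat mem_cat sub ?orbT // mem_head.
Qed.

(** After the colour change two boxes stand in a row: an H^dagger-edge cancels the H, while an
    H-edge forms a dualiser, which fixes the phase-free spider. *)
Lemma feq_X_leaf x l y F : x \notin allegs F -> x != y ->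
  feq (Xspider [::] [:: x] 0%R 0%R :: Ed l x y :: F) (Ph y 0%R 0%R :: F).
Proof.
move=> xF xy; have [n /=] := bound_ex (x :: y :: allegs F) => /and3P[nx ny nF].
step (Ph n 0%R 0%R :: Ed false n x :: Ed l x y :: F)
  (@feq_X01 n x 0%R 0%R (Ed l x y :: F)).
case: l.
  have := @feq_contract_star R false x n y 0%R 0%R [::] F => /= e.
  by last_step e.
have nn : n \notin allegs F by fresh_tac.
have := @rule_dualiser_Z R [:: 0] [:: 1] [:: 2] 0%R 0%R erefl erefl.
rewrite !boxes_rowE /= => r; apply: feq_sym.
apply: (@feq_rule R (nth 0 [:: y; x; n]) _ _ F r) => //.
by rewrite /inner_fresh /= nn xF; lia.
Qed.

Definition x_units (xs : seq nat) : seq (node R) := [seq Xspider [::] [:: x] 0%R 0%R | x <- xs].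

Lemma feq_X_leaves xs N F : size xs = size N -> uniq xs ->
  all (fun x => x \notin ends N) xs -> all (fun x => x \notin allegs F) xs ->
  feq (x_units xs ++ zip_star xs N ++ F) (units N ++ F).
Proof.
elim: xs N F => [|x xs IH] [|[l y] N] F //=; first by move=> *; apply: feq_refl.
move=> [sz] /andP[x_xs u] /andP[+ /allP frN] /andP[xF /allP frF].
rewrite inE negb_or => /andP[xy xN].
have xX : x \notin allegs (x_units xs).
  by elim: (xs) x_xs => //= z zs IHz; rewrite inE negb_or allegs_cons mem_cat negb_or /= mem_seq1 => /andP[-> /IHz].
step (Ph y 0%R 0%R :: x_units xs ++ zip_star xs N ++ F) (@feq_X_leaf x l y (x_units xs ++ zip_star xs N ++ F)).
apply: (@feq_trans _ (x_units xs ++ zip_star xs N ++ Ph y 0%R 0%R :: F)).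
  by apply: feq_seqv; seqv_tac.
apply: (@feq_trans _ (units N ++ Ph y 0%R 0%R :: F)); last by apply: feq_seqv; seqv_tac.
apply: IH => //; apply/allP => z z_xs; have := frN z z_xs; rewrite inE negb_or => /andP[zy zN] //.
by rewrite allegs_cons mem_cat negb_or frF //= inE zy.
Qed.

(** Fourier inversion: the sum over the free leaf [p] forces [q] to be 0. All phases and edges at
    [q] then equal 1, so [a] and [b] disappear and the neighbours keep trivial marks. *)
Lemma feq_copy0 p q a b N F : p != q -> p \notin ends N -> p \notin allegs F ->
  q \notin ends N -> q \notin allegs F ->
  feq (Ed false p q :: Ph q a b :: star q N ++ F) (units N ++ F).
Proof.
move=> pq pN pF qN qF; have [k] := bound_ex (p :: q :: ends N ++ allegs F).
rewrite /= below_cat => /and4P[kp kq bN bF]; pose xs := iota k (size N).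
have sz : size xs = size N by rewrite size_iota.
have u : uniq xs by rewrite iota_uniq.
have ge x : x \in xs -> k <= x by rewrite mem_iota => /andP[].
have qx : q \notin xs by apply/negP => /ge; lia.
have hN : all (fun x => x \notin ends N) xs.
  by apply/allP => x /ge; apply: notin_below.
have hF : all (fun x => x \notin allegs F) xs.
  by apply/allP => x /ge; apply: notin_below.
have hpF : all (fun x => x \notin allegs (Xspider [::] [:: q] 0%R 0%R :: F)) xs.
  apply/allP => x x_in; rewrite allegs_cons mem_cat negb_or /= inE (allP hF) // andbT.
  by apply: contraNneq qx => <-.
steps (Ph p 0%R 0%R :: Ed false p q :: Ph q a b :: star q N ++ F)
  (@feq_unit R p (Ed false p q :: Ph q a b :: star q N ++ F)).
apply: (@feq_trans _ (Xspider [::] [:: q] 0%R 0%R :: Ph q a b :: star q N ++ F)).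
  (* The leaf with its H-edge is a phase-free X-state, which [rule_copy] distributes over the legs
     of the spider [q]. *)
  by apply: feq_sym; apply: feq_X01; fresh_tac.
steps (Zspider [::] (q :: xs) a b :: zip_star xs N ++ Xspider [::] [:: q] 0%R 0%R :: F)
  (@feq_star R q xs N a b (Xspider [::] [:: q] 0%R 0%R :: F)).
apply: feq_trans (feq_X_leaves sz u hN hF).
apply: (@feq_trans _ ([:: Xspider [::] [:: q] 0%R 0%R; Zspider [:: q] xs a b] ++ zip_star xs N ++ F)).
  apply: (@feq_trans _ (Zspider [:: q] xs a b :: Xspider [::] [:: q] 0%R 0%R :: zip_star xs N ++ F)).
    apply: (@feq_trans _ (Zspider [::] (q :: xs) a b :: Xspider [::] [:: q] 0%R 0%R :: zip_star xs N ++ F)).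
      by apply: feq_seqv; seqv_tac.
    exact: feq_legs.
  by apply: feq_seqv; seqv_tac.
have aX : allegs (x_units xs) = xs.
  by elim: (xs) => //= z zs IHz; rewrite allegs_cons /= IHz.
apply: (@feq_rule_perm _ _ _ xs [:: q] [::] _ (rule_copy q xs a b)).
- by rewrite perm_sym perm_catC !allegs_cons /= cats0.
- by rewrite -/(x_units xs) aX /= cats0.
- by rewrite cats1 rcons_uniq qx.
- by rewrite cats0.
by rewrite /= andbT; fresh_tac.
Qed.

Lemma feq_copy e p q a b N F : p != q -> p \notin ends N -> p \notin allegs F ->
  q \notin ends N -> q \notin allegs F ->
  feq (Ed e p q :: Ph q a b :: star q N ++ F) (units N ++ F).
Proof.
move=> pq pN pF qN qF; case: e; last exact: feq_copy0.
have qp : q != p by rewrite eq_sym.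
step (Ed false p q :: Ph q b a :: star q (neg N) ++ F)
  (@feq_flip R q a b ((true, p) :: N) F).
have -> : units N = units (neg N) :> seq (node R) by elim: (N) => //= e N' ->.
by apply: feq_copy0; rewrite ?ends_neg.
Qed.

End Copying.

(** * The bialgebra rule as a statement about edges *)

Section Bialgebra.
Variable R : realType.
Implicit Types (C L F G : seq (node R)) (N A B : seq (bool * nat)).
Implicit Types (a b c : R) (d l : bool) (k m n p q r s t u v w x y z : nat).

Local Notation t1 := (third R 1).
Local Notation t2 := (third R 2).

(** The vertex [m] is the centre of an X-spider with inputs [u], [v] and output [w], and [w] is the
    Z-spider copying the result. The labels are those produced by the colour change: H^dagger on
    inputs, H on the output. Other labels are reached later by relabelling. *)
Lemma feq_bialgebra u v p q m w F : m \notin allegs F -> w \notin allegs F ->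
  m != w -> m != u -> m != v -> m != p -> m != q ->
  w != u -> w != v -> w != p -> w != q ->
  feq ([:: Ed true m u; Ed true m v; Ed false m w; Ed true w p; Ed true w q] ++ F)
      ([:: Ed true u p; Ed true v p; Ed true u q; Ed true v q] ++ F).
Proof.
move=> mF wF mw mu mv mp mq wu wv wp wq.
have [k /=] := bound_ex (m :: w :: u :: v :: p :: q :: allegs F).
move=> /and5P[km kw ku kv /and3P[kp kq kF]].
pose z := k; pose t := k.+1; pose x1 := k.+2; pose x2 := k.+3.
pose y1 := k.+4; pose y2 := k.+4.+1; pose n1 := k.+4.+2; pose n2 := k.+4.+3.
have fr i : k <= i -> i \notin allegs F by move=> ?; fresh_tac.
pose G : seq (node R) := [:: Ed true z p; Ed true t q].
steps (Ph m 0%R 0%R :: [:: Ed true m u; Ed true m v; Ed false m w; Ed true w p; Ed true w q] ++ F)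
  (@feq_unit R m ([:: Ed true m u; Ed true m v; Ed false m w; Ed true w p; Ed true w q] ++ F)).
steps (Xspider [:: u; v] [:: w] 0%R 0%R :: Ed true w p :: Ed true w q :: F)
  (@feq_X21 R m u v w 0%R 0%R (Ed true w p :: Ed true w q :: F)).
steps (Ph w 0%R 0%R :: Xspider [:: u; v] [:: w] 0%R 0%R :: Ed true w p :: Ed true w q :: F)
  (@feq_unit R w (Xspider [:: u; v] [:: w] 0%R 0%R :: Ed true w p :: Ed true w q :: F)).
steps (Zspider [::] [:: w; z; t] 0%R 0%R :: Xspider [:: u; v] [:: w] 0%R 0%R :: Ed true z p :: Ed true t q :: F)
  (@feq_star R w [:: z; t] [:: (true, p); (true, q)] 0%R 0%R (Xspider [:: u; v] [:: w] 0%R 0%R :: F)).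
apply: (@feq_trans _ ([:: Xspider [:: u; v] [:: w] 0%R 0%R; Zspider [:: w] [:: z; t] 0%R 0%R] ++ G ++ F)).
  apply: (@feq_trans _ (Zspider [:: w] [:: z; t] 0%R 0%R :: Xspider [:: u; v] [:: w] 0%R 0%R :: G ++ F)).
    exact: feq_legs.
  by apply: feq_seqv; rewrite /G; seqv_tac.
apply: (@feq_trans _ ([:: Zspider [:: u] [:: x1; x2] 0%R 0%R; Zspider [:: v] [:: y1; y2] 0%R 0%R;
    Xspider [:: x1; y1] [:: z] 0%R 0%R; Xspider [:: x2; y2] [:: t] 0%R 0%R] ++ G ++ F)).
  apply: feq_sym.
  apply: (@feq_rule R (nth 0 [:: u; v; z; t; x1; x2; y1; y2; w]) _ _ (G ++ F)
    (rule_bialgebra R 0 1 2 3 4 5 6 7 8)) => //;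
  rewrite /inner_fresh /G /= !allegs_cons /= !in_cons !negb_or ?wF ?fr /x1 /x2 /y1 /y2 /z /t;
    repeat (apply/andP; split); try done; clear -mw wu wv wp wq km kw ku kv kp kq; lia.
apply: (@feq_trans _ (Zspider [:: u] [:: x1; x2] 0%R 0%R :: [:: Zspider [:: v] [:: y1; y2] 0%R 0%R;
    Xspider [:: x1; y1] [:: z] 0%R 0%R; Xspider [:: x2; y2] [:: t] 0%R 0%R; Ed true z p; Ed true t q] ++ F)).
  by apply: feq_seqv; rewrite /G; seqv_tac.
apply: feq_trans (@feq_merge_legs R x1 u [:: u] [:: x1; x2] [:: x2] _ _ F _ _ _ _ _) _.
- by rewrite /x1; lia.
- by apply: fr; rewrite /x1; lia.
- by rewrite inE /x1 /x2; lia.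
- by apply/permP => P /=; lia.
rewrite /= substE !substF; try (rewrite /x1 /x2 /y1 /y2 /z /t; lia).
apply: (@feq_trans _ (Zspider [::] [:: u; x2] 0%R 0%R :: [:: Zspider [:: v] [:: y1; y2] 0%R 0%R;
    Xspider [:: u; y1] [:: z] 0%R 0%R; Xspider [:: x2; y2] [:: t] 0%R 0%R; Ed true z p; Ed true t q] ++ F)).
  exact: feq_refl.
apply: feq_trans (@feq_merge_legs R x2 u [::] [:: u; x2] [::] _ _ F _ _ _ _ _) _ => //.
- by rewrite /x2; lia.
- by apply: fr; rewrite /x2; lia.
- by apply/permP => P /=; lia.
rewrite /= substE !substF; try (rewrite /x1 /x2 /y1 /y2 /z /t; lia).
apply: (@feq_trans _ (Zspider [:: v] [:: y1; y2] 0%R 0%R :: [:: Ph u 0%R 0%R;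
    Xspider [:: u; y1] [:: z] 0%R 0%R; Xspider [:: u; y2] [:: t] 0%R 0%R; Ed true z p; Ed true t q] ++ F)).
  by apply: feq_seqv; seqv_tac.
apply: feq_trans (@feq_merge_legs R y1 v [:: v] [:: y1; y2] [:: y2] _ _ F _ _ _ _ _) _.
- by rewrite /y1; lia.
- by apply: fr; rewrite /y1; lia.
- by rewrite inE /y1 /y2; lia.
- by apply/permP => P /=; lia.
rewrite /= substE !substF; try (rewrite /x1 /x2 /y1 /y2 /z /t; lia).
apply: (@feq_trans _ (Zspider [::] [:: v; y2] 0%R 0%R :: [:: Ph u 0%R 0%R;
    Xspider [:: u; v] [:: z] 0%R 0%R; Xspider [:: u; y2] [:: t] 0%R 0%R; Ed true z p; Ed true t q] ++ F)).
  exact: feq_refl.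
apply: feq_trans (@feq_merge_legs R y2 v [::] [:: v; y2] [::] _ _ F _ _ _ _ _) _ => //.
- by rewrite /y2; lia.
- by apply: fr; rewrite /y2; lia.
- by apply/permP => P /=; lia.
rewrite /= substE !substF; try (rewrite /x1 /x2 /y1 /y2 /z /t; lia).
(* The H at the output of the X-spider cancels the H^dagger leading to [o], so the whole spider
   reduces to two H^dagger-edges at [o]. *)
have adder n x o G0 : n \notin allegs G0 -> x \notin allegs G0 -> n != x ->
    n != u -> n != v -> n != o -> x != u -> x != v -> x != o ->
    feq (Xspider [:: u; v] [:: x] 0%R 0%R :: Ed true x o :: G0)
        (Ed true u o :: Ed true v o :: Ph o 0%R 0%R :: G0).
  move=> nG xG nx nu nv no xu xv xo.
  step (Ed true u n :: Ed true v n :: Ph n 0%R 0%R :: Ed false n x :: Ed true x o :: G0)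
    (@feq_X21 R n u v x 0%R 0%R (Ed true x o :: G0)).
  have := @feq_contract_star R false x n o 0%R 0%R [:: (true, u); (true, v)] G0 => /= e.
  by last_step e.
step (Ph u 0%R 0%R :: Ph v 0%R 0%R :: Ed true u p :: Ed true v p :: Ph p 0%R 0%R ::
    Xspider [:: u; v] [:: t] 0%R 0%R :: Ed true t q :: F)
  (@adder n1 z p (Ph u 0%R 0%R :: Ph v 0%R 0%R :: Xspider [:: u; v] [:: t] 0%R 0%R :: Ed true t q :: F)).
step (Ph u 0%R 0%R :: Ph v 0%R 0%R :: Ed true u p :: Ed true v p :: Ph p 0%R 0%R ::
    Ed true u q :: Ed true v q :: Ph q 0%R 0%R :: F)
  (@adder n2 t q (Ph u 0%R 0%R :: Ph v 0%R 0%R :: Ed true u p :: Ed true v p :: Ph p 0%R 0%R :: F)).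
have := @feq_units R [:: (true, u); (true, v); (true, p); (true, q)]
  ([:: Ed true u p; Ed true v p; Ed true u q; Ed true v q] ++ F) => e.
apply: feq_via (e _) _ _; [|seqv_tac|seqv_tac].
by apply/allP; rewrite /= andbT; repeat (apply/andP; split); mem_tac.
Qed.

End Bialgebra.

(** * Elimination of a vertex with an X-Pauli leaf *)

Section PauliCopying.
Variable R : realType.
Implicit Types (C L F G : seq (node R)) (N A B : seq (bool * nat)).
Implicit Types (a b c : R) (d l : bool) (k m n p q r s t u v w x y z : nat).

Local Notation t1 := (third R 1).
Local Notation t2 := (third R 2).
Local Notation pauli := (@pauli R).
Local Notation paulis := (@paulis R).
Local Notation x_paulis := (@x_paulis R).

(** A shift of one end of an edge is a linear phase at the other end. The H-edge needs a flip first,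
    so that the colour-change box next to [x] can be cancelled; the flip exchanges the two
    phases. *)
Lemma feq_x_pauli_leg z x l y F : x \notin allegs F -> x != y -> x != z ->
  feq (Xspider [:: z] [:: x] t1 t2 :: Ed l x y :: F)
      (Ed l z y :: Ph y (pauli l).1 (pauli l).2 :: F).
Proof.
move=> xF xy xz; have [n /=] := bound_ex (z :: x :: y :: allegs F) => /and4P[nz nx ny nF].
step (Ed true z n :: Ph n t1 t2 :: Ed false n x :: Ed l x y :: F)
  (@feq_X11 R n z x t1 t2 (Ed l x y :: F)).
case: l => /=.
  have := @feq_contract_star R false x n y t1 t2 [:: (true, z)] F => /= e.
  by last_step e.
step (Ed false z n :: Ph n t2 t1 :: Ed true n x :: Ed false x y :: F)
  (@feq_flip R n t1 t2 [:: (true, z); (false, x)] (Ed false x y :: F)).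
have := @feq_contract_star R true x n y t2 t1 [:: (false, z)] F => /= e.
by last_step e.
Qed.

Lemma feq_x_paulis zs xs N F : size zs = size N -> size xs = size N -> uniq (xs ++ zs) ->
  all (fun x => x \notin ends N) xs -> all (fun x => x \notin allegs F) xs ->
  feq (x_paulis zs xs ++ zip_star xs N ++ F) (zip_star zs N ++ paulis false N ++ F).
Proof.
elim: N zs xs F => [|[l y] N IH] [|z zs] [|x xs] F //; first by move=> *; apply: feq_refl.
move=> [sz] [sx] /andP[x_xs u] /andP[xyN /allP frN] /andP[xF /allP frF].
have [xy xN] : x != y /\ x \notin ends N by apply/andP; rewrite -negb_or -in_cons.
have [x_xs' [xz x_zs]] : x \notin xs /\ x != z /\ x \notin zs.
  by move: x_xs; rewrite mem_cat in_cons !negb_or => /and3P[].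
have [z_xs u'] : z \notin xs /\ uniq (xs ++ zs).
  have: uniq (xs ++ z :: zs) := u.
  by rewrite uniq_catC cons_uniq mem_cat negb_or uniq_catC => /andP[/andP[_ ->] ->].
step (Ed l z y :: Ph y (pauli l).1 (pauli l).2 :: x_paulis zs xs ++ zip_star xs N ++ F)
  (@feq_x_pauli_leg z x l y (x_paulis zs xs ++ zip_star xs N ++ F)).
apply: (@feq_trans _ (x_paulis zs xs ++ zip_star xs N ++ Ed l z y :: Ph y (pauli l).1 (pauli l).2 :: F)).
  by apply: feq_seqv; seqv_tac.
apply: feq_trans (IH zs xs _ sz sx u' _ _) _.
- by apply/allP => w /frN; rewrite inE negb_or => /andP[].
- apply/allP => w w_xs; have := frN w w_xs; rewrite inE negb_or => /andP[wy _].
  have wz : w != z by apply: contraNneq z_xs => <-.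
  by have wF := frF w w_xs; fresh_tac.
by apply: feq_seqv; seqv_tac.
Qed.

Lemma fresh_lists n (l : seq nat) : exists z xs zs,
  [/\ below z l, size xs = n, size zs = n, uniq (xs ++ zs)
    & {in xs ++ zs, forall w, z.+1 < w}].
Proof.
have [z zl] := bound_ex l; exists z, (spread 0 z.+2 n), (spread 1 z.+2 n).
split=> //; rewrite ?size_spread //.
  by have := uniq_spread3 z.+2 n; rewrite catA [X in is_true X -> _]cat_uniq => /andP[].
by move=> w; rewrite mem_cat => /orP[] /spread_ge.
Qed.

(** The sum over [p] forces q = t - 1. The phases at t = 0, 1, 2 are thus b, 0, a, that is (-b, a -
    b) after division by the scalar e^(i b), and each edge at [q] contributes a linear phase at its
    other end. *)
Lemma feq_shift t p q a b N F : p \notin ends N -> p \notin allegs F ->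
  q \notin ends N -> q \notin allegs F -> p != q -> p != t -> q != t ->
  feq (Ed true t p :: Ph p t1 t2 :: Ed false p q :: Ph q a b :: star q N ++ F)
      (Ph t (- b)%R (a - b)%R :: star t N ++ paulis false N ++ F).
Proof.
move=> pN pF qN qF pq pt qt.
have [z [xs [zs []]]] := fresh_lists (size N) (t :: p :: q :: ends N ++ allegs F).
rewrite /= below_cat => /and5P[tz pz qz zN zF] sx sz uxz gt.
have [y zy] : exists y, y = z.+1 by exists z.+1.
rewrite -zy in gt.
have yN : y \notin ends N by apply: notin_below zN _; rewrite zy.
have [ux uz] : uniq xs /\ uniq zs by move: uxz; rewrite cat_uniq => /and3P[-> _ ->].
have gx w : w \in xs -> y < w by move=> w_in; apply: gt; rewrite mem_cat w_in.
have gz w : w \in zs -> y < w by move=> w_in; apply: gt; rewrite mem_cat w_in orbT.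
have lx w : w <= y -> w \notin xs by move=> wy; apply/negP => /gx; rewrite ltnNge wy.
have lz w : w <= y -> w \notin zs by move=> wy; apply/negP => /gz; rewrite ltnNge wy.
have zN' w : z <= w -> w \notin ends N by exact: notin_below.
have zF' w : z <= w -> w \notin allegs F by exact: notin_below.
have zly : z < y by rewrite zy.
have zw w : y < w -> z <= w by move=> yw; rewrite ltnW // (ltn_trans zly).
have hN : all (fun x => x \notin ends N) xs by apply/allP => w /gx/zw/zN'.
have hF : all (fun x => x \notin allegs F) xs by apply/allP => w /gx/zw/zF'.
have hNz : all (fun x => x \notin ends N) zs by apply/allP => w /gz/zw/zN'.
have hFz : all (fun x => x \notin allegs F) zs by apply/allP => w /gz/zw/zF'.
have qy : q < y := ltn_trans qz zly.
have ty : t < y := ltn_trans tz zly.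
have zE : z \notin allegs (@zip_star R xs N) by apply: notin_zip_star; [apply: lx; exact: ltnW | exact: zN'].
have yE : y \notin allegs (@zip_star R xs N) by apply: notin_zip_star; [apply: lx | apply: zN'; exact: ltnW].
have qE : q \notin allegs (@zip_star R xs N) by apply: notin_zip_star => //; apply: lx; exact: ltnW.
have qx := lx q (ltnW qy); have zx := lx z (ltnW zly); have yx := lx y (leqnn y).
have zz := lz z (ltnW zly); have yz := lz y (leqnn y).
have zF1 : z \notin allegs F by exact: zF'.
have yF1 : y \notin allegs F by apply: zF'; exact: ltnW.
have qz' : q != z by rewrite neq_ltn qz.
have qy' : q != y by rewrite neq_ltn qy.
have tz' : t != z by rewrite neq_ltn tz.
have ty' : t != y by rewrite neq_ltn ty.
have yz' : y != z by rewrite neq_ltn zly orbT.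
have xF := allP hF. have xN := allP hN. have zzF := allP hFz. have zzN := allP hNz.
have xneq w v : w \in xs -> v <= y -> w != v.
  by move=> /gx yw vy; rewrite neq_ltn (leq_ltn_trans vy yw) orbT.
have zneq w v : w \in zs -> v <= y -> w != v.
  by move=> /gz yw vy; rewrite neq_ltn (leq_ltn_trans vy yw) orbT.
have [qy1 ty1 zy1] : [/\ q <= y, t <= y & z <= y] by split; exact: ltnW.
clear gt zw hNz hFz zy zN' zF' zN zF pz qz tz zly.
steps (Xspider [:: t] [:: q] t1 t2 :: Ph q a b :: star q N ++ F)
  (@feq_X11 R p t q t1 t2 (Ph q a b :: star q N ++ F)).
apply: (@feq_trans _ (Zspider [::] (q :: xs) a b :: zip_star xs N ++ Xspider [:: t] [:: q] t1 t2 :: F)).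
  apply: feq_vias; [apply: (@feq_star R q xs N a b (Xspider [:: t] [:: q] t1 t2 :: F)) | seqv_tac | seqv_tac] => //.
  apply/allP => w w_in; have := xF w w_in => wF.
  have wq := xneq w q w_in qy1; have wt := xneq w t w_in ty1; fresh_tac.
(* Split the spider [q], and move the Pauli through the half carrying the phases. *)
apply: (@feq_trans _ ([:: Zspider [:: q] [:: z] a b; Zspider [:: z] xs 0%R 0%R] ++
    Xspider [:: t] [:: q] t1 t2 :: zip_star xs N ++ F)).
  apply: (@feq_trans _ ([:: Zspider [:: q] xs a b] ++ Xspider [:: t] [:: q] t1 t2 :: zip_star xs N ++ F)).
    apply: (@feq_trans _ (Zspider [::] (q :: xs) a b :: Xspider [:: t] [:: q] t1 t2 :: zip_star xs N ++ F)).
      by apply: feq_seqv; seqv_tac.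
    exact: feq_legs.
  apply: feq_sym; have := @rule_fusion R [:: q] [::] [:: z] [::] xs a b 0%R 0%R isT.
  rewrite !addr0 => r; apply: (@feq_rule_perm _ _ _ (q :: xs) [:: z] [::] _ r).
  - rewrite !allegs_cons /= cats0 -[[:: q, z, z & xs]]/([:: q] ++ [:: z; z] ++ xs).
    by rewrite -[q :: _ ++ _]/([:: q] ++ xs ++ [:: z; z]) perm_cat2l perm_catC.
  - by rewrite /allegs /= !cats0.
  - by rewrite cats1 rcons_uniq inE negb_or eq_sym qz' zx /= qx.
  - by rewrite cats0 /= qx.
  by rewrite /= andbT; fresh_tac.
apply: (@feq_trans _ ([:: Zspider [:: t] [:: y] (- b)%R (a - b)%R; Xspider [:: y] [:: z] t1 t2] ++
    Zspider [:: z] xs 0%R 0%R :: zip_star xs N ++ F)).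
  apply: (@feq_trans _ ([:: Xspider [:: t] [:: q] t1 t2; Zspider [:: q] [:: z] a b] ++
      Zspider [:: z] xs 0%R 0%R :: zip_star xs N ++ F)).
    by apply: feq_seqv; seqv_tac.
  (* The rule sends (-b, a - b) to (a, b) and is used from right to left. *)
  apply: feq_sym; have := @rule_Pauli_phase R t y q z (- b)%R (a - b)%R.
  rewrite opprK subrK => r; apply: (@feq_rule_perm _ _ _ [:: t; z] [:: y] [:: q] _ r).
  - by apply/permP => P /=; clear; lia.
  - by apply/permP => P /=; clear; lia.
  - by rewrite /= !inE negb_or tz' ty' eq_sym yz'.
  - by rewrite /= !inE negb_or tz' eq_sym qt eq_sym qz'.
  by rewrite /= andbT; apply/andP; split; fresh_tac.
apply: (@feq_trans _ ((Zspider [:: y] zs 0%R 0%R :: x_paulis zs xs) ++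
    Zspider [:: t] [:: y] (- b)%R (a - b)%R :: zip_star xs N ++ F)).
  apply: (@feq_trans _ ([:: Xspider [:: y] [:: z] t1 t2; Zspider [:: z] xs 0%R 0%R] ++
      Zspider [:: t] [:: y] (- b)%R (a - b)%R :: zip_star xs N ++ F)).
    by apply: feq_seqv; seqv_tac.
  have := @rule_Pauli_copy R y z xs zs (etrans sz (esym sx)); rewrite x_paulisE => r.
  apply: (@feq_rule_perm _ _ _ (y :: xs) [:: z] zs _ r).
  - rewrite !allegs_cons /= cats0 perm_cons perm_sym perm_catC; exact: perm_refl.
  - rewrite allegs_cons /= perm_cons; apply: (perm_trans (y := zs ++ zs ++ xs)).
      by rewrite perm_cat2l perm_x_paulis // sz.
    by rewrite perm_sym perm_catC -catA perm_refl.
  - by rewrite cats1 rcons_uniq inE negb_or eq_sym yz' zx /= yx.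
  - by rewrite /= mem_cat negb_or yx yz.
  apply/allP => w; rewrite inE => /predU1P[->|w_in]; first by fresh_tac.
  have wF := zzF w w_in; have wN := zzN w w_in.
  have wt := zneq w t w_in ty1; have wy := zneq w y w_in (leqnn y).
  have wx : w \notin xs by move: uxz; rewrite cat_uniq => /and3P[_ /hasPn h _]; exact: h.
  by fresh_tac.
apply: (@feq_trans _ (Zspider [:: y] zs 0%R 0%R :: Zspider [:: t] [:: y] (- b)%R (a - b)%R ::
    zip_star zs N ++ paulis false N ++ F)).
  apply: feq_via; [apply: (@feq_x_paulis zs xs N (Zspider [:: y] zs 0%R 0%R ::
      Zspider [:: t] [:: y] (- b)%R (a - b)%R :: F)) | seqv_tac | seqv_tac] => //.
  apply/allP => w w_in; have wF := xF w w_in.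
  have wt := xneq w t w_in ty1; have wy := xneq w y w_in (leqnn y).
  have wz : w \notin zs.
    by move: uxz; rewrite uniq_catC cat_uniq => /and3P[_ /hasPn h _]; exact: h.
  by fresh_tac.
apply: (@feq_trans _ (Ph y 0%R 0%R :: star y N ++ Zspider [:: t] [:: y] (- b)%R (a - b)%R ::
    paulis false N ++ F)).
  apply: (@feq_trans _ (Zspider [::] (y :: zs) 0%R 0%R ::
      zip_star zs N ++ Zspider [:: t] [:: y] (- b)%R (a - b)%R :: paulis false N ++ F)).
    apply: (@feq_trans _ (Zspider [:: y] zs 0%R 0%R ::
      zip_star zs N ++ Zspider [:: t] [:: y] (- b)%R (a - b)%R :: paulis false N ++ F)).
      by apply: feq_seqv; seqv_tac.
    exact: feq_legs.
  apply: feq_star => //; first by apply/allP.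
  apply/allP => w w_in; have wF := zzF w w_in; have wN := zzN w w_in.
  have wt := zneq w t w_in ty1; have wy := zneq w y w_in (leqnn y).
  by fresh_tac.
apply: (@feq_trans _ (Zspider [:: t] [:: y] (- b)%R (a - b)%R ::
    (Ph y 0%R 0%R :: star y N) ++ paulis false N ++ F)).
  by apply: feq_seqv; seqv_tac.
have yQ : y \notin allegs (paulis false N ++ F) by rewrite allegs_cat mem_cat negb_or notin_paulis.
apply: feq_trans (@feq_merge_legs R y t [:: t] [:: y] [::] _ _ _ _ yQ _ _ _) _ => //.
- by rewrite eq_sym.
- by apply/permP => P /=; clear; lia.
rewrite /= substE subst_star //.
last_step (@feq_unit R t (Ph t (- b)%R (a - b)%R :: star t N ++ paulis false N ++ F)).
Qed.

(** The leaf forces [q] to be a nonzero basis state, so each edge at [q] leaves a linear phase on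
    the neighbour. Up to a shift of [q] this is the copying of 0. *)
Lemma feq_pauli_copy d p q a b N F : p != q -> p \notin ends N -> p \notin allegs F ->
  q \notin ends N -> q \notin allegs F ->
  feq (Ph p t1 t2 :: Ed d p q :: Ph q a b :: star q N ++ F) (units N ++ paulis d N ++ F).
Proof.
move=> pq pN pF qN qF; wlog -> : d a b N pN qN / d = false.
  move=> H; case: d; last exact: H.
  have qp : q != p by rewrite eq_sym.
  step (Ph p t1 t2 :: Ed false p q :: Ph q b a :: star q (neg N) ++ F)
    (@feq_flip R q a b ((true, p) :: N) (Ph p t1 t2 :: F)).
  have -> : units N = units (neg N) :> seq (node R) by elim: (N) => //= e N' ->.
  by rewrite -(negbK true) -paulis_neg; apply: H; rewrite ?ends_neg.
have [z /=] := bound_ex (p :: q :: ends N ++ allegs F).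
rewrite below_cat => /and4P[pz qz zN zF].
pose G := Ed false p q :: Ph q a b :: star q N ++ F.
(* A cancelling pair of edges is inserted in front of the leaf. The shift to [z.+1] then consumes
   [p] and [q], leaving [z] as a phase-free leaf of [z.+1]. *)
apply: (@feq_trans _ (Ed false z.+1 z :: Ed true z.+1 p :: Ph p t1 t2 :: G)).
  apply: feq_sym; apply: (@feq_trans _ (Ph p 0%R 0%R :: Ph p t1 t2 :: G)).
    apply: (@feq_contract R false z.+1 z p [::] (Ph p t1 t2 :: G)); rewrite ?/G; fresh_tac.
  by apply: feq_unit; mem_tac.
step (Ed false z z.+1 :: Ph z.+1 (- b)%R (a - b)%R :: star z.+1 N ++ paulis false N ++ F)
  (@feq_shift z.+1 p q a b N (Ed false z z.+1 :: F)).
last_step (@feq_copy R false z z.+1 (- b)%R (a - b)%R N (paulis false N ++ F)).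
Qed.

End PauliCopying.

(** * Pivoting *)

Section Pivot.
Variable R : realType.
Implicit Types (C L F G : seq (node R)) (N A B : seq (bool * nat)) (e f : bool * nat).
Implicit Types (a b : R) (c d l : bool) (k m n p q r s t u v x y z : nat) (w : bool).

(* The edges between [A] and [B] left by the elimination of two phase-free
   vertices joined by a [w]-edge, one adjacent to [A] and the other to [B]: with
   edge weights 1 and 2 (mod 3), the new weights are - sigma tau / w. *)
Fixpoint pairs w A B : seq (node R) :=
  if A is e :: A' then star e.2 (sgn (e.1 (+) w) B) ++ pairs w A' B else [::].

(** Edges are unoriented, and the label of each new edge is symmetric in its two ends. *)
Lemma count_pairs w A B P : sym_pred P ->
  count P (pairs w A B) = count P (pairs w B A).
Proof.
move=> hP; have cons f : forall A0 B0, count P (pairs w A0 (f :: B0)) =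
    count P (star f.2 (sgn (f.1 (+) w) A0)) + count P (pairs w A0 B0).
  elim=> [|e A0 IH] B0 /=; first by rewrite /sgn if_same.
  rewrite !sgn_cons /= !count_cat IH /= hP.
  have -> : f.1 (+) w (+) e.1 = e.1 (+) w (+) f.1 by case: f.1; case: e.1; case: (w).
  by move: (count P _) => x; lia.
elim: A B => [|e A IH] B /=; last by rewrite count_cat cons IH.
by elim: B => //= f B IH; rewrite /sgn if_same.
Qed.

(** The units on the right keep neighbours that lose their last edge, for instance when the other
    side is empty. *)
Definition pivotable A w B : Prop := forall s m F, s != m ->
  s \notin ends A -> s \notin ends B -> s \notin allegs F ->
  m \notin ends A -> m \notin ends B -> m \notin allegs F ->
  feq (Ed w s m :: star s A ++ star m B ++ F) (pairs w A B ++ units A ++ units B ++ F).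

Lemma pivotable_nil w B : pivotable [::] w B.
Proof.
move=> s m F sm sA sB sF mA mB mF /=.
steps (Ph m 0%R 0%R :: Ed w s m :: star m B ++ F) (@feq_unit R m (Ed w s m :: star m B ++ F)).
last_step (@feq_copy R w s m 0%R 0%R B F).
Qed.

Lemma pivotable_sym A w B : pivotable A w B -> pivotable B w A.
Proof.
move=> h s m F sm sB sA sF mB mA mF; have ms : m != s by rewrite eq_sym.
apply: feq_via (h m s F ms mA mB mF sA sB sF) _ _; first by seqv_tac.
move=> P hP; rewrite !count_cat count_pairs //.
by move: (count P _) (count P _) (count P _) => *; lia.
Qed.

Lemma pivotable_swap e f w A B : pivotable [:: e, f & A] w B ->
  pivotable [:: f, e & A] w B.
Proof.
move=> h s m F sm sA sB sF mA mB mF.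
have sw x : x \notin ends [:: f, e & A] -> x \notin ends [:: e, f & A].
  by rewrite /= !inE !negb_or => /and3P[-> -> ->].
apply: feq_via (h s m F sm (sw _ sA) sB sF (sw _ mA) mB mF) _ _; seqv_tac.
Qed.

Lemma feq_units_star v N G F : feq (star v N ++ G ++ units N ++ F) (star v N ++ G ++ F).
Proof.
apply: feq_via (@feq_units R N (star v N ++ G ++ F) _) _ _; [|seqv_tac|seqv_tac].
by move=> x /(@sub_ends_star R v); rewrite allegs_cat mem_cat => ->.
Qed.

Lemma pivotable_flip A w B : pivotable A w B -> pivotable (neg A) (~~ w) B.
Proof.
move=> h s m F sm; rewrite ends_neg => sA sB sF mA mB mF.
steps (Ph s 0%R 0%R :: Ed (~~ w) s m :: star s (neg A) ++ star m B ++ F)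
  (@feq_unit R s (Ed (~~ w) s m :: star s (neg A) ++ star m B ++ F)).
have sBm : s \notin allegs (star m B ++ F) by fresh_tac.
steps (Ph s 0%R 0%R :: Ed w s m :: star s A ++ star m B ++ F)
  (@feq_flip R s 0%R 0%R ((w, m) :: A) (star m B ++ F)).
step (Ed w s m :: star s A ++ star m B ++ F) (@feq_unit R s (Ed w s m :: star s A ++ star m B ++ F)).
apply: feq_trans (h s m F sm sA sB sF mA mB mF) _.
have -> : pairs (~~ w) (neg A) B = pairs w A B.
  by elim: (A) => //= e A' ->; rewrite addbN addNb negbK.
by rewrite -[neg A]/(sgn false A) units_sgn; exact: feq_refl.
Qed.

(** The edge from [s] to [x] is replaced by three edges of the other type through [k] and [k.+1].
    After the pivot, flipping [k] makes the two remaining edges cancel, so that [k] becomes [x] with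
    the signs of its new edges reversed. *)
Lemma pivotable_relabel l A w B : (forall x, pivotable ((l, x) :: A) w B) ->
  forall x, pivotable ((~~ l, x) :: A) w B.
Proof.
move=> h x s m F sm sA sB sF mA mB mF.
have [k] := bound_ex (x :: s :: m :: ends A ++ ends B ++ allegs F).
rewrite /= !below_cat => /and3P[kx ks /and4P[km kA kB kF]].
have [sx sA'] : s != x /\ s \notin ends A by apply/andP; rewrite -negb_or -in_cons.
have [mx mA'] : m != x /\ m \notin ends A by apply/andP; rewrite -negb_or -in_cons.
steps (Ed l s k :: Ed l k k.+1 :: Ed l k.+1 x :: Ed w s m :: star s A ++ star m B ++ F)
  (@feq_path3 R l s k k.+1 x (Ed w s m :: star s A ++ star m B ++ F)).
have hk := h k s m (Ed l k k.+1 :: Ed l k.+1 x :: F) sm.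
apply: (@feq_trans _ (pairs w ((l, k) :: A) B ++ Ph k 0%R 0%R :: units A ++ units B ++
    Ed l k k.+1 :: Ed l k.+1 x :: F)).
  by apply: feq_via (hk _ _ _ _ _ _) _ _; [fresh_tac..|seqv_tac|seqv_tac].
have kp : k \notin allegs (pairs w A B).
  elim: (A) kA => //= e A' IH /andP[ke kA].
  by rewrite allegs_cat mem_cat negb_or IH // andbT; fresh_tac.
have kp1 : k.+1 \notin allegs (pairs w A B).
  elim: (A) kA {kp} => //= e A' IH /andP[ke kA].
  by rewrite allegs_cat mem_cat negb_or IH // andbT; fresh_tac.
step (Ph k 0%R 0%R :: Ed (~~ l) k k.+1 :: star k (neg (sgn (l (+) w) B)) ++ pairs w A B ++
    units A ++ units B ++ Ed l k.+1 x :: F)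
  (@feq_flip R k 0%R 0%R ((l, k.+1) :: sgn (l (+) w) B) (pairs w A B ++ units A ++ units B ++ Ed l k.+1 x :: F)).
have := @feq_contract_star R (~~ l) k.+1 k x 0%R 0%R (neg (sgn (l (+) w) B))
  (pairs w A B ++ units A ++ units B ++ F).
rewrite negbK => hc.
apply: feq_via (hc _ _ _ _ _ _ _) _ _; [fresh_tac..|seqv_tac|].
by rewrite -sgn_neg /= addNb; seqv_tac.
Qed.

Lemma pivotable_labels A w B : (forall x, pivotable ((true, x) :: A) w B) ->
  forall e, pivotable (e :: A) w B.
Proof. by move=> h [[] x]; [exact: h | exact: (@pivotable_relabel true)]. Qed.

(** [base] is the bialgebra law. The four outer labels are corrected one at a time, and the central
    one by flipping [s]. *)
Lemma pivotable_22 e1 e2 w f1 f2 : pivotable [:: e1; e2] w [:: f1; f2].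
Proof.
have base x1 x2 y1 y2 :
    pivotable [:: (true, x1); (true, x2)] false [:: (true, y1); (true, y2)].
  move=> s m F sm /=; rewrite !inE !negb_or => /andP[? ?] /andP[? ?] sF /andP[? ?] /andP[? ?] mF.
  rewrite /sgn /=; apply: feq_sym.
  step ([:: Ed true x1 y1; Ed true x2 y1; Ed true x1 y2; Ed true x2 y2] ++ F)
    (@feq_units R [:: (true, x1); (true, x2); (true, y1); (true, y2)]
       ([:: Ed true x1 y1; Ed true x2 y1; Ed true x1 y2; Ed true x2 y2] ++ F)).
  last_steps (@feq_bialgebra R x1 x2 y1 y2 s m F).
have b1 : pivotable [:: e1; e2] false [:: f1; f2].
  apply: pivotable_labels => x1; apply: pivotable_swap; apply: pivotable_labels => x2.
  apply: pivotable_sym; apply: pivotable_labels => y1; apply: pivotable_swap.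
  apply: pivotable_labels => y2; apply/pivotable_swap/pivotable_sym/pivotable_swap.
  exact: base.
case: w; last exact: b1.
rewrite -[[:: e1; e2]]negK; apply: (@pivotable_flip _ false).
apply: pivotable_labels => x1; apply: pivotable_swap; apply: pivotable_labels => x2.
apply: pivotable_sym; apply: pivotable_labels => y1; apply: pivotable_swap.
apply: pivotable_labels => y2; apply/pivotable_swap/pivotable_sym/pivotable_swap.
exact: base.
Qed.

(** The neighbours [A] move to a new vertex [q], joined to [s] through [p] by cancelling edges. The
    pivot at [s], [m] only sees [e] and [p] and joins [p] to all of [B]; the pivot at [q], [p] then
    distributes [A]. The second hypothesis fixes the size of [B'] so that [B] can be kept at length
    two in an induction on [A]. *)
Lemma pivotable_split e A w B : (forall x, pivotable [:: e; (false, x)] w B) ->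
  (forall w' B', size B' = size B -> pivotable A w' B') -> pivotable (e :: A) w B.
Proof.
move=> h1 h2 s m F sm sA sB sF mA mB mF.
have [p] := bound_ex (e.2 :: s :: m :: ends A ++ ends B ++ allegs F).
rewrite /= !below_cat => /and3P[px ps /and4P[pm pA pB pF]].
have [sx sA'] : s != e.2 /\ s \notin ends A by apply/andP; rewrite -negb_or -in_cons.
have [mx mA'] : m != e.2 /\ m \notin ends A by apply/andP; rewrite -negb_or -in_cons.
have [q [qp pq]] : exists q, q = p.+1 /\ p < q by exists p.+1.
have qA : below q (ends A) by apply: sub_all pA => z /ltn_trans; apply.
have qB : below q (ends B) by apply: sub_all pB => z /ltn_trans; apply.
have qF : below q (allegs F) by apply: sub_all pF => z /ltn_trans; apply.
have [qx qs qm] : [/\ e.2 < q, s < q & m < q] by split; apply: ltn_trans pq.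
steps (Ph s 0%R 0%R :: Ed w s m :: Ed e.1 s e.2 :: star s A ++ star m B ++ F)
  (@feq_unit R s (Ed w s m :: Ed e.1 s e.2 :: star s A ++ star m B ++ F)).
steps (Ed true p q :: Ed false p s :: Ph q 0%R 0%R :: star q A ++
    Ed w s m :: Ed e.1 s e.2 :: star m B ++ F)
  (@feq_contract_star R true p q s 0%R 0%R A (Ed w s m :: Ed e.1 s e.2 :: star m B ++ F)).
step (Ed true p q :: Ed false p s :: star q A ++ Ed w s m :: Ed e.1 s e.2 :: star m B ++ F)
  (@feq_unit R q (Ed true p q :: Ed false p s :: star q A ++ Ed w s m :: Ed e.1 s e.2 :: star m B ++ F)).
have hp := h1 p s m (Ed true p q :: star q A ++ F) sm.
apply: (@feq_trans _ (star e.2 (sgn (e.1 (+) w) B) ++ star p (sgn w B) ++ Ph e.2 0%R 0%R ::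
    Ph p 0%R 0%R :: units B ++ Ed true p q :: star q A ++ F)).
  by apply: feq_via (hp _ _ _ _ _ _) _ _; [fresh_tac..|seqv_tac|seqv_tac].
step (star e.2 (sgn (e.1 (+) w) B) ++ star p (sgn w B) ++ Ph e.2 0%R 0%R ::
    units B ++ Ed true p q :: star q A ++ F)
  (@feq_unit R p (star e.2 (sgn (e.1 (+) w) B) ++ star p (sgn w B) ++ Ph e.2 0%R 0%R ::
    units B ++ Ed true p q :: star q A ++ F)).
have hq := h2 true (sgn w B) (size_sgn w B) q p
  (star e.2 (sgn (e.1 (+) w) B) ++ Ph e.2 0%R 0%R :: units B ++ F).
(* Signs compose correctly: -w from the first pivot, and sigma from the second, whose central edge
   has weight -1, give - sigma w. *)
have eK : pairs true A (sgn w B) = pairs w A B.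
  by elim: (A) => //= f A' ->; rewrite addbT sgn_sgn.
rewrite eK units_sgn in hq.
apply: (@feq_trans _ (pairs w A B ++ units A ++ units B ++
   star e.2 (sgn (e.1 (+) w) B) ++ Ph e.2 0%R 0%R :: units B ++ F)).
  by apply: feq_via (hq _ _ _ _ _ _ _) _ _; [fresh_tac..|seqv_tac|seqv_tac].
have hz := @feq_units_star e.2 (sgn (e.1 (+) w) B)
  (pairs w A B ++ Ph e.2 0%R 0%R :: units A ++ units B) F.
rewrite units_sgn in hz.
by apply: feq_via hz _ _; [seqv_tac|rewrite /=; seqv_tac].
Qed.

(** One side is kept at length two while the other one grows by splitting; then the first side grows
    too. The base cases are two against two and an empty side. *)
Lemma pivot A w B : pivotable A w B.
Proof.
have h2 n : forall e1 e2 w' B', size B' = n -> pivotable [:: e1; e2] w' B'.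
  elim: n => [|n IH] e1 e2 w' [|f B'] //= => [_|[sz]].
    exact/pivotable_sym/pivotable_nil.
  apply/pivotable_sym/pivotable_split => [x|w1 B1]; first exact: pivotable_22.
  case: B1 => [|f1 [|f2 []]] //= _; apply: pivotable_sym; exact: IH.
elim: A w B => [|e A IH] w B; first exact: pivotable_nil.
by apply: pivotable_split => [x|w' B' _]; [exact: h2 | exact: IH].
Qed.

End Pivot.

(** * Loops, parallel edges and local complementation *)

Section Laws.
Variable R : realType.
Implicit Types (C L F G : seq (node R)) (N A B : seq (bool * nat)) (e f : bool * nat).
Implicit Types (a b : R) (c d l : bool) (k m n p q r s t u v x y z : nat) (w : bool).

Local Notation t1 := (third R 1).
Local Notation t2 := (third R 2).

(** Expanding the H-edge into three H^dagger-edges gives a four-cycle, which is the result of a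
    pivot. Undoing that pivot leaves each of the two auxiliary vertices [k] and [k.+1] as a leaf,
    and copying them away disconnects [u] from [p]. *)
Lemma feq_Hopf d u p F :
  feq (Ed d u p :: Ed (~~ d) u p :: F) (Ph u 0%R 0%R :: Ph p 0%R 0%R :: F).
Proof.
wlog -> : d / d = true.
  move=> H; case: d; first exact: H.
  by apply: feq_trans (H true erefl); apply: feq_seqv; seqv_tac.
have [k] := bound_ex (u :: p :: allegs F) => /= /and3P[uk pk kF].
pose A := [:: (true, u); (true, k)]; pose B := [:: (true, p); (true, k.+1)].
pose s := k.+2; pose m := k.+3.
have hp : feq (Ed false s m :: star s A ++ star m B ++ F) (pairs R false A B ++ units A ++ units B ++ F).
  by apply: pivot; rewrite /s /m /A /B; fresh_tac.
have hu : feq (units A ++ units B ++ pairs R false A B ++ F) (pairs R false A B ++ F).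
  by apply: feq_via (@feq_units R (A ++ B) (pairs R false A B ++ F) _) _ _;
   [rewrite /A /B /=; fresh_tac | rewrite /A /B; seqv_tac | seqv_tac].
steps (Ed true u p :: Ed true u k.+1 :: Ed true k.+1 k :: Ed true k p :: F)
  (@feq_path3 R true u k.+1 k p (Ed true u p :: F)).
apply: (@feq_trans _ (Ed false s m :: star s A ++ star m B ++ F)).
  apply: (@feq_trans _ (pairs R false A B ++ F)); first by apply: feq_seqv; rewrite /A /B; seqv_tac.
  apply: feq_trans (feq_sym hu) _; apply: feq_trans _ (feq_sym hp).
  by apply: feq_seqv; rewrite /A /B; seqv_tac.
rewrite /A /B /s /m.
steps (Ph k.+2 0%R 0%R :: Ed false k.+2 k.+3 :: Ed true k.+2 u :: Ed true k.+2 k ::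
    Ed true k.+3 p :: Ed true k.+3 k.+1 :: F)
  (@feq_unit R k.+2 (Ed false k.+2 k.+3 :: Ed true k.+2 u :: Ed true k.+2 k ::
    Ed true k.+3 p :: Ed true k.+3 k.+1 :: F)).
step (Ph k.+3 0%R 0%R :: Ph u 0%R 0%R :: Ed true k.+3 p :: Ed true k.+3 k.+1 :: F)
  (@feq_copy R true k k.+2 0%R 0%R [:: (false, k.+3); (true, u)]
    (Ed true k.+3 p :: Ed true k.+3 k.+1 :: F)).
last_step (@feq_copy R true k.+1 k.+3 0%R 0%R [:: (true, p)] (Ph u 0%R 0%R :: F)).
Qed.

(* The phases occurring in the decomposition of a [d]-edge: (2, 2) for H. *)
Definition euler_phase d : R := if d then t1 else t2.
Local Notation Pk u d := (Ph u (euler_phase d) (euler_phase d)).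

Lemma euler_phase_double d : eq_mod2pi (euler_phase d + euler_phase d)%R (euler_phase (~~ d)).
Proof.
case: d; [exists 0%R | exists 1%R]; rewrite /euler_phase /third /=; lra.
Qed.

Lemma euler_phase_opp d : eq_mod2pi (euler_phase d + euler_phase (~~ d))%R 0%R.
Proof. by exists 1%R; case: d; rewrite /euler_phase /third /=; lra. Qed.

Lemma feq_euler_phase_double u d F : feq (Pk u d :: Pk u d :: F) (Pk u (~~ d) :: F).
Proof.
apply: feq_trans (feq_phase_add _ _ _ _ _ _) _.
by apply: feq_phase; exact: euler_phase_double.
Qed.

Lemma feq_euler_phase_opp u d F : feq (Pk u d :: Pk u (~~ d) :: F) (Ph u 0%R 0%R :: F).
Proof.
apply: feq_trans (feq_phase_add _ _ _ _ _ _) _.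
by apply: feq_phase; exact: euler_phase_opp.
Qed.

Lemma feq_euler d u v r F : r \notin allegs F -> r != u -> r != v ->
  feq (Ed d u v :: F) (Pk u d :: Pk v d :: Pk r d :: Ed (~~ d) u r :: Ed d r v :: F).
Proof.
case: d => rF ru rv; last exact: feq_Euler.
(* For H^dagger, the H-edge on the right-hand side is decomposed in turn. Its phases cancel those at
   [u] and [r], which makes [r] a phase-free vertex of degree two with opposite edges, hence
   contractible. *)
apply: feq_sym; have [k] := bound_ex (r :: u :: v :: allegs F) => /= /and4P[rk uk vk kF].
step (Pk u true :: Pk u false :: Pk r true :: Pk r false :: Pk k false :: Pk v true ::
    Ed true u k :: Ed false k r :: Ed true r v :: F)
  (@feq_Euler R u r k (Pk u true :: Pk v true :: Pk r true :: Ed true r v :: F)).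
step (Ph u 0%R 0%R :: Pk r true :: Pk r false :: Pk k false :: Pk v true ::
    Ed true u k :: Ed false k r :: Ed true r v :: F)
  (@feq_euler_phase_opp u true (Pk r true :: Pk r false :: Pk k false :: Pk v true ::
    Ed true u k :: Ed false k r :: Ed true r v :: F)).
step (Ph u 0%R 0%R :: Ph r 0%R 0%R :: Pk k false :: Pk v true ::
    Ed true u k :: Ed false k r :: Ed true r v :: F)
  (@feq_euler_phase_opp r true (Ph u 0%R 0%R :: Pk k false :: Pk v true ::
    Ed true u k :: Ed false k r :: Ed true r v :: F)).
step (Ph u 0%R 0%R :: Pk k false :: Pk v true ::
    Ed true u k :: Ed false k r :: Ed true r v :: F)
  (@feq_unit R r (Ph u 0%R 0%R :: Pk k false :: Pk v true ::
    Ed true u k :: Ed false k r :: Ed true r v :: F)).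
step (Pk v true :: Pk v false :: Ph u 0%R 0%R :: Ed true u v :: F)
  (@feq_contract_star R false r k v (euler_phase false) (euler_phase false) [:: (true, u)]
    (Ph u 0%R 0%R :: Pk v true :: F)).
step (Ph v 0%R 0%R :: Ph u 0%R 0%R :: Ed true u v :: F)
  (@feq_euler_phase_opp v true (Ph u 0%R 0%R :: Ed true u v :: F)).
last_step (@feq_units R [:: (true, v); (true, u)] (Ed true u v :: F)).
Qed.

(** The Euler decomposition with both ends at [u]: the edges to the middle vertex are opposite and
    cancel by [feq_Hopf], the middle vertex becomes a nonzero scalar, and the two phases at [u] add
    up. *)
Lemma feq_loop d u F : feq (Ed d u u :: F) (Pk u (~~ d) :: F).
Proof.
have [r] := bound_ex (u :: allegs F) => /= /andP[ur rF].
have nr : r \notin allegs F by fresh_tac.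
step (Pk u d :: Pk u d :: Pk r d :: Ed (~~ d) u r :: Ed d r u :: F)
  (@feq_euler d u u r F).
step (Pk u d :: Pk u d :: Pk r d :: Ph u 0%R 0%R :: Ph r 0%R 0%R :: F)
  (@feq_Hopf d r u (Pk u d :: Pk u d :: Pk r d :: F)).
step (Pk u d :: Pk u d :: Pk r d :: F)
  (@feq_units R [:: (true, u); (true, r)] (Pk u d :: Pk u d :: Pk r d :: F)).
step (Pk u d :: Pk u d :: F) (@feq_scalar_diag R r (euler_phase d) (Pk u d :: Pk u d :: F)).
exact: feq_euler_phase_double.
Qed.

(** A quadratic Gauss sum up to a scalar. Since the two phases are equal, flipping [r] makes the
    type of the edge irrelevant. *)
Lemma feq_Gauss d l r u F : r \notin allegs F -> r != u ->
  feq (Pk r d :: Ed l r u :: F) (Pk u (~~ d) :: F).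
Proof.
move=> rF ru; wlog -> : l / l = ~~ d.
  move=> H; case: (eqVneq l (~~ d)) => [|ld]; first exact: H.
  step (Pk r d :: Ed (~~ l) r u :: F) (@feq_flip R r (euler_phase d) (euler_phase d) [:: (l, u)] F).
  by apply: H; case: l d ld => [] [].
have [v] := bound_ex (r :: u :: allegs F) => /= /and3P[rv uv vF]; set z := v.+1.
apply: feq_sym.
steps (Ph u 0%R 0%R :: Pk u (~~ d) :: F) (@feq_unit R u (Pk u (~~ d) :: F)).
(* An edge to a vertex [v] held at 0 by its leaf [z] is trivial. Its Euler decomposition is not: it
   yields the leaf [r] and a phase at [u] that cancels the given one. *)
steps (Ed d u v :: Ed false z v :: Ph v 0%R 0%R :: Pk u (~~ d) :: F)
  (@feq_copy R false z v 0%R 0%R [:: (d, u)] (Pk u (~~ d) :: F)).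
step (Ed d u v :: Ed false z v :: Pk u (~~ d) :: F)
  (@feq_unit R v (Ed d u v :: Ed false z v :: Pk u (~~ d) :: F)).
step (Pk u d :: Pk v d :: Pk r d :: Ed (~~ d) u r :: Ed d r v :: Ed false z v :: Pk u (~~ d) :: F)
  (@feq_euler d u v r (Ed false z v :: Pk u (~~ d) :: F)).
step (Ph r 0%R 0%R :: Pk u d :: Pk r d :: Ed (~~ d) u r :: Pk u (~~ d) :: F)
  (@feq_copy R false z v (euler_phase d) (euler_phase d) [:: (d, r)]
    (Pk u d :: Pk r d :: Ed (~~ d) u r :: Pk u (~~ d) :: F)).
step (Ph u 0%R 0%R :: Ph r 0%R 0%R :: Pk r d :: Ed (~~ d) u r :: F)
  (@feq_euler_phase_opp u d (Ph r 0%R 0%R :: Pk r d :: Ed (~~ d) u r :: F)).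
last_step (@feq_units R [:: (true, u); (true, r)] (Pk r d :: Ed (~~ d) u r :: F)).
Qed.

(* After an Euler decomposition of both edges, a pivot merges their two middle
   vertices into one, whose phases make it the middle of a single edge. *)
Lemma feq_parallel d x y F : feq (Ed d x y :: Ed d x y :: F) (Ed (~~ d) x y :: F).
Proof.
have [k] := bound_ex (x :: y :: allegs F) => /= /and3P[xk yk kF].
pose A := [:: (false, k); (false, k.+1)]; pose B := [:: (d, x); (~~ d, y)].
pose s := k.+2; pose m := k.+3.
pose G := Pk x d :: Pk x d :: Pk y d :: Pk y d :: Pk k d :: Pk k.+1 d :: F.
have hp : feq (Ed false s m :: star s A ++ star m B ++ G) (pairs R false A B ++ units A ++ units B ++ G).
  by apply: pivot; rewrite /s /m /A /B /G; fresh_tac.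
have hu : feq (units A ++ units B ++ pairs R false A B ++ G) (pairs R false A B ++ G).
  by apply: feq_via (@feq_units R (A ++ B) (pairs R false A B ++ G) _) _ _;
   [rewrite /A /B /=; fresh_tac | rewrite /A /B; seqv_tac | seqv_tac].
(* The labels in [B] are opposite to those of the Euler edges because the pivot with a central
   H-edge and H-edges in [A] negates them. *)
step (Pk x d :: Pk y d :: Pk k d :: Ed (~~ d) x k :: Ed d k y :: Ed d x y :: F)
  (@feq_euler d x y k (Ed d x y :: F)).
step (Pk x d :: Pk y d :: Pk k.+1 d :: Ed (~~ d) x k.+1 :: Ed d k.+1 y ::
    Pk x d :: Pk y d :: Pk k d :: Ed (~~ d) x k :: Ed d k y :: F)
  (@feq_euler d x y k.+1 (Pk x d :: Pk y d :: Pk k d :: Ed (~~ d) x k :: Ed d k y :: F)).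
apply: (@feq_trans _ (Ed false s m :: star s A ++ star m B ++ G)).
  apply: (@feq_trans _ (pairs R false A B ++ G)).
    by apply: feq_seqv; rewrite /A /B /G /= negbK; seqv_tac.
  apply: feq_trans (feq_sym hu) _; apply: feq_trans _ (feq_sym hp).
  by apply: feq_seqv; rewrite /A /B; seqv_tac.
rewrite /A /B /s /m /G.
step (Pk k.+2 (~~ d) :: Pk k.+1 d :: Ed false k.+2 k.+1 :: Ed false k.+2 k.+3 ::
    Ed d k.+3 x :: Ed (~~ d) k.+3 y :: Pk x d :: Pk x d :: Pk y d :: Pk y d :: F)
  (@feq_Gauss d false k k.+2 (Pk k.+1 d :: Ed false k.+2 k.+1 :: Ed false k.+2 k.+3 ::
    Ed d k.+3 x :: Ed (~~ d) k.+3 y :: Pk x d :: Pk x d :: Pk y d :: Pk y d :: F)).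
step (Pk k.+2 (~~ d) :: Pk k.+2 (~~ d) :: Ed false k.+2 k.+3 ::
    Ed d k.+3 x :: Ed (~~ d) k.+3 y :: Pk x d :: Pk x d :: Pk y d :: Pk y d :: F)
  (@feq_Gauss d false k.+1 k.+2 (Pk k.+2 (~~ d) :: Ed false k.+2 k.+3 ::
    Ed d k.+3 x :: Ed (~~ d) k.+3 y :: Pk x d :: Pk x d :: Pk y d :: Pk y d :: F)).
(* Two leaves of phase [d] have put [~~ d] twice on [k.+2], which amounts to [d]. So [k.+2] is again
   a Gauss leaf, and [k.+3] receives [~~ d], the middle phase of a [~~ d]-edge. *)
have := @feq_euler_phase_double k.+2 (~~ d) (Ed false k.+2 k.+3 ::
  Ed d k.+3 x :: Ed (~~ d) k.+3 y :: Pk x d :: Pk x d :: Pk y d :: Pk y d :: F).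
rewrite negbK => hd.
step (Pk k.+2 d :: Ed false k.+2 k.+3 ::
    Ed d k.+3 x :: Ed (~~ d) k.+3 y :: Pk x d :: Pk x d :: Pk y d :: Pk y d :: F) hd.
step (Pk k.+3 (~~ d) ::
    Ed d k.+3 x :: Ed (~~ d) k.+3 y :: Pk x d :: Pk x d :: Pk y d :: Pk y d :: F)
  (@feq_Gauss d false k.+2 k.+3 (
    Ed d k.+3 x :: Ed (~~ d) k.+3 y :: Pk x d :: Pk x d :: Pk y d :: Pk y d :: F)).
step (Pk x (~~ d) :: Pk k.+3 (~~ d) ::
    Ed d k.+3 x :: Ed (~~ d) k.+3 y :: Pk y d :: Pk y d :: F)
  (@feq_euler_phase_double x d (Pk k.+3 (~~ d) ::
    Ed d k.+3 x :: Ed (~~ d) k.+3 y :: Pk y d :: Pk y d :: F)).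
step (Pk x (~~ d) :: Pk y (~~ d) :: Pk k.+3 (~~ d) ::
    Ed d k.+3 x :: Ed (~~ d) k.+3 y :: F)
  (@feq_euler_phase_double y d (Pk x (~~ d) :: Pk k.+3 (~~ d) ::
    Ed d k.+3 x :: Ed (~~ d) k.+3 y :: F)).
have := @feq_euler (~~ d) x y k.+3 F; rewrite negbK => he.
last_steps he.
Qed.

(* The phases of [v] are traded for an H-loop at a new leaf, which is opened into a
   triangle and eliminated by two pivots. *)
Lemma local_complementation v d N F : v \notin ends N -> v \notin allegs F ->
  let N' := sgn (~~ d) N in
  feq (Pk v d :: star v N ++ F)
      (pairs R (~~ d) N' N' ++ units N ++ units N ++ units N ++ F).
Proof.
move=> vN vF N'; have [s] := bound_ex (v :: ends N ++ allegs F).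
rewrite /= below_cat => /and3P[vs sN sF].
have := @feq_Gauss (~~ d) false s v (star v N ++ F); rewrite negbK => hg.
steps (Pk s (~~ d) :: Ed false s v :: star v N ++ F) hg.
steps (Ed d s s :: Ed false s v :: star v N ++ F) (@feq_loop d s (Ed false s v :: star v N ++ F)).
have := @feq_path3 R (~~ d) s s.+1 s.+2 s (Ed false s v :: star v N ++ F); rewrite negbK => h3.
steps (Ed (~~ d) s s.+1 :: Ed (~~ d) s.+1 s.+2 :: Ed (~~ d) s.+2 s :: Ed false s v :: star v N ++ F) h3.
have hp := @pivot R [:: (~~ d, s.+1); (~~ d, s.+2)] false N s v (Ed (~~ d) s.+1 s.+2 :: F).
apply: (@feq_trans _ (star s.+1 N' ++ star s.+2 N' ++ Ph s.+1 0%R 0%R :: Ph s.+2 0%R 0%R ::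
    units N ++ Ed (~~ d) s.+1 s.+2 :: F)).
  apply: feq_via (hp _ _ _ _ _ _ _) _ _; [fresh_tac..|seqv_tac|].
  by rewrite /N' /= addbF; seqv_tac.
have hu := @feq_units R [:: (true, s.+1); (true, s.+2)]
  (star s.+1 N' ++ star s.+2 N' ++ units N ++ Ed (~~ d) s.+1 s.+2 :: F).
step (star s.+1 N' ++ star s.+2 N' ++ units N ++ Ed (~~ d) s.+1 s.+2 :: F) hu.
(* Both [s.+1] and [s.+2] are now adjacent to all of [N]. Pairing [N'] with itself produces every
   edge twice and a loop at every neighbour; [normalise] cleans this up later. *)
have hq := @pivot R N' (~~ d) N' s.+1 s.+2 (units N ++ F).
apply: feq_via (hq _ _ _ _ _ _ _) _ _; rewrite ?/N'; [fresh_tac..|seqv_tac|].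
by rewrite units_sgn; seqv_tac.
Qed.

(* The phases of the leaves that are sent by H to a computational-basis vector. *)
Definition leaf c : R * R := if c then (t1, t2) else (0%R, 0%R).
Definition leaf_phases c N : seq (node R) := if c then @paulis R false N else [::].

Lemma feq_leaf_copy c p q a b N F : p != q -> p \notin ends N -> p \notin allegs F ->
  q \notin ends N -> q \notin allegs F ->
  feq (Ph p (leaf c).1 (leaf c).2 :: Ed false p q :: Ph q a b :: star q N ++ F)
      (units N ++ leaf_phases c N ++ F).
Proof.
case: c => /= pq pN pF qN qF; first by have := @feq_pauli_copy R false p q a b N F; exact.
step (Ed false p q :: Ph q a b :: star q N ++ F)
  (@feq_unit R p (Ed false p q :: Ph q a b :: star q N ++ F)).
exact: feq_copy.
Qed.

(* Linear phase functions can be replaced by an edge to a basis state. *)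
Definition linear_phase a b : Prop := exists c l, forall p q v F, p != q -> p != v ->
  p \notin allegs F -> q != v -> q \notin allegs F ->
  feq (Ph v a b :: F) (Ph p (leaf c).1 (leaf c).2 :: Ed false p q :: Ed l q v :: F).

Lemma linear_phase0 : linear_phase 0%R 0%R.
Proof.
exists false, false => p q v F pq pv pF qv qF.
steps (Ph p 0%R 0%R :: Ed false p q :: Ph q 0%R 0%R :: Ed false q v :: F)
  (@feq_leaf_copy false p q 0%R 0%R [:: (false, v)] F).
last_step (@feq_unit R q (Ph p 0%R 0%R :: Ed false p q :: Ed false q v :: F)).
Qed.

Lemma linear_phase_pauli l : linear_phase (pauli R l).1 (pauli R l).2.
Proof.
exists true, l => p q v F pq pv pF qv qF.
steps (Ph v 0%R 0%R :: Ph v (pauli R l).1 (pauli R l).2 :: F)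
  (@feq_unit R v (Ph v (pauli R l).1 (pauli R l).2 :: F)).
steps (Ph p t1 t2 :: Ed false p q :: Ph q 0%R 0%R :: Ed l q v :: F)
  (@feq_pauli_copy R false p q 0%R 0%R [:: (l, v)] F).
last_step (@feq_unit R q (Ph p t1 t2 :: Ed false p q :: Ed l q v :: F)).
Qed.

End Laws.

(** * Elimination of one quadratic or two adjacent linear vertices *)

Section Elimination.
Variable R : realType.
Implicit Types (C L F G : seq (node R)) (N A B : seq (bool * nat)) (e f : bool * nat).
Implicit Types (a b : R) (c d l : bool) (k m n p q r s t u v x y z : nat) (w : bool).

Local Notation Pk u d := (Ph u (euler_phase R d) (euler_phase R d)).

Definition graph_node (p : node R) : bool :=
  match p with
  | Zspider [::] [:: _] _ _ | Hbox _ _ _ => true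
  | _ => false
  end.
Definition graph F : bool := all graph_node F.

Lemma graph_star v N : graph (star v N). Proof. by elim: N. Qed.
Lemma graph_units N : graph (units N). Proof. by elim: N. Qed.
Lemma graph_leaf_phases c N : graph (leaf_phases R c N). Proof. by case: c => //; elim: N. Qed.
Lemma graph_pairs w A B : graph (pairs R w A B).
Proof. by elim: A => //= e A IH; rewrite /graph all_cat [all _ _]graph_star. Qed.
Lemma graph_cat F F' : graph (F ++ F') = graph F && graph F'.
Proof. exact: all_cat. Qed.

Lemma allegs_units N : allegs (@units R N) = ends N.
Proof. by elim: N => // e N IH; rewrite /= allegs_cons IH. Qed.

Lemma sub_leaf_phases c N : {subset allegs (leaf_phases R c N) <= ends N}.
Proof.
case: c => //; elim: N => // e N IH x; rewrite [leaf_phases _ _ _]/= allegs_cons mem_cat.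
case/orP=> [|/IH xN]; first by rewrite /= mem_seq1 in_cons => ->.
by rewrite [ends _]/= in_cons xN orbT.
Qed.

Lemma sub_star v N x : x \in allegs (@star R v N) -> x = v \/ x \in ends N.
Proof.
elim: N => // e N IH; rewrite [star _ _]/= allegs_cons mem_cat.
case/orP=> [|/IH[->|xN]]; [|by left|by right; rewrite [ends _]/= in_cons xN orbT].
rewrite /= in_cons mem_seq1 => /orP[/eqP|xe]; first by left.
by right; rewrite in_cons xe.
Qed.

Lemma sub_pairs w A B x : x \in allegs (pairs R w A B) -> (x \in ends A) || (x \in ends B).
Proof.
elim: A => // e A IH; rewrite [pairs _ _ _ _]/= allegs_cat mem_cat => /orP[/sub_star[->|]|/IH].
- by rewrite /= mem_head.
- by rewrite ends_sgn orbC => ->.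
by rewrite /= inE => /orP[->|->]; rewrite ?orbT.
Qed.

Lemma notin_pairs w A B x : x \notin ends A -> x \notin ends B ->
  x \notin allegs (pairs R w A B).
Proof. by move=> xA xB; apply/negP => /sub_pairs; rewrite (negbTE xA) (negbTE xB). Qed.

(** The linear part becomes an edge to a vertex [q] held in a basis state by the leaf [p], so that
    [v] is purely quadratic. Local complementation makes [q] a neighbour of [N], and copying its
    basis state removes it. The last conclusion records that no vertex besides [v] is lost or added,
    as the spider count requires. *)
Lemma eliminate_quadratic d v a b N F : linear_phase a b -> v \notin ends N ->
  v \notin allegs F -> graph F ->
  exists F', [/\ feq (Pk v d :: Ph v a b :: star v N ++ F) F', graph F'
    & allegs F' =i ends N ++ allegs F].
Proof.
move=> [c [l lin]] vN vF gF; have [p] := bound_ex (v :: ends N ++ allegs F).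
rewrite /= below_cat => /and3P[vp pN pF]; pose q := p.+1.
pose F1 := Ph p (leaf R c).1 (leaf R c).2 :: Ed false p q :: F.
pose N2 := sgn (~~ d) N; pose f := (~~ (~~ d (+) l), q).
pose M := sgn (f.1 (+) ~~ d) N2.
have e1 : feq (Pk v d :: Ph v a b :: star v N ++ F) (Pk v d :: star v ((l, q) :: N) ++ F1).
  apply: feq_via (lin p q v (Pk v d :: star v N ++ F) _ _ _ _ _) _ _.
  1-5: rewrite /q; fresh_tac.
  - by seqv_tac.
  - by rewrite /F1; seqv_tac.
have e2 := @local_complementation R v d ((l, q) :: N) F1.
(* The factor [f] of [q] occurs in both arguments of [pairs]: it pairs with itself into a loop, and
   twice with [N2], whence [M ++ M]. *)
have e3 : feq (Pk v d :: Ph v a b :: star v N ++ F)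
    (Ed (~~ (f.1 (+) ~~ d (+) f.1)) q q :: star q (M ++ M) ++ pairs R (~~ d) N2 N2 ++
     Ph q 0%R 0%R :: Ph q 0%R 0%R :: Ph q 0%R 0%R :: units N ++ units N ++ units N ++ F1).
  apply: feq_trans e1 _; apply: feq_trans (e2 _ _) _.
  - by rewrite /q; fresh_tac.
  - by rewrite /F1 /q; fresh_tac.
  rewrite sgn_cons -/N2 -/f; apply: feq_seqv => P hP.
  have := count_pairs (~~ d) N2 (f :: N2) hP.
  rewrite /= !star_cat sgn_cons -/M /= !(count_cat, map_cat) /= !count_cat => ->.
  by repeat progress rewrite ?count_cat /=; gen_counts P; clear; intros; lia.
set g := ~~ (f.1 (+) _ (+) _) in e3.
pose G := pairs R (~~ d) N2 N2 ++ units N ++ units N ++ units N ++ F.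
have Mq : ends M = ends N by rewrite /M /N2 !ends_sgn.
have N2q : ends N2 = ends N by rewrite /N2 !ends_sgn.
have pG : p \notin allegs G.
  rewrite /G; do ! (rewrite allegs_cat mem_cat negb_or; apply/andP; split);
    rewrite ?allegs_units; try apply: notin_pairs; rewrite ?N2q; fresh_tac.
have qG : q \notin allegs G.
  rewrite /G; do ! (rewrite allegs_cat mem_cat negb_or; apply/andP; split);
    rewrite ?allegs_units; try apply: notin_pairs; rewrite ?N2q /q; fresh_tac.
have e4 : feq (Pk v d :: Ph v a b :: star v N ++ F)
    (Ph p (leaf R c).1 (leaf R c).2 :: Ed false p q :: Pk q (~~ g) :: star q (M ++ M) ++ G).
  apply: feq_trans e3 _.
  pose G1 := star q (M ++ M) ++ pairs R (~~ d) N2 N2 ++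
     Ph q 0%R 0%R :: Ph q 0%R 0%R :: Ph q 0%R 0%R :: units N ++ units N ++ units N ++ F1.
  apply: feq_trans (feq_loop g q G1) _.
  apply: feq_via (@feq_units R [:: (true, q); (true, q); (true, q)]
    (Ph p (leaf R c).1 (leaf R c).2 :: Ed false p q :: Pk q (~~ g) :: star q (M ++ M) ++ G) _) _ _.
  - by fresh_tac.
  - by rewrite /G1 /F1 /G; seqv_tac.
  by rewrite /G; seqv_tac.
have pq : p != q by rewrite /q neq_ltn ltnSn.
have pM : p \notin ends (M ++ M) by rewrite ends_cat Mq mem_cat orbb; fresh_tac.
have qM : q \notin ends (M ++ M) by rewrite ends_cat Mq mem_cat orbb /q; fresh_tac.
have e5 := @feq_leaf_copy R c p q _ _ (M ++ M) G pq pM pG qM qG.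
exists (units (M ++ M) ++ leaf_phases R c (M ++ M) ++ G); split.
- exact: feq_trans e4 (e5 _ _).
- by rewrite !graph_cat !graph_units graph_leaf_phases graph_pairs gF.
move=> x; rewrite !allegs_cat !mem_cat !allegs_units ends_cat Mq mem_cat orbb.
case: (boolP (x \in ends N)) => //= xN; rewrite ?orbT //.
have /negbTE -> : x \notin allegs (leaf_phases R c (M ++ M)).
  by apply/negP => /sub_leaf_phases; rewrite ends_cat Mq mem_cat orbb (negbTE xN).
by have /negbTE -> : x \notin allegs (pairs R (~~ d) N2 N2) by apply: notin_pairs; rewrite N2q.
Qed.

(** Both linear phases are moved to auxiliary vertices [q] and [q'], so the pivot applies to a
    phase-free pair. It makes [q] and [q'] neighbours of the other side and of each other; their
    leaves then remove them one after the other. *)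
Lemma eliminate_pair w s m a b (a' b' : R) A B F : linear_phase a b -> linear_phase a' b' -> s != m ->
  s \notin ends A -> s \notin ends B -> s \notin allegs F ->
  m \notin ends A -> m \notin ends B -> m \notin allegs F -> graph F ->
  exists F', [/\ feq (Ph s a b :: Ph m a' b' :: Ed w s m :: star s A ++ star m B ++ F) F',
    graph F' & allegs F' =i ends A ++ ends B ++ allegs F].
Proof.
move=> [c [l lin]] [c' [l' lin']] sm sA sB sF mA mB mF gF.
have [p] := bound_ex (s :: m :: ends A ++ ends B ++ allegs F).
rewrite /= !below_cat => /and5P[sp mp pA pB pF].
pose q := p.+1; pose p' := p.+2; pose q' := p.+3; pose f := (l', q').
pose F0 := Ph p' (leaf R c').1 (leaf R c').2 :: Ed false p' q' :: F.
pose F1 := Ph p (leaf R c).1 (leaf R c).2 :: Ed false p q :: F0.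
have e1 : feq (Ph s a b :: Ph m a' b' :: Ed w s m :: star s A ++ star m B ++ F)
    (Ed w s m :: star s ((l, q) :: A) ++ star m (f :: B) ++ F1).
  apply: (@feq_trans _ (Ph m a' b' :: Ed w s m :: star s ((l, q) :: A) ++ star m B ++
      Ph p (leaf R c).1 (leaf R c).2 :: Ed false p q :: F)).
    apply: feq_via (lin p q s (Ph m a' b' :: Ed w s m :: star s A ++ star m B ++ F) _ _ _ _ _) _ _.
    1-5: rewrite /q; fresh_tac.
    - by seqv_tac.
    - by seqv_tac.
  apply: feq_via (lin' p' q' m (Ed w s m :: star s ((l, q) :: A) ++ star m B ++
      Ph p (leaf R c).1 (leaf R c).2 :: Ed false p q :: F) _ _ _ _ _) _ _.
  1-5: rewrite /p' /q' /q; fresh_tac.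
  - by seqv_tac.
  - by rewrite /F1 /F0; seqv_tac.
have e2 := @pivot R ((l, q) :: A) w (f :: B) s m F1 sm.
pose M := sgn (l (+) w) B; pose g := (~~ (l (+) w (+) l'), q').
have Mq : ends M = ends B by rewrite /M ends_sgn.
pose G := pairs R w A (f :: B) ++ units A ++ Ph q' 0%R 0%R :: units B ++ F0.
have e3 : feq (Ph s a b :: Ph m a' b' :: Ed w s m :: star s A ++ star m B ++ F)
    (Ph p (leaf R c).1 (leaf R c).2 :: Ed false p q :: Ph q 0%R 0%R :: star q (g :: M) ++ G).
  apply: feq_trans e1 _; apply: feq_trans (e2 _ _ _ _ _ _) _.
  1-6: rewrite /F1 /F0 /f /p' /q' /q; fresh_tac.
  by apply: feq_seqv; rewrite /G /F1 /F0 [pairs _ _ _ _]/= sgn_cons -/M /g; seqv_tac.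
have pG : p \notin allegs G.
  rewrite /G /F0; do ! (rewrite allegs_cat mem_cat negb_or; apply/andP; split);
    rewrite ?allegs_units; try apply: notin_pairs; rewrite /p' /q' /f /=; fresh_tac.
have qG : q \notin allegs G.
  rewrite /G /F0; do ! (rewrite allegs_cat mem_cat negb_or; apply/andP; split);
    rewrite ?allegs_units; try apply: notin_pairs; rewrite /p' /q' /q /f /=; fresh_tac.
have pq : p != q by rewrite /q neq_ltn ltnSn.
have pM : p \notin ends (g :: M) by rewrite /= Mq /q'; fresh_tac.
have qM : q \notin ends (g :: M) by rewrite /= Mq /q' /q; fresh_tac.
have e4 := @feq_leaf_copy R c p q 0%R 0%R (g :: M) G pq pM pG qM qG.
pose H := pairs R w B A ++ units M ++ leaf_phases R c M ++ units A ++ units B ++ F.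
pose A' := sgn (l' (+) w) A.
have Aq : ends A' = ends A by rewrite /A' ends_sgn.
have rot3 (x y z : node R) L : feq [:: x, y, z & L] [:: y, z, x & L].
  by apply: feq_seqv; seqv_tac.
(* Removing [q] may leave phases on [q']. Their value is immaterial, as copying a basis state
   through [q'] discards any phases. *)
have [a1 [b1 e5]] : exists a1 b1,
    feq (units (g :: M) ++ leaf_phases R c (g :: M) ++ G)
      (Ph p' (leaf R c').1 (leaf R c').2 :: Ed false p' q' :: Ph q' a1 b1 :: star q' A' ++ H).
  have e6 : feq (units (g :: M) ++ leaf_phases R c (g :: M) ++ G)
      (units [:: g] ++ leaf_phases R c [:: g] ++ units [:: g] ++ Ph p' (leaf R c').1 (leaf R c').2 ::
       Ed false p' q' :: star q' A' ++ H).
    apply: feq_seqv => P hP; have := count_pairs w A (f :: B) hP.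
    rewrite /G /H /F0 /= -/A' !(count_cat, count_cat, map_cat) /= !count_cat /= => ->.
    by case: (c); rewrite /= ?count_cat /= ?count_cat; gen_counts P; clear; intros; lia.
  pose r := Ph p' (leaf R c').1 (leaf R c').2 :: Ed false p' q' :: star q' A' ++ H.
  case: (c) e6 => e6.
    exists (0 + (pauli R (false (+) g.1)).1 + 0)%R, (0 + (pauli R (false (+) g.1)).2 + 0)%R.
    apply: feq_trans e6 _.
    apply: (@feq_trans _ (Ph q' (0 + (pauli R (false (+) g.1)).1)%R
        (0 + (pauli R (false (+) g.1)).2)%R :: Ph q' 0%R 0%R :: r)).
      by apply: feq_phase_add.
    by apply: feq_trans (feq_phase_add _ _ _ _ _ _) _; exact: rot3.
  exists (0 + 0)%R, (0 + 0)%R; apply: feq_trans e6 _.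
  by apply: feq_trans (feq_phase_add _ _ _ _ _ _) _; exact: rot3.
have pH : p' \notin allegs H.
  rewrite /H; do ! (rewrite allegs_cat mem_cat negb_or; apply/andP; split);
    rewrite ?allegs_units; try apply: notin_pairs; rewrite ?Mq;
    try (apply/negP => /sub_leaf_phases; apply/negP; rewrite Mq); rewrite /p'; fresh_tac.
have qH : q' \notin allegs H.
  rewrite /H; do ! (rewrite allegs_cat mem_cat negb_or; apply/andP; split);
    rewrite ?allegs_units; try apply: notin_pairs; rewrite ?Mq;
    try (apply/negP => /sub_leaf_phases; apply/negP; rewrite Mq); rewrite /q'; fresh_tac.
have pq' : p' != q' by rewrite /p' /q' neq_ltn ltnSn.
have pA' : p' \notin ends A' by rewrite Aq /p'; fresh_tac.
have qA' : q' \notin ends A' by rewrite Aq /q'; fresh_tac.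
have e6 := @feq_leaf_copy R c' p' q' a1 b1 A' H pq' pA' pH qA' qH.
exists (units A' ++ leaf_phases R c' A' ++ H); split.
- exact: feq_trans e3 (feq_trans e4 (feq_trans e5 e6)).
- by rewrite !graph_cat !graph_units !graph_leaf_phases graph_pairs gF.
move=> x; rewrite !allegs_cat !mem_cat !allegs_units Aq Mq.
case: (boolP (x \in ends A)) => //= xA.
case: (boolP (x \in ends B)) => //= xB; rewrite ?orbT //.
have /negbTE -> : x \notin allegs (leaf_phases R c' A').
  by apply/negP => /sub_leaf_phases; rewrite Aq (negbTE xA).
have /negbTE -> : x \notin allegs (leaf_phases R c M).
  by apply/negP => /sub_leaf_phases; rewrite Mq (negbTE xB).
by have /negbTE -> : x \notin allegs (pairs R w B A) by apply: notin_pairs.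
Qed.

End Elimination.

(** * Graphs and graph-like diagrams *)

Section NormalForm.
Variable R : realType.
Implicit Types (C L F G B : seq (node R)) (N : seq (bool * nat)) (h : node R).
Implicit Types (a b : R) (d l : bool) (u v x y : nat) (vs : seq nat) (ph : nat -> R * R).

Definition phases ph vs : seq (node R) := [seq Ph v (ph v).1 (ph v).2 | v <- vs].

Definition is_box h : bool := ~~ is_spider h.

Definition key h : nat * nat :=
  if h is Hbox _ x y then (minn x y, maxn x y) else (0, 0).

Definition simple B : bool :=
  all (fun h => is_box h && uniq (legs h)) B && uniq (map key B).

Lemma seqv_perm F F' : perm_eq F F' -> seqv F F'.
Proof. by move=> /permP e P _. Qed.

Lemma absorb u a b ph vs F : u \in vs -> uniq vs ->
  exists ph', feq (Ph u a b :: phases ph vs ++ F) (phases ph' vs ++ F).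
Proof.
move=> u_vs uvs; pose ph' v := if v == u then (a + (ph u).1, b + (ph u).2)%R else ph v.
have e := perm_to_rem u_vs; exists ph'.
have e' f : seqv (phases f vs) (Ph u (f u).1 (f u).2 :: phases f (rem u vs)).
  exact: seqv_perm (perm_map _ e).
apply: (@feq_trans _ (Ph u a b :: Ph u (ph u).1 (ph u).2 :: phases ph (rem u vs) ++ F)).
  by apply: feq_seqv => P hP; rewrite /= !count_cat e' //= !addnA.
apply: feq_trans (feq_phase_add _ _ _ _ _ _) _.
have -> : phases ph (rem u vs) = phases ph' (rem u vs).
  by apply/eq_in_map => v; rewrite mem_rem_uniq // inE /ph' => /andP[/negbTE ->].
apply: feq_seqv => P hP; rewrite /= !count_cat (e' ph') //= /ph' eqxx /=.
by rewrite addnA.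
Qed.

Lemma absorb_unit u ph vs F : u \in vs -> feq (Ph u 0%R 0%R :: phases ph vs ++ F) (phases ph vs ++ F).
Proof.
move=> u_vs; apply: feq_unit; rewrite allegs_cat mem_cat; apply/orP; left.
elim: vs u_vs => // v vs IH; rewrite in_cons [phases _ _]/= allegs_cons mem_cat => /predU1P[->|/IH ->].
  by rewrite /= mem_head.
by rewrite orbT.
Qed.

Lemma collect vs F ph B : uniq vs -> graph F -> {subset allegs F <= vs} ->
  exists ph' B', [/\ feq (F ++ phases ph vs ++ B) (phases ph' vs ++ B'),
    all is_box B' = all is_box B & {subset allegs B' <= allegs F ++ allegs B}].
Proof.
move=> uvs; elim: F ph B => [|p F IH] ph B; first by move=> _ _; exists ph, B; split=> //; apply: feq_refl.
case/andP=> gp gF sub; have subF : {subset allegs F <= vs}.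
  by move=> x xF; apply: sub; rewrite allegs_cons mem_cat xF orbT.
case: p gp sub => // [[|//] [|u [|//]] // a b _ sub|d x y _ sub].
  have u_vs : u \in vs by apply: sub; rewrite allegs_cons mem_cat mem_head.
  have [ph1 e1] := absorb a b ph (F ++ B) u_vs uvs.
  have [ph2 [B2 [e2 h2 s2]]] := IH ph1 B gF subF.
  exists ph2, B2; split=> //.
    apply: feq_trans e2; apply: feq_via e1 _ _; seqv_tac.
  by move=> z /s2; rewrite allegs_cons !mem_cat => /orP[->|->]; rewrite !orbT.
have [ph2 [B2 [e2 h2 s2]]] := IH ph (Ed d x y :: B) gF subF.
exists ph2, B2; split=> //; first by apply: feq_via e2 _ _; seqv_tac.
by move=> z /s2; rewrite !allegs_cons !mem_cat; do 3 case: (_ \in _).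
Qed.

Lemma dup_image (T : eqType) (f : node R -> T) B : ~~ uniq (map f B) ->
  exists h k B', perm_eq B [:: h, k & B'] /\ f h = f k.
Proof.
elim: B => //= h B IH; rewrite negb_and negbK => /orP[/mapP[k kB ek]|/IH[k [k' [B' [e ek]]]]].
  exists h, k, (rem k B); split=> //; rewrite perm_cons; exact: perm_to_rem.
exists k, k', (h :: B'); split=> //.
apply/permP => P; rewrite /= (permP e) /=; lia.
Qed.

Lemma key_eq d e x y u v : key (Hbox d x y) = key (Hbox e u v) ->
  x = u /\ y = v \/ x = v /\ y = u.
Proof. by case; lia. Qed.

(** A loop becomes a phase, two equal parallel edges become one edge of the other type, and two
    opposite ones vanish. Each reduction lowers the number of boxes. *)
Lemma normalise vs ph B : uniq vs -> all is_box B -> {subset allegs B <= vs} ->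
  exists ph' B', [/\ feq (phases ph vs ++ B) (phases ph' vs ++ B'), simple B' &
    {subset allegs B' <= vs}].
Proof.
move=> uvs; have [k] := ubnP (size B).
elim: k B ph => // k IH B ph lt_k boxB sub.
have [uB|] := boolP (all (fun h => uniq (legs h)) B); last first.
  case/allPn => h hB; have e := perm_to_rem hB.
  case: h hB e (allP boxB h hB) => // d x y hB e _; rewrite /= andbT inE negbK => /eqP exy.
  rewrite -{y}exy in hB e *.
  have s_rem : {subset allegs (rem (Ed d x x) B) <= allegs B}.
    by move=> z zr; rewrite (perm_mem (perm_allegs e)) allegs_cons mem_cat zr orbT.
  have x_vs : x \in vs by apply: sub; rewrite (perm_mem (perm_allegs e)) allegs_cons mem_cat mem_head.
  have [ph1 e1] := absorb (euler_phase R (~~ d)) (euler_phase R (~~ d)) ph (rem (Ed d x x) B) x_vs uvs.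
  have [||| ph2 [B2 [e2 s2 sub2]]] := IH (rem (Ed d x x) B) ph1.
  - by move: lt_k; rewrite (perm_size e) /=; lia.
  - by apply/allP => z /mem_rem; apply: (allP boxB).
  - by move=> z /s_rem; apply: sub.
  exists ph2, B2; split=> //; apply: feq_trans e2; apply: feq_trans e1.
  apply: feq_via (@feq_loop R d x (phases ph vs ++ rem (Ed d x x) B)) _ _; last by [].
  by move=> P hP; rewrite /= !count_cat (permP e) /=; lia.
have [uk|] := boolP (uniq (map key B)).
  exists ph, B; split=> //; first exact: feq_refl.
  by rewrite /simple uk andbT; apply/allP => h hB; rewrite (allP boxB) ?(allP uB).
case/dup_image => h [k' [B' [e]]].
have boxB' : all is_box [:: h, k' & B'] by rewrite -(perm_all _ e).
have sub' : {subset allegs [:: h, k' & B'] <= vs}.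
  by move=> z; rewrite -(perm_mem (perm_allegs e)); exact: sub.
have sz : (size B').+1 < k by move: lt_k; rewrite (perm_size e) /=; lia.
case/and3P: boxB'; case: h e sub' => // d x y; case: k' => // d' u v e sub' _ _ boxB' /key_eq ek.
have x_vs : x \in vs by apply: sub'; rewrite allegs_cons mem_cat mem_head.
have y_vs : y \in vs by apply: sub'; rewrite allegs_cons mem_cat /= !inE eqxx orbT.
have e1 : seqv (phases ph vs ++ B) (Ed d x y :: Ed d' x y :: phases ph vs ++ B').
  move=> P hP; rewrite /= !count_cat (permP e) /=.
  by case: ek => -[-> ->]; rewrite ?(hP d' v u); lia.
have subB' : {subset allegs B' <= vs}.
  by move=> z zB; apply: sub'; rewrite !allegs_cons !mem_cat zB !orbT.
have [edd|] := eqVneq d d'.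
  rewrite -edd in e1; have [||| ph2 [B2 [e2 s2 sub2]]] := IH (Ed (~~ d) x y :: B') ph => //.
    by move=> z; rewrite allegs_cons mem_cat => /orP[|/subB' //]; rewrite /= !inE => /orP[] /eqP ->.
  exists ph2, B2; split=> //; apply: feq_trans e2.
  apply: feq_via (@feq_parallel R d x y (phases ph vs ++ B')) e1 _; seqv_tac.
move=> dd'; have {dd'} ed : d' = ~~ d by case: d d' dd' {e sub' e1} => [] [].
rewrite ed in e1; have [||| ph2 [B2 [e2 s2 sub2]]] := IH B' ph => //; first by lia.
exists ph2, B2; split=> //; apply: feq_trans e2.
apply: feq_trans (feq_via (@feq_Hopf R d x y (phases ph vs ++ B')) e1 (fun P _ => erefl)) _.
apply: feq_trans (_ : feq _ (Ph y 0%R 0%R :: phases ph vs ++ B')) _.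
  apply: feq_unit; rewrite allegs_cons mem_cat; apply/orP; right.
  rewrite allegs_cat mem_cat; apply/orP; left.
  by elim: (vs) x_vs => // z zs IHz; rewrite in_cons [phases _ _]/= allegs_cons mem_cat
    => /predU1P[->|/IHz ->]; rewrite ?orbT //= mem_head.
exact: absorb_unit.
Qed.

Lemma graph_normal_form F : graph F ->
  exists ph B, [/\ feq F (phases ph (undup (allegs F)) ++ B), simple B
    & {subset allegs B <= undup (allegs F)}].
Proof.
move=> gF; set vs := undup (allegs F).
have uvs : uniq vs by apply: undup_uniq.
have subF : {subset allegs F <= vs} by move=> x; rewrite mem_undup.
have [ph [B [e1 boxB sB]]] := collect (fun=> (0, 0)%R) [::] uvs gF subF.
rewrite cats0 in e1; have [|ph' [B' [e2 sB' sub']]] := normalise ph uvs boxB.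
  by move=> x /sB; rewrite cats0; exact: subF.
exists ph', B'; split=> //; apply: feq_trans e2; apply: feq_trans e1.
(* [collect] expects a phase at every vertex, so trivial ones are added first; the labels [true] are
   arbitrary. *)
pose N := [seq (true, v) | v <- vs].
have eN : ends N = vs by rewrite /N; elim: (vs) => //= z zs ->.
have eZ : units N = phases (fun=> (0, 0)%R) vs by rewrite /N; elim: (vs) => //= z zs ->.
apply: feq_sym; have := @feq_units R N F; rewrite eN eZ => h.
apply: feq_via (h _) _ _; [|seqv_tac|by []].
by move=> x; rewrite mem_undup.
Qed.

(** The clause on keys traces each neighbour back to an edge of [B]. With distinct keys this shows
    that once an edge has been set aside, no second edge has the same ends. *)
Lemma extract_star v B : all (fun h => is_box h && uniq (legs h)) B ->
  exists N B', [/\ seqv B (star v N ++ B'), v \notin ends N, v \notin allegs B',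
    all is_box B' & {subset ends N ++ allegs B' <= allegs B} /\
    (forall y, y \in ends N -> exists2 h, h \in B & key h = key (Hbox (R := R) false v y)) /\
    {subset B' <= B}].
Proof.
elim: B => [|h B IH]; first by exists [::], [::].
rewrite [all _ _]/= => /andP[/andP[bh uh]] /IH[N [B' [e vN vB bB [sub [hN sB]]]]].
case: h bh uh => // d x y _; rewrite /= andbT inE => xy.
have star z : z != v -> (forall P : pred (node R), sym_pred P -> P (Ed d x y) = P (Ed d v z)) ->
    key (Hbox (R := R) d x y) = key (Hbox (R := R) false v z) -> z \in [:: x; y] ->
    exists N B', [/\ seqv (Ed d x y :: B) (star v N ++ B'), v \notin ends N, v \notin allegs B',
    all is_box B' & {subset ends N ++ allegs B' <= allegs (Ed d x y :: B)} /\
    (forall t, t \in ends N -> exists2 h, h \in (Ed d x y :: B) & key h = key (Hbox (R := R) false v t)) /\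
    {subset B' <= Ed d x y :: B}].
  move=> zv hP hk z_xy; exists ((d, z) :: N), B'; split=> //.
  - by move=> P sP; rewrite /= e // (hP P sP).
  - by rewrite /= inE negb_or eq_sym zv.
  split; [|split].
  - move=> w; rewrite mem_cat [ends _]/= in_cons allegs_cons mem_cat.
    case/orP=> [/predU1P[->|wN]|wB]; first by rewrite [legs _]/= z_xy.
      by rewrite sub ?orbT // mem_cat wN.
    by rewrite sub ?orbT // mem_cat wB orbT.
  - move=> w; rewrite [ends _]/= in_cons => /predU1P[->|/hN[h hB ek]].
      by exists (Ed d x y); [rewrite inE eqxx | exact: hk].
    by exists h => //; rewrite inE hB orbT.
  by move=> w /sB wB; rewrite inE wB orbT.
have [exv|xv] := eqVneq x v.
  apply: (star y) => //; first by rewrite -exv eq_sym.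
  - by move=> P _; rewrite exv.
  - by rewrite exv.
  by rewrite !inE eqxx orbT.
have [eyv|yv] := eqVneq y v.
  apply: (star x) => //; last by rewrite mem_head.
  - by move=> P sP; rewrite eyv sP.
  by rewrite eyv /key minnC maxnC.
exists N, (Ed d x y :: B'); split=> //.
- by move=> P sP; rewrite /= e // !count_cat /=; lia.
- by rewrite allegs_cons mem_cat negb_or vB /= !inE negb_or ![v == _]eq_sym xv yv.
split; [|split].
- move=> w; rewrite !allegs_cons !mem_cat => /orP[wN|/orP[->|wB]] //.
    by rewrite (sub w) ?orbT // mem_cat wN.
  by rewrite (sub w) ?orbT // mem_cat wB orbT.
- by move=> w /hN[h hB ek]; exists h => //; rewrite inE hB orbT.
by move=> w; rewrite !inE => /orP[->|/sB ->]; rewrite ?orbT.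
Qed.

End NormalForm.

(** * From simple graphs to graph-like diagrams *)

Section GraphDiagrams.
Variable R : realType.
Implicit Types (C L S F G B : seq (node R)) (h : node R) (g f : nat -> nat).
Implicit Types (a b : R) (d l : bool) (i j u v w x y : nat) (vs : seq nat) (ph : nat -> R * R).

(* The wire [w] is attached to the vertex [g w]. *)
Definition vertex ph g C v : node R :=
  Zspider [::] [seq w <- allegs C | g w == v] (ph v).1 (ph v).2.
Definition gdiag vs ph g C : seq (node R) := [seq vertex ph g C v | v <- vs] ++ C.

Record gdiag_ok vs g C : Prop := GdiagOk {
  ok_uniq : uniq vs;
  ok_box : all (@is_box R) C;
  ok_wires : uniq (allegs C);
  ok_ends : {subset map g (allegs C) <= vs} }.

Lemma allegs_vertices vs ph g C :
  allegs [seq vertex ph g C v | v <- vs] = allegs (verts R g (allegs C) vs).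
Proof. by rewrite /allegs /verts -!map_comp. Qed.

Lemma count_gdiag vs ph g C w : gdiag_ok vs g C ->
  count_mem w (allegs (gdiag vs ph g C)) = (w \in allegs C) + (w \in allegs C).
Proof.
case=> uvs _ uC sub; rewrite allegs_cat count_cat allegs_vertices.
by rewrite allegs_verts // !count_uniq_mem.
Qed.

Lemma wfl_gdiag vs ph g C : gdiag_ok vs g C -> wfl (gdiag vs ph g C).
Proof.
by move=> ok; apply/wflP => w; rewrite count_gdiag //; case: (_ \in _); [right|left].
Qed.

Lemma zxe_fuse_all (T : seq nat) (e : nat -> nat) (f : nat -> seq nat) (a b : nat -> R) L :
  wfl ([seq Zspider [::] [:: e v] (a v) (b v) | v <- T] ++
       [seq Zspider [::] (e v :: f v) 0%R 0%R | v <- T] ++ L) ->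
  zxe ([seq Zspider [::] [:: e v] (a v) (b v) | v <- T] ++
       [seq Zspider [::] (e v :: f v) 0%R 0%R | v <- T] ++ L)
      ([seq Zspider [::] (f v) (a v) (b v) | v <- T] ++ L).
Proof.
elim: T L => [|v T IH] L /=; first by move=> _; apply: zxe_refl.
set Q := [seq _ | _ <- T]; set V := [seq _ | _ <- T]; set W := [seq _ | _ <- T] => wf1.
have pe : perm_eq (Zspider [::] [:: e v] (a v) (b v) :: Q ++ Zspider [::] (e v :: f v) 0%R 0%R :: V ++ L)
    [:: Zspider [::] [:: e v] (a v) (b v), Zspider [::] (e v :: f v) 0%R 0%R & Q ++ V ++ L].
  by apply/permP => P; rewrite /= !count_cat /= !count_cat; lia.
have wf2 := wfl_perm (perm_allegs pe) wf1.
have [wf3 e3] := @zxe_fuse R [:: e v] [::] (f v) (a v) (b v) 0%R 0%R _ isT wf2.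
apply: zxe_trans (zxe_perm pe) _; apply: zxe_trans e3 _.
rewrite /= !addr0 in wf3 *.
have pe2 : perm_eq (Zspider [::] (f v) (a v) (b v) :: Q ++ V ++ L)
    (Q ++ V ++ Zspider [::] (f v) (a v) (b v) :: L).
  by apply/permP => P; rewrite /= !count_cat /=; lia.
have wf4 := wfl_perm (perm_allegs pe2) wf3.
apply: zxe_trans (zxe_perm pe2) _; apply: zxe_trans (IH _ wf4) _.
by apply: zxe_perm; rewrite -/W; apply/permP => P; rewrite /= !count_cat /=; clear; lia.
Qed.

(** The drawing keeps the phases of [v] on a separate spider, attached by the wire [k + v]. This
    gives every vertex, even an isolated one, a variable spider, and fusing along these wires yields
    [gdiag]. *)
Lemma gdiag_net vs ph g C : gdiag_ok vs g C -> exists C0 g0 bd0 vs0,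
  net (phases ph vs ++ map (map_node g) C) C0 g0 bd0 vs0 /\
  zxe (draw C0 g0 bd0 vs0) (gdiag vs ph g C).
Proof.
case=> uvs box uC sub; have [k kC] := bound_ex (allegs C).
pose Q := [seq Zspider [::] [:: k + v] (ph v).1 (ph v).2 | v <- vs].
pose g0 w := if w < k then g w else w - k.
have gC : {in allegs C, g0 =1 g} by move=> w /(allP kC); rewrite /g0 => ->.
have gk v : g0 (k + v) = v by rewrite /g0 ltnNge leq_addr addKn.
have aQ : allegs Q = map (addn k) vs.
  by rewrite /Q; elim: (vs) => // v vs' IH; rewrite [map _ _]/= allegs_cons IH.
have u0 : uniq (allegs (Q ++ C)).
  rewrite allegs_cat aQ cat_uniq map_inj_uniq ?uvs ?uC ?andbT /=; last exact: addnI.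
  apply/hasPn => w /(allP kC) wk; apply/mapP => -[v _ e]; move: wk.
  by rewrite e ltnNge leq_addr.
have := net_uniq_intro g0 u0; rewrite map_cat (eq_map_nodes gC).
have -> : map (map_node g0) Q = phases ph vs.
  by rewrite /Q /phases -map_comp; apply: eq_map => v /=; rewrite gk.
have eF w : (w \in map g0 (allegs (Q ++ C))) = (w \in vs).
  rewrite allegs_cat map_cat mem_cat aQ -map_comp.
  have -> : map (g0 \o addn k) vs = vs by rewrite map_id_in // => v _ /=; rewrite gk.
  have -> : map g0 (allegs C) = map g (allegs C) by apply/eq_in_map.
  by case: (boolP (w \in vs)) => //= nw; apply/negbTE; apply: contra nw; exact: sub.
move=> n; have {}n : net (phases ph vs ++ map (map_node g) C) (Q ++ C) g0 (allegs (Q ++ C)) vs.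
  by case: n => *; split=> // w; rewrite eF.
exists (Q ++ C), g0, (allegs (Q ++ C)), vs; split=> //.
have ev : verts R g0 (allegs (Q ++ C)) vs =
    [seq Zspider [::] (k + v :: [seq w <- allegs C | g w == v]) 0%R 0%R | v <- vs].
  apply/eq_in_map => v v_in; rewrite /fiber allegs_cat filter_cat aQ filter_map.
  rewrite (eq_filter (a2 := pred1 v)) => [|u /=]; last by rewrite gk.
  rewrite filter_pred1_uniq //=; congr (Zspider _ (_ :: _)).
  by apply: eq_in_filter => w w_in; rewrite gC.
have pe : perm_eq (draw (Q ++ C) g0 (allegs (Q ++ C)) vs)
    (Q ++ [seq Zspider [::] (k + v :: [seq w <- allegs C | g w == v]) 0%R 0%R | v <- vs] ++ C).
  by rewrite /draw ev -catA perm_cat2l perm_catC.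
apply: zxe_trans (zxe_perm pe) _.
exact: zxe_fuse_all (wfl_perm (perm_allegs pe) (net_wf n)).
Qed.

Lemma gdiag_feq vs ph g C vs' ph' g' C' : gdiag_ok vs g C -> gdiag_ok vs' g' C' ->
  feq (phases ph vs ++ map (map_node g) C) (phases ph' vs' ++ map (map_node g') C') ->
  zxe (gdiag vs ph g C) (gdiag vs' ph' g' C').
Proof.
move=> /(gdiag_net ph)[C0 [g0 [bd0 [vs0 [n0 e0]]]]] /(gdiag_net ph')[C1 [g1 [bd1 [vs1 [n1 e1]]]]].
case=> e; exact: zxe_trans (zxe_sym e0) (zxe_trans (e _ _ _ _ _ _ _ _ n0 n1) e1).
Qed.

Lemma gdiag_exists vs B : uniq vs -> all (@is_box R) B -> {subset allegs B <= vs} ->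
  exists g C, gdiag_ok vs g C /\ map (map_node g) C = B.
Proof.
move=> uvs boxB sub; have [C [g [eB uC _]]] := net_exists B 0.
exists g, C; split=> //; split=> //.
  by move: boxB; rewrite -eB all_map; apply: sub_all => -[].
by rewrite -allegs_map eB.
Qed.

Lemma filter_spiders S C : all (@is_spider R) S -> all (@is_box R) C ->
  [seq p <- S ++ C | is_spider p] = S /\ [seq p <- S ++ C | is_box p] = C.
Proof.
move=> aS aC; rewrite !filter_cat; split.
  rewrite (all_filterP aS) -[RHS]cats0; congr cat; apply/eqP; rewrite -[_ == _]negbK -has_filter.
  by apply/hasPn => p /(allP aC).
rewrite (all_filterP aC) -[RHS]cat0s; congr cat; apply/eqP; rewrite -[_ == _]negbK -has_filter.
by apply/hasPn => p /(allP aS); rewrite /is_box negbK.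
Qed.

Lemma vertices_spiders vs ph g C : all (@is_spider R) [seq vertex ph g C v | v <- vs].
Proof. by rewrite all_map; apply/allP. Qed.

Lemma n_spiders_gdiag vs ph g C : gdiag_ok vs g C ->
  n_spiders (closedD (gdiag vs ph g C)) = size vs.
Proof.
case=> _ box _ _; rewrite /n_spiders -size_filter /=.
have [-> _] := filter_spiders (vertices_spiders vs ph g C) box.
by rewrite size_map.
Qed.

Lemma joins_map p q x y d g ph C u v : p = vertex ph g C u -> q = vertex ph g C v ->
  joins (Hbox d x y) p q -> (minn (g x) (g y), maxn (g x) (g y)) = (minn u v, maxn u v).
Proof.
move=> -> ->; rewrite /= !mem_filter.
case/orP=> /andP[/andP[/eqP -> _] /andP[/eqP -> _]] //.
by rewrite minnC maxnC.
Qed.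

Lemma gdiag_graph_like vs ph g C : gdiag_ok vs g C -> simple (map (map_node g) C) ->
  graph_like (closedD (gdiag vs ph g C)).
Proof.
move=> ok; rewrite /simple all_map -map_comp => /andP[/allP sC uK].
have [uvs box uC sub] := ok.
pose T := [seq vertex ph g C v | v <- vs].
have [fS fC] := filter_spiders (vertices_spiders vs ph g C) box.
have permC L (e : perm_eq (gdiag vs ph g C) L) : perm_eq C [seq p <- L | is_box p].
  by rewrite -fC; apply: perm_filter.
have inT p : p \in gdiag vs ph g C -> is_spider p -> exists2 v, v \in vs & p = vertex ph g C v.
  rewrite mem_cat => /orP[/mapP[v v_in ->]|/(allP box)]; first by exists v.
  by rewrite /is_box => /negbTE ->.
split.
- exact: wfl_gdiag.
- apply/allP => p p_in; apply/implyP => /(inT p p_in)[v _ ->] //.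
- move=> p q L e sp sq; apply/hasPn => w wq; apply/negP => wp.
  have w_in : w \in allegs C.
    have: p \in gdiag vs ph g C by rewrite (perm_mem e) mem_head.
    by move=> /inT/(_ sp)[v _ ep]; move: wp; rewrite /= ep mem_filter => /andP[].
  (* A leg of a vertex is always a box wire, so a wire shared by [p] and [q] would have three
     ends. *)
  have := count_gdiag ph w ok; rewrite w_in (permP (perm_allegs e)) !allegs_cons !count_cat.
  have c1 (z : nat) (zs : seq nat) : z \in zs -> 0 < count_mem z zs by rewrite -has_pred1 has_count.
  have cL : 0 < count_mem w (allegs L).
    apply: c1; have := permC _ e; rewrite /= /is_box sp sq /= => eC.
    move: w_in; rewrite (perm_mem (perm_allegs eC)) => /flattenP[l /mapP[h h_in ->] wh].
    apply/flattenP; exists (legs h) => //; apply: map_f.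
    by move: h_in; rewrite mem_filter => /andP[].
  by have := c1 _ _ wp; have := c1 _ _ wq; move: cL; clear; lia.
- move=> p /inT h /h[v _ ->]; exact: filter_uniq.
- move=> h; rewrite mem_cat => /orP[/mapP[v _ ->] //|h_in _].
  case: h h_in (allP box h h_in) (sC h h_in) => // d x y h_in _; rewrite /= andbT inE => gxy.
  have xC : x \in allegs C by apply/flattenP; exists [:: x; y]; rewrite ?mem_head //; apply/mapP; exists (Hbox d x y).
  have yC : y \in allegs C.
    apply/flattenP; exists [:: x; y]; rewrite ?inE ?eqxx ?orbT //.
    by apply/mapP; exists (Hbox d x y).
  have gx : g x \in vs by apply: sub; apply: map_f.
  have gy : g y \in vs by apply: sub; apply: map_f.
  have gy' : g y \in rem (g x) vs by rewrite mem_rem_uniq // inE eq_sym gxy.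
  exists (vertex ph g C (g x)), (vertex ph g C (g y)).
  exists ([seq vertex ph g C v | v <- rem (g y) (rem (g x) vs)] ++ rem (Hbox d x y) C).
  split=> //; last by rewrite /= !mem_filter !eqxx xC yC.
  have e1 := perm_to_rem h_in; have e2 := perm_map (vertex ph g C) (perm_to_rem gx).
  have e3 := perm_map (vertex ph g C) (perm_to_rem gy').
  apply/permP => P; rewrite count_cat (permP e1) (permP e2) /= (permP e3) /= count_cat.
  by rewrite addnCA -!addnA.
- move=> p q h k L e sp sq; apply/negP => /andP[jh jk].
  have [|u _ ep] := inT p _ sp; first by rewrite (perm_mem e) mem_head.
  have [|v _ eq] := inT q _ sq; first by rewrite (perm_mem e) !inE eqxx orbT.
  case: h e jh => // d x y e jh; case: k e jk => // d' x' y' e jk.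
  have := permC _ e; rewrite /= /is_box sp sq /= => eC.
  move: uK; rewrite (perm_uniq (perm_map _ eC)) /= inE.
  by rewrite (joins_map ep eq jh) (joins_map ep eq jk) eqxx.
- by [].
- by [].
Qed.

End GraphDiagrams.

(** * From graph-like diagrams to simple graphs *)

Section FromDiagrams.
Variable R : realType.
Implicit Types (C L S F G B : seq (node R)) (h p q : node R) (g f : nat -> nat).
Implicit Types (a b : R) (d l : bool) (i j u v w x y : nat) (vs : seq nat) (ph : nat -> R * R).

Lemma graph_like_perm L L' : perm_eq L L' -> graph_like (closedD L) -> graph_like (closedD L').
Proof.
move=> e [w gr np nl ed si _ _]; split=> //.
- exact: wfl_perm (perm_allegs e) w.
- by rewrite /= -(perm_all _ e).
- move=> p q C e'; apply: np; exact: perm_trans e e'.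
- by move=> p; rewrite /= -(perm_mem e); exact: nl.
- move=> h; rewrite /= -(perm_mem e) => h1 h2; have [p [q [C [e' sp sq j]]]] := ed h h1 h2.
  by exists p, q, C; split=> //; apply: perm_trans e'; rewrite perm_sym.
- move=> p q h k C e'; apply: si; exact: perm_trans e e'.
Qed.

Lemma perm_nth2 (x0 : node R) S i j : i < size S -> j < size S -> i != j ->
  exists S', perm_eq S [:: nth x0 S i, nth x0 S j & S'].
Proof.
move=> iS jS ij; set n := size S in iS jS *.
have ii : i \in iota 0 n by rewrite mem_iota.
have jj : j \in rem i (iota 0 n) by rewrite mem_rem_uniq ?iota_uniq // inE eq_sym ij mem_iota.
exists (map (nth x0 S) (rem j (rem i (iota 0 n)))).
rewrite -[X in perm_eq X _](mkseq_nth x0) /mkseq -/n.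
apply: perm_trans (perm_map _ (perm_to_rem ii)) _; rewrite /= perm_cons.
exact: perm_map (perm_to_rem jj).
Qed.

Lemma perm_nth1 (x0 : node R) S i : i < size S ->
  perm_eq S (nth x0 S i :: map (nth x0 S) (rem i (iota 0 (size S)))).
Proof.
move=> iS; have ii : i \in iota 0 (size S) by rewrite mem_iota.
rewrite -[X in perm_eq X _](mkseq_nth x0) /mkseq.
exact: perm_map (perm_to_rem ii).
Qed.

Lemma zxe_legs_all (T : seq nat) (f f' : nat -> node R) L :
  (forall v, v \in T -> exists xs ys zs a b, [/\ f v = Zspider xs ys a b,
     f' v = Zspider [::] zs a b & perm_eq (xs ++ ys) zs]) ->
  wfl (map f T ++ L) -> zxe (map f T ++ L) (map f' T ++ L).
Proof.
elim: T L => [|v T IH] L hT wf1; first exact: zxe_refl.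
have [xs [ys [zs [a [b [fv f'v e]]]]]] := hT v (mem_head _ _).
have wf2 : wfl ([:: f' v] ++ map f T ++ L).
  apply: wfl_perm wf1; rewrite /= !allegs_cons fv f'v /= perm_cat2r //.
apply: (@zxe_trans _ (f' v :: map f T ++ L)).
  apply: (@zxe_local _ [:: f v] [:: f' v]) => //.
  by rewrite fv f'v; apply: rule_legs.
have pe : perm_eq (f' v :: map f T ++ L) (map f T ++ f' v :: L).
  by rewrite -cat1s -(cat1s (f' v) L) perm_catCA.
apply: zxe_trans (zxe_perm pe) _.
have hT' u : u \in T -> _ := fun uT => hT u (mem_behead (s := v :: T) uT).
apply: zxe_trans (IH (f' v :: L) hT' (wfl_perm (perm_allegs pe) wf2)) _.
apply: zxe_perm; rewrite perm_sym -(cat1s (f' v) L) -(cat1s v T) map_cat -catA.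
by rewrite perm_catCA.
Qed.

Section Graph.
Variables S C : seq (node R).
Hypothesis aS : all (@is_spider R) S.
Hypothesis aC : all (@is_box R) C.
Hypothesis gl : graph_like (closedD (S ++ C)).

Let x0 : node R := Hbox false 0 0.
(** Vertices are indices in [S] and not nodes, since distinct legless spiders may be equal as
    nodes. *)
Let owner w := find (fun p => w \in legs p) S.

Lemma spider_nth i : i < size S -> nth x0 S i \in S ++ C.
Proof. by move=> iS; rewrite mem_cat mem_nth. Qed.

Lemma spider_disjoint i j w : i < size S -> j < size S ->
  w \in legs (nth x0 S i) -> w \in legs (nth x0 S j) -> i = j.
Proof.
move=> iS jS wi wj; apply/eqP; apply: contraTT isT => ij.
have [S' e] := perm_nth2 x0 iS jS ij.
have e' : perm_eq (S ++ C) [:: nth x0 S i, nth x0 S j & S' ++ C].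
  by rewrite -!cat_cons perm_cat2r.
have := gl_no_plain gl e' (allP aS _ (mem_nth x0 iS)) (allP aS _ (mem_nth x0 jS)).
by move/hasPn/(_ w wj); rewrite /= wi.
Qed.

Lemma ownerE i w : i < size S -> w \in legs (nth x0 S i) -> owner w = i.
Proof.
move=> iS wi; have hw : has (fun p => w \in legs p) S.
  by apply/hasP; exists (nth x0 S i); rewrite ?mem_nth.
apply: (@spider_disjoint _ _ w) => //; first by rewrite -has_find.
exact: nth_find hw.
Qed.

Lemma spider_index p : p \in S ++ C -> is_spider p -> exists2 i, i < size S & p = nth x0 S i.
Proof.
rewrite mem_cat => /orP[p_in _|/(allP aC)]; last by rewrite /is_box => /negbTE ->.
by exists (index p S); rewrite ?index_mem ?nth_index.
Qed.

Lemma box_wire w : w \in allegs C -> owner w < size S /\ w \in legs (nth x0 S (owner w)).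
Proof.
case/flattenP => l /mapP[h hC ->] wh.
have h_in : h \in S ++ C by rewrite mem_cat hC orbT.
have [p [q [L [e sp sq j]]]] := gl_edge gl h_in (allP aC h hC).
have [|i iS ep] := spider_index _ sp; first by rewrite (perm_mem e) !inE eqxx orbT.
have [|k kS eq] := spider_index _ sq; first by rewrite (perm_mem e) !inE eqxx !orbT.
suff [t tS wt] : exists2 t, t < size S & w \in legs (nth x0 S t) by rewrite (ownerE tS wt).
case: h hC h_in wh e j => // d x y _ _; rewrite /= !inE => wxy _.
by rewrite ep eq => /orP[] /andP[xi yk]; case/orP: wxy => /eqP ->; [exists i|exists k|exists k|exists i].
Qed.

(** The wire has two ends; a loop or a plain wire to another spider being excluded, exactly one of
    them lies on a box. *)
Lemma count_spider i w : i < size S -> w \in legs (nth x0 S i) ->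
  count_mem w (allegs C) = 1.
Proof.
move=> iS wi; have /wflP/(_ w) := gl_wf gl.
have e := perm_nth1 x0 iS; rewrite allegs_cat count_cat.
rewrite (permP (perm_allegs e)) allegs_cons count_cat.
rewrite count_uniq_mem; last first.
  exact: (gl_no_loop gl (spider_nth iS) (allP aS _ (mem_nth x0 iS))).
rewrite wi (count_memPn _).
  by case=> //; rewrite addn0 => -[].
apply/negP => /flattenP[l /mapP[p /mapP[j]]].
rewrite mem_rem_uniq ?iota_uniq // inE mem_iota /= => /andP[ji jS] -> -> wj.
by move: ji; rewrite (spider_disjoint jS iS wj wi) eqxx.
Qed.

Lemma uniq_box_wires : uniq (allegs C).
Proof.
apply/count_mem_uniq => w; case: (boolP (w \in allegs C)) => [w_in|/count_memPn //].
have [oS wo] := box_wire w_in; exact: count_spider oS wo.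
Qed.

Lemma legs_owner i : i < size S ->
  perm_eq (legs (nth x0 S i)) [seq w <- allegs C | owner w == i].
Proof.
move=> iS; apply: uniq_perm; rewrite ?filter_uniq ?uniq_box_wires //.
  exact: (gl_no_loop gl (spider_nth iS) (allP aS _ (mem_nth x0 iS))).
move=> w; rewrite mem_filter; apply/idP/andP => [wi|[/eqP <- /box_wire[] //]].
by rewrite (ownerE iS wi) eqxx -has_pred1 has_count (count_spider iS wi).
Qed.

Lemma box_owner d x y : Hbox d x y \in C -> owner x != owner y.
Proof.
move=> hC; have h_in : Hbox d x y \in S ++ C by rewrite mem_cat hC orbT.
have [p [q [L [e sp sq j]]]] := gl_edge gl h_in isT.
have [|i iS ep] := spider_index _ sp; first by rewrite (perm_mem e) !inE eqxx orbT.
have [|k kS eq] := spider_index _ sq; first by rewrite (perm_mem e) !inE eqxx !orbT.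
have e' : perm_eq (S ++ C) [:: p, q, Hbox d x y & L].
  apply: (perm_trans e); apply/permP => P /=; clear; lia.
have /hasPn np := gl_no_plain gl e' sp sq; rewrite ep eq in j np.
have nik : i != k.
  apply/negP => /eqP ik; rewrite ik in np j; move: j => /=.
  by rewrite orbb => /andP[xk _]; have := np x xk; rewrite /= xk.
by case/orP: j => /andP[xi yk]; rewrite (ownerE _ xi) ?(ownerE _ yk) // eq_sym.
Qed.

Lemma simple_owner : simple (map (map_node owner) C).
Proof.
rewrite /simple; apply/andP; split.
  apply/allP => h' /mapP[h hC ->]; case: h hC => [? ? ? ?|? ? ? ?|d x y] hC; try by have := allP aC _ hC.
  by rewrite /= andbT inE (box_owner hC).
rewrite -map_comp; apply: contraT => /dup_image[h [k [C' [e]]]].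
have hC : h \in C by rewrite (perm_mem e) mem_head.
have kC : k \in C by rewrite (perm_mem e) !inE eqxx orbT.
case: h e hC (allP aC h hC) => // d x y e hC _; case: k e kC (allP aC k kC) => // d' u v e kC _.
move=> /= ek.
have mem_h z : z \in [:: x; y] -> z \in allegs C.
  by move=> z_in; apply/flattenP; exists [:: x; y] => //; apply/mapP; exists (Hbox d x y).
have mem_k z : z \in [:: u; v] -> z \in allegs C.
  by move=> z_in; apply/flattenP; exists [:: u; v] => //; apply/mapP; exists (Hbox d' u v).
have [xS wx] := box_wire (mem_h x (mem_head _ _)).
have [yS wy] := box_wire (mem_h y (mem_last x [:: y])).
have [uS wu] := box_wire (mem_k u (mem_head _ _)).
have [vS wv] := box_wire (mem_k v (mem_last u [:: v])).
have [S' eS] := perm_nth2 x0 xS yS (box_owner hC).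
have e' : perm_eq (S ++ C) [:: nth x0 S (owner x), nth x0 S (owner y),
    Hbox d x y, Hbox d' u v & S' ++ C'].
  apply: (perm_trans (perm_cat eS e)); apply/permP => P; rewrite /= !count_cat /=.
  by rewrite -?addnA; do 2 congr addn; rewrite addnCA; congr addn; rewrite addnCA.
have := gl_simple gl e' (allP aS _ (mem_nth x0 xS)) (allP aS _ (mem_nth x0 yS)).
rewrite /= wx wy /=; have := @key_eq R false false (owner x) (owner y) (owner u) (owner v).
case=> // -[-> ->]; first by rewrite wu wv.
by rewrite wu wv orbT.
Qed.

Definition spider_phases i : R * R :=
  if nth x0 S i is Zspider _ _ a b then (a, b) else (0, 0)%R.

Lemma gdiag_ok_owner : gdiag_ok (iota 0 (size S)) owner C.
Proof.
split=> //; [exact: iota_uniq | exact: uniq_box_wires |].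
by move=> v /mapP[w /box_wire[oS _] ->]; rewrite mem_iota.
Qed.

Lemma spider_nthE i : i < size S -> exists xs ys,
  nth x0 S i = Zspider xs ys (spider_phases i).1 (spider_phases i).2.
Proof.
move=> iS; have p_in := mem_nth x0 iS.
have := allP (gl_green gl) _ (spider_nth iS); rewrite (allP aS _ p_in) /= /spider_phases.
by case: (nth x0 S i) => // xs ys a b _; exists xs, ys.
Qed.

(** Only the order of the legs and their status as inputs or outputs differ, which [rule_legs]
    repairs spider by spider. *)
Lemma zxe_gdiag : zxe (S ++ C) (gdiag (iota 0 (size S)) spider_phases owner C).
Proof.
have wf1 : wfl (S ++ C) := gl_wf gl.
have eS : map (nth x0 S) (iota 0 (size S)) = S := mkseq_nth x0 S.
rewrite -{1}eS in wf1; rewrite -[X in zxe (X ++ C)]eS /gdiag.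
apply: zxe_legs_all => // i; rewrite mem_iota /= => iS.
have [xs [ys e]] := spider_nthE iS.
exists xs, ys, [seq w <- allegs C | owner w == i], (spider_phases i).1, (spider_phases i).2.
by split=> //; have := legs_owner iS; rewrite e.
Qed.

End Graph.
End FromDiagrams.

(** * The rewrite steps *)

Section Steps.
Variable R : realType.
Implicit Types (C L S F G B : seq (node R)) (h p q : node R) (g f : nat -> nat).
Implicit Types (a b : R) (d l : bool) (i j u v w x y : nat) (vs : seq nat) (ph : nat -> R * R).

Lemma eq_mod2pi_trans (a b c : R) : eq_mod2pi a b -> eq_mod2pi b c -> eq_mod2pi a c.
Proof.
by move=> [j ->] [k ->]; exists (k + j)%R; rewrite intrD; ring.
Qed.

Lemma linear_phase_mod a b (a' b' : R) : eq_mod2pi a a' -> eq_mod2pi b b' ->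
  linear_phase a' b' -> linear_phase a b.
Proof.
move=> ea eb [c [l lin]]; exists c, l => p q v F h1 h2 h3 h4 h5.
exact: feq_trans (feq_phase v F ea eb) (lin p q v F h1 h2 h3 h4 h5).
Qed.

Lemma third0 : third R 0 = 0%R. Proof. by rewrite /third mul0r. Qed.

Lemma M_linear xs ys a b : M_spider (Zspider xs ys a b) -> linear_phase a b.
Proof.
case=> -[k l] + [/= ha hb]; rewrite !inE => /or3P[] /eqP[ek el]; subst k l;
  apply: (linear_phase_mod ha hb).
- by rewrite third0; exact: (linear_phase0 R).
- exact: (linear_phase_pauli R true).
- exact: (linear_phase_pauli R false).
Qed.

(** Modulo 3: (0, 1) = (2, 2) + (1, 2), (1, 0) = (2, 2) + (2, 1), (0, 2) = (1, 1) + (2, 1) and (2,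
    0) = (1, 1) + (1, 2); P-phases have linear part (0, 0). *)
Lemma NP_quadratic xs ys a b :
  N_spider (Zspider xs ys a b) \/ P_spider (Zspider xs ys a b) ->
  exists d (a' b' : R), linear_phase a' b' /\
    forall v F, feq (Ph v a b :: F) (Ph v (euler_phase R d) (euler_phase R d) :: Ph v a' b' :: F).
Proof.
have split_phases d (a' b' : R) (k m : nat) : linear_phase a' b' ->
    eq_mod2pi (third R k) (euler_phase R d + a')%R -> eq_mod2pi (third R m) (euler_phase R d + b')%R ->
    eq_mod2pi a (third R k) -> eq_mod2pi b (third R m) ->
    exists d (a' b' : R), linear_phase a' b' /\
    forall v F, feq (Ph v a b :: F) (Ph v (euler_phase R d) (euler_phase R d) :: Ph v a' b' :: F).
  move=> lin ek el ea eb; exists d, a', b'; split=> // v F.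
  apply: feq_trans (feq_sym (feq_phase_add v (euler_phase R d) (euler_phase R d) a' b' F)).
  by apply: feq_phase; [exact: eq_mod2pi_trans ea ek | exact: eq_mod2pi_trans eb el].
have t03 : eq_mod2pi (third R 0) (third R 1 + third R 2)%R.
  by exists (- 1)%R; rewrite /third; lra.
have t03' : eq_mod2pi (third R 0) (third R 2 + third R 1)%R.
  by exists (- 1)%R; rewrite /third; lra.
have t14 : eq_mod2pi (third R 1) (third R 2 + third R 2)%R.
  by exists (- 1)%R; rewrite /third; lra.
have t22 : eq_mod2pi (third R 2) (third R 1 + third R 1)%R.
  by exists 0%R; rewrite /third; lra.
have tk k : eq_mod2pi (third R k) (third R k + 0)%R by exists 0%R; rewrite addr0 mul0r addr0.
have lt := @linear_phase_pauli R true; have lf := @linear_phase_pauli R false.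
case=> -[[k l] + [/= ha hb]]; rewrite !inE.
- case/or4P=> /eqP[ek el]; subst k l.
  + exact: (split_phases false _ _ _ _ lt t03' t14 ha hb).
  + exact: (split_phases false _ _ _ _ lf t14 t03' ha hb).
  + exact: (split_phases true _ _ _ _ lf t03 t22 ha hb).
  + exact: (split_phases true _ _ _ _ lt t22 t03 ha hb).
case/orP=> /eqP[ek el]; subst k l.
  exact: (split_phases true _ _ _ _ (linear_phase0 R) (tk 1) (tk 1) ha hb).
exact: (split_phases false _ _ _ _ (linear_phase0 R) (tk 2) (tk 2) ha hb).
Qed.

Lemma allegs_phases ph vs : allegs (phases ph vs) = vs.
Proof. by elim: vs => // v vs IH; rewrite [phases _ _]/= allegs_cons IH. Qed.

Lemma graph_phases ph vs : graph (phases ph vs).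
Proof. by elim: vs. Qed.

Lemma graph_boxes B : all (@is_box R) B -> graph B.
Proof. by apply: sub_all => -[]. Qed.

(** Returns from factor lists to diagrams: the number of spiders is the number of variables
    occurring in [F], whatever its edges reduce to. *)
Lemma gdiag_step vs ph g C F vs' : gdiag_ok vs g C ->
  feq (phases ph vs ++ map (map_node g) C) F -> graph F -> uniq vs' -> allegs F =i vs' ->
  exists L, [/\ zxe (gdiag vs ph g C) L, graph_like (closedD L) &
    n_spiders (closedD L) = size vs'].
Proof.
move=> ok e gF uvs' eF; have [ph2 [B2 [e2 s2 sub2]]] := graph_normal_form gF.
have uvs2 : uniq (undup (allegs F)) by apply: undup_uniq.
have boxB2 : all (@is_box R) B2.
  by case/andP: s2 => + _; apply: sub_all => h /andP[].
have [g2 [C2 [ok2 eB2]]] := gdiag_exists uvs2 boxB2 sub2.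
exists (gdiag (undup (allegs F)) ph2 g2 C2); split.
- by apply: gdiag_feq ok ok2 _; rewrite eB2; exact: feq_trans e e2.
- by apply: gdiag_graph_like => //; rewrite eB2.
rewrite n_spiders_gdiag //; apply: perm_size; apply: uniq_perm => // v.
by rewrite mem_undup eF.
Qed.

Lemma eliminate_NP S C i : all (@is_spider R) S -> all (@is_box R) C ->
  graph_like (closedD (S ++ C)) -> i < size S ->
  N_spider (nth (Hbox false 0 0) S i) \/ P_spider (nth (Hbox false 0 0) S i) ->
  exists L, [/\ zxe (S ++ C) L, graph_like (closedD L) &
    size S = (n_spiders (closedD L)).+1].
Proof.
move=> aS aC gl iS NP; set x0 := Hbox false 0 0 in NP.
pose ph := spider_phases S; pose vs := iota 0 (size S).
pose g w := find (fun p => w \in legs p) S.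
have ok : gdiag_ok vs g C := gdiag_ok_owner aS aC gl.
have sB : simple (map (map_node g) C) := simple_owner aS aC gl.
have e0 : zxe (S ++ C) (gdiag vs ph g C) := zxe_gdiag aS aC gl.
have [xs [ys ei]] := spider_nthE aS gl iS; rewrite ei in NP.
have [d [a' [b' [lin eph]]]] := NP_quadratic NP.
have [N [B' [eB iN iB bB' [subB _]]]] := extract_star i (proj1 (andP sB)).
have i_vs : i \in vs by rewrite mem_iota.
pose vs' := rem i vs.
have uvs : uniq vs := ok_uniq ok.
have uvs' : uniq vs' by apply: rem_uniq.
have endsB : {subset allegs (map (map_node g) C) <= vs}.
  by rewrite allegs_map; exact: ok_ends ok.
pose F := phases ph vs' ++ B'.
have aF : allegs F = vs' ++ allegs B' by rewrite allegs_cat allegs_phases.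
have e1 : feq (phases ph vs ++ map (map_node g) C) (Ph i (ph i).1 (ph i).2 :: star i N ++ F).
  apply: feq_seqv => P hP.
  have := perm_map (fun v => Ph v (ph v).1 (ph v).2) (perm_to_rem i_vs) => /permP/(_ P).
  rewrite !count_cat eB // => -> /=; rewrite !count_cat /=.
  by rewrite -!addnA; congr addn; rewrite addnCA.
have iF : i \notin allegs F by rewrite aF mem_cat negb_or iB andbT mem_rem_uniq // inE eqxx.
have gF : graph F by rewrite graph_cat graph_phases graph_boxes.
have [F' [e2 gF' aF']] := eliminate_quadratic d lin iN iF gF.
have e3 : feq (phases ph vs ++ map (map_node g) C) F'.
  exact: feq_trans e1 (feq_trans (eph _ _) e2).
have sub_vs' v : v != i -> v \in allegs (map (map_node g) C) -> v \in vs'.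
  by move=> vi /endsB; rewrite mem_rem_uniq // inE vi.
have eF' : allegs F' =i vs'.
  move=> v; rewrite aF' mem_cat aF mem_cat.
  have [//|nv] := boolP (v \in vs'); first by rewrite orbT.
  apply/negbTE; apply: contra nv => /orP[vN|/= vB]; apply: sub_vs'.
  - by apply: contraNneq iN => <-.
  - by apply: subB; rewrite mem_cat vN.
  - by apply: contraNneq iB => <-.
  - by apply: subB; rewrite mem_cat vB orbT.
have [L [e4 glL nL]] := gdiag_step ok e3 gF' uvs' eF'.
exists L; split=> //; first exact: zxe_trans e0 e4.
by rewrite nL size_rem // size_iota prednK //; case: (size S) iS.
Qed.

(** Placing [p] and [q] at the head of the spiders makes them the vertices 0 and 1. *)
Lemma eliminate_M_pair p q h S C : all (@is_spider R) [:: p, q & S] ->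
  all (@is_box R) (h :: C) -> graph_like (closedD ([:: p, q & S] ++ h :: C)) ->
  M_spider p -> M_spider q -> joins h p q ->
  exists L, [/\ zxe ([:: p, q & S] ++ h :: C) L, graph_like (closedD L) &
    (size S).+2 = (n_spiders (closedD L)).+2].
Proof.
set T := [:: p, q & S]; set D := h :: C => aS aC gl Mp Mq hpq.
pose ph := spider_phases T; pose vs := iota 0 (size T); pose vs' := iota 2 (size S).
pose g w := find (fun p => w \in legs p) T.
have ok : gdiag_ok vs g D := gdiag_ok_owner aS aC gl.
have sB : simple (map (map_node g) D) := simple_owner aS aC gl.
have e0 : zxe (T ++ D) (gdiag vs ph g D) := zxe_gdiag aS aC gl.
have lin0 : linear_phase (ph 0).1 (ph 0).2.
  have [xs [ys e]] := @spider_nthE R T D aS gl 0 isT.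
  by apply: (@M_linear xs ys); rewrite -e.
have lin1 : linear_phase (ph 1).1 (ph 1).2.
  have [xs [ys e]] := @spider_nthE R T D aS gl 1 isT.
  by apply: (@M_linear xs ys); rewrite -e.
have endsB : {subset allegs (map (map_node g) D) <= vs}.
  by rewrite allegs_map; exact: ok_ends ok.
have uvs' : uniq vs' by apply: iota_uniq.
have own0 w : w \in legs p -> g w = 0.
  by move=> wp; exact: (@ownerE R T D aS gl 0 w isT wp).
have own1 w : w \in legs q -> g w = 1.
  by move=> wq; exact: (@ownerE R T D aS gl 1 w isT wq).
pose B0 := map (map_node g) C.
have [d [eh hk]] : exists d, (forall P, sym_pred P -> P (map_node g h) = P (Ed d 0 1)) /\
    key (map_node g h) = (0, 1).
  case: h hpq {aC gl ok sB e0 endsB D} => // d x y /= /orP[]/andP[hx hy]; exists d.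
    by rewrite (own0 _ hx) (own1 _ hy).
  by rewrite (own1 _ hx) (own0 _ hy); split=> // P hP; exact: hP.
move: sB; rewrite /simple [map _ D]/= -/B0 => /andP[/andP[_ sB0] /= /andP[nk _]].
have [A [B1 [eB0 zA zB1 bB1 [subB1 [kA sB1]]]]] := extract_star 0 sB0.
(* As the keys are distinct, [h] is the only edge between 0 and 1, so the remaining star of 0 avoids
   1. *)
have oA : 1 \notin ends A.
  apply/negP => /kA[h' h'B ek]; move: nk; rewrite hk; apply/negP; rewrite negbK.
  by apply/mapP; exists h'.
have sB1' : all (fun h => is_box h && uniq (legs h)) B1.
  by apply/allP => h' /sB1; exact: (allP sB0).
have [B [B2 [eB1 oB oB2 bB2 [subB2 _]]]] := extract_star 1 sB1'.
have zB : 0 \notin ends B.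
  by apply: contra zB1 => zB; apply: subB2; rewrite mem_cat zB.
have zB2 : 0 \notin allegs B2.
  by apply: contra zB1 => z2; apply: subB2; rewrite mem_cat z2 orbT.
pose F := phases ph vs' ++ B2.
have aF : allegs F = vs' ++ allegs B2 by rewrite allegs_cat allegs_phases.
have e1 : feq (phases ph vs ++ map (map_node g) D)
    (Ph 0 (ph 0).1 (ph 0).2 :: Ph 1 (ph 1).1 (ph 1).2 :: Ed d 0 1 :: star 0 A ++ star 1 B ++ F).
  apply: feq_seqv => P hP; rewrite /= !count_cat /= -/B0 eh // eB0 // count_cat eB1 //.
  rewrite count_cat /vs'.
  by do 2 congr addn; rewrite addnCA; congr addn; rewrite addnCA; congr addn; rewrite addnCA.
have zF : 0 \notin allegs F by rewrite aF mem_cat negb_or zB2 mem_iota.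
have oF : 1 \notin allegs F by rewrite aF mem_cat negb_or oB2 mem_iota.
have gF : graph F by rewrite graph_cat graph_phases graph_boxes.
have [F' [e2 gF' aF']] := @eliminate_pair R d 0 1 _ _ _ _ A B F lin0 lin1 isT zA zB zF oA oB oF gF.
have sub_vs' v : v != 0 -> v != 1 -> v \in allegs (map (map_node g) D) -> v \in vs'.
  by move=> v0 v1 /endsB; rewrite !mem_iota /=; move: v0 v1; clear; lia.
have subB0 : {subset allegs B0 <= allegs (map (map_node g) D)}.
  by move=> v; rewrite [map _ D]/= allegs_cons mem_cat => ->; rewrite orbT.
have eF' : allegs F' =i vs'.
  move=> v; rewrite aF' !mem_cat aF mem_cat.
  have [_|nv] := boolP (v \in vs'); first by rewrite !orbT.
  apply/negbTE; rewrite /=; apply: contra nv => /or3P[vA|vB|vB2].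
  - apply: sub_vs'; [by apply: contraNneq zA => <- | by apply: contraNneq oA => <- |].
    by apply: subB0; apply: subB1; rewrite mem_cat vA.
  - apply: sub_vs'; [by apply: contraNneq zB => <- | by apply: contraNneq oB => <- |].
    apply: subB0; apply: subB1; rewrite mem_cat; apply/orP; right.
    by apply: subB2; rewrite mem_cat vB.
  apply: sub_vs'; [by apply: contraNneq zB2 => <- | by apply: contraNneq oB2 => <- |].
  apply: subB0; apply: subB1; rewrite mem_cat; apply/orP; right.
  by apply: subB2; rewrite mem_cat vB2 orbT.
have [L [e4 glL nL]] := gdiag_step ok (feq_trans e1 e2) gF' uvs' eF'.
exists L; split=> //; first exact: zxe_trans e0 e4.
by rewrite nL size_iota.
Qed.

Lemma perm_spiders L :
  perm_eq L ([seq p <- L | is_spider p] ++ [seq p <- L | is_box p]).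
Proof. by rewrite perm_sym perm_filterC. Qed.

Lemma rewrite_step_NP (D : diagram R) p : closed_diagram D -> graph_like D ->
  p \in dnodes D -> N_spider p \/ P_spider p -> exists E, rewrite_step D E.
Proof.
case: D => ins outs L /= [/= -> ->] gl pL NP.
set S := [seq p <- L | is_spider p]; set C := [seq p <- L | is_box p].
have eL : perm_eq L (S ++ C) := perm_spiders L.
have gl' := graph_like_perm eL gl.
have aS : all (@is_spider R) S := filter_all _ _.
have aC : all (@is_box R) C := filter_all _ _.
have sp : is_spider p by case: p NP {pL} => //= d x y; case.
have pS : p \in S by rewrite mem_filter sp.
have iS : index p S < size S by rewrite index_mem.
have NP' : N_spider (nth (Hbox false 0 0) S (index p S)) \/
  P_spider (nth (Hbox false 0 0) S (index p S)) by rewrite nth_index.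
have [L' [e glL' n]] := eliminate_NP aS aC gl' iS NP'.
exists (closedD L'); split=> //.
  exact: zxe_trans (zxe_perm eL) e.
left; split; first by exists p.
by rewrite -n /n_spiders /= -size_filter.
Qed.

Lemma rewrite_step_M (D : diagram R) : closed_diagram D -> graph_like D ->
  adjacent_M_pair D -> exists E, rewrite_step D E.
Proof.
case: D => ins outs L [/= -> ->] gl M; have [p [q [h [L' [/= e Mp Mq j]]]]] := M.
set S := [seq p <- L' | is_spider p]; set C := [seq p <- L' | is_box p].
have sp : is_spider p by case: p Mp {e j}.
have sq : is_spider q by case: q Mq {e j}.
have bh : is_box h by case: h j {e}.
have eL : perm_eq L ([:: p, q & S] ++ h :: C).
  apply: (perm_trans e); rewrite /= !perm_cons -cat1s.
  by rewrite -(cat1s h C) perm_sym perm_catCA perm_cat2l perm_sym perm_spiders.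
have gl' := graph_like_perm eL gl.
have aS : all (@is_spider R) [:: p, q & S] by rewrite /= sp sq filter_all.
have aC : all (@is_box R) (h :: C) by rewrite /= bh filter_all.
have [L2 [e2 glL n]] := eliminate_M_pair aS aC gl' Mp Mq j.
exists (closedD L2); split=> //; first exact: zxe_trans (zxe_perm eL) e2.
right; split=> //; rewrite -n /n_spiders /= (permP eL) -size_filter.
by have [-> _] := filter_spiders aS aC.
Qed.

End Steps.

Theorem theorem3p9 (R : realType) (D : diagram R) :
  closed_diagram D -> graph_like D ->
  exists D' : diagram R,
    [/\ closed_diagram D', graph_like D' & zx_equiv D D'] /\
    [/\ forall p, p \in dnodes D' -> ~ N_spider p,
        forall p, p \in dnodes D' -> ~ P_spider p
      & ~ adjacent_M_pair D'] /\
    clos_refl_trans_1n (diagram R)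
      (fun E F => rewrite_step E F /\ (n_spiders F < n_spiders E)%N) D D'.
Proof.
have [n] := ubnP (n_spiders D); elim: n D => // n IH D lt_n cD gD.
(* Classical case distinction: as long as some step exists it is taken, and the spider count
   decreases; when none exists, the elimination lemmas exclude all forbidden configurations. *)
have [[E stepE]|no_step] := pselect (exists E, rewrite_step D E).
  have [eDE gE cE dec] := stepE.
  have lt_E : (n_spiders E < n_spiders D)%N by case: dec => -[_ ->]; lia.
  have [D' [[cD' gD' eD'] [nf steps]]] := IH E (leq_trans lt_E lt_n) cE gE.
  exists D'; split; first by split=> //; exact: zx_trans eDE eD'.
  by split=> //; apply: rt1n_trans steps.
exists D; split; first by split=> //; exact: zx_refl.
split; last exact: rt1n_refl.
split=> [p pD Np|p pD Pp|M]; apply: no_step.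
- by apply: rewrite_step_NP pD _ => //; left.
- by apply: rewrite_step_NP pD _ => //; right.
exact: rewrite_step_M.
Qed.
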